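(* Assume $\varepsilon=\hbar(k+N-q_l)$ and $n_a-n_{a+1}\ge3$ for all $1\le a\le v$. Let $\widetilde{\mathcal{W}}^k(\mathfrak{gl}(b_1(n_1-n_2)),(b_1^{n_1-n_2}))$ be the vertex subalgebra of $\mathcal{W}^k(\mathfrak{gl}(N),f)$ generated by $\{W^{(r)}_{i,j}\mid r=1,2,\ 1\le i,j\le n_1-n_2\}$. Then the homomorphism $\Phi_s$ induces a homomorphism $$Y_{\hbar,\varepsilon-(n_s-q_l)\hbar}(\widehat{\mathfrak{sl}}(n_s-n_{s+1}))\to C\big(\mathcal{U}(\mathcal{W}^k(\mathfrak{gl}(N),f)),\ \mathcal{U}(\widetilde{\mathcal{W}}^k(\mathfrak{gl}(b_1(n_1-n_2)),(b_1^{n_1-n_2})))\big),$$ where the target is the centralizer in $\mathcal{U}(\mathcal{W}^k(\mathfrak{gl}(N),f))$ of (the image of) $\mathcal{U}(\widetilde{\mathcal{W}}^k(\mathfrak{gl}(b_1(n_1-n_2)),(b_1^{n_1-n_2})))$.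
   Context: **Partition data.** $\hbar\in\mathbb{C}\setminus\{0\}$, $k\in\mathbb{C}$; $N=q_1+\dots+q_l$ with integers $q_1\geq\cdots\geq q_l\geq 1$. Let $n_1>n_2>\dots>n_v$ be the distinct values of the $q_i$ (so $n_1=q_1$, $n_v=q_l$), $n_{v+1}=0$, and $b_a=\#\{i: q_i\geq n_a\}$. Put $\alpha_s=k+N-q_s$, $\gamma_s=\sum_{u=s+1}^l\alpha_u$. **W-algebra.** For $1\le i\le N$ let $\mathrm{col}(i)=s$ if $\sum_{j<s}q_j<i\le\sum_{j\le s}q_j$, and $\mathrm{row}(i)=i-\sum_{j<\mathrm{col}(i)}q_j+q_1-q_{\mathrm{col}(i)}$. Let $f=\sum_j E_{\hat j,j}$, where $\mathrm{col}(\hat j)=\mathrm{col}(j)+1$, $\mathrm{row}(\hat j)=\mathrm{row}(j)$ (sum over those $j$ for which $\hat j$ exists). On $\mathfrak{gl}(N)$ use the form $(E_{i,j}|E_{p,q})=k\delta_{i,q}\delta_{p,j}+\delta_{i,j}\delta_{p,q}$. $\mathcal{W}^k(\mathfrak{gl}(N),f)$ is the vertex algebra obtained by quantum Drinfeld–Sokolov reduction of the universal affine vertex algebra of $\mathfrak{gl}(N)$ with this form, with respect to $f$ (good grading $\deg E_{i,j}=\mathrm{col}(j)-\mathrm{col}(i)$). On $\mathfrak{gl}(q_s)$ let $\kappa_s(E_{i,j},E_{p,q})=\alpha_s\delta_{j,p}\delta_{i,q}+\delta_{i,j}\delta_{p,q}$. Via the Miura map (induced by projection of $\bigoplus_{\mathrm{col}(i)\ge\mathrm{col}(j)}\mathbb{C}E_{i,j}$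 to its block-diagonal part $\bigoplus_s\mathfrak{gl}(q_s)$), $\mathcal{W}^k(\mathfrak{gl}(N),f)$ is a vertex subalgebra of $\bigotimes_{s=1}^lV^{\kappa_s}(\mathfrak{gl}(q_s))$, where $V^{\kappa_s}(\mathfrak{gl}(q_s))=U(t^{-1}\mathfrak{gl}(q_s)[t^{-1}])$ is the universal affine vertex algebra. **Elements $W^{(r)}_{p,q}$.** Write $E^{(s)}_{i+(q_1-q_s),j+(q_1-q_s)}[-u]$ for $E_{i,j}t^{-u}$ in the $s$-th factor, and $E^{(s)}_{p,q}[-u]=0$ unless $q_1-q_s<p,q\le q_1$. For $1\le a\le v$ and $q_1-n_a<p,q\le q_1-n_{a+1}$, the following are elements of $\mathcal{W}^k(\mathfrak{gl}(N),f)$: $W^{(1)}_{p,q}=\sum_{r=1}^lE^{(r)}_{p,q}[-1]$, $W^{(2)}_{p,q}=-\sum_{r=1}^l\gamma_rE^{(r)}_{p,q}[-2]+\sum_{r_1<r_2,\ u>q_1-n_a}E^{(r_1)}_{u,q}[-1]E^{(r_2)}_{p,u}[-1]-\sum_{r_1\ge r_2,\ q_1-q_{r_2}<u\le q_1-n_a}E^{(r_1)}_{u,q}[-1]E^{(r_2)}_{p,u}[-1]$. **Enveloping algebra of a vertex algebra.** For a vertex algebra $V$, $L(V)=V\otimes\mathbb{C}[t^{\pm1}]/\mathrm{Im}(\partial\otimes\mathrm{id}+\mathrm{id}\otimes\frac{d}{dt})$ ($\partial$ the translation operator) with $[ut^a,vt^b]=\sum_{r\ge0}\binom{a}{r}(u_{(r)}v)t^{a+b-r}$.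 $\mathcal{U}(V)$ is the quotient of the standard degreewise completion of $U(L(V))$ by the completed two-sided ideal generated by $(u_{(a)}v)t^b-\sum_{i\ge0}\binom{a}{i}(-1)^i(ut^{a-i}vt^{b+i}-(-1)^avt^{a+b-i}ut^i)$ and $|0\rangle t^{-1}-1$. In $\mathcal{U}(V)$ an element $w\in V$ written without a power of $t$ means $wt^0$. **Affine Yangian.** For $n\ge3$ and parameters $\hbar,\varepsilon$, $Y_{\hbar,\varepsilon}(\widehat{\mathfrak{sl}}(n))$ is the associative algebra generated by $X^\pm_{i,r},H_{i,r}$ ($i\in\mathbb{Z}/n\mathbb{Z}$, $r=0,1$) with relations, where $\{X,Y\}=XY+YX$, $\tilde H_{i,1}=H_{i,1}-\frac\hbar2H_{i,0}^2$, and $a_{i,i}=2$, $a_{i,i\pm1}=-1$, $a_{i,j}=0$ otherwise: $[H_{i,r},H_{j,s}]=0$; $[X^+_{i,0},X^-_{j,0}]=\delta_{i,j}H_{i,0}$; $[X^+_{i,1},X^-_{j,0}]=\delta_{i,j}H_{i,1}=[X^+_{i,0},X^-_{j,1}]$; $[H_{i,0},X^\pm_{j,r}]=\pm a_{i,j}X^\pm_{j,r}$; $[\tilde H_{i,1},X^\pm_{j,0}]=\pm a_{i,j}X^\pm_{j,1}$ if $(i,j)\ne(0,n-1),(n-1,0)$; $[\tilde H_{0,1},X^\pm_{n-1,0}]=\mp(X^\pm_{n-1,1}+(\varepsilon+\frac n2\hbar)X^\pm_{n-1,0})$; $[\tilde H_{n-1,1},X^\pm_{0,0}]=\mp(X^\pm_{0,1}-(\varepsilon+\frac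 n2\hbar)X^\pm_{0,0})$; $[X^\pm_{i,1},X^\pm_{j,0}]-[X^\pm_{i,0},X^\pm_{j,1}]=\pm a_{i,j}\frac\hbar2\{X^\pm_{i,0},X^\pm_{j,0}\}$ if $(i,j)\ne(0,n-1),(n-1,0)$; $[X^\pm_{0,1},X^\pm_{n-1,0}]-[X^\pm_{0,0},X^\pm_{n-1,1}]=\mp\frac\hbar2\{X^\pm_{0,0},X^\pm_{n-1,0}\}+(\varepsilon+\frac n2\hbar)[X^\pm_{0,0},X^\pm_{n-1,0}]$; $(\mathrm{ad}X^\pm_{i,0})^{1+|a_{i,j}|}(X^\pm_{j,0})=0$ for $i\ne j$. It is generated by $X^\pm_{i,0}$ ($0\le i\le n-1$) and $H_{j,1}$ ($1\le j\le n-1$). **The homomorphisms $\Phi_a$.** For $1\le a\le v$, $\Phi_a\colon Y_{\hbar,\varepsilon-(n_a-q_l)\hbar}(\widehat{\mathfrak{sl}}(n_a-n_{a+1}))\to\mathcal{U}(\mathcal{W}^k(\mathfrak{gl}(N),f))$ is the algebra homomorphism determined, with $d=n_1-n_a$ and $1\le i\le n_a-n_{a+1}-1$, by $X^+_{0,0}\mapsto W^{(1)}_{n_1-n_{a+1},d+1}t$, $X^-_{0,0}\mapsto W^{(1)}_{d+1,n_1-n_{a+1}}t^{-1}$, $X^+_{i,0}\mapsto W^{(1)}_{d+i,d+i+1}$, $X^-_{i,0}\mapsto W^{(1)}_{d+i+1,d+i}$, and $H_{i,1}\mapsto-\hbar(W^{(2)}_{d+i,d+i}t-W^{(2)}_{d+i+1,d+i+1}t)-\frac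 i2\hbar(W^{(1)}_{d+i,d+i}-W^{(1)}_{d+i+1,d+i+1})-\hbar W^{(1)}_{d+i,d+i}W^{(1)}_{d+i+1,d+i+1}+\hbar\sum_{s\ge0}\sum_{u=1}^iW^{(1)}_{d+i,d+u}t^{-s}W^{(1)}_{d+u,d+i}t^s+\hbar\sum_{s\ge0}\sum_{u=i+1}^{n_a-n_{a+1}}W^{(1)}_{d+i,d+u}t^{-s-1}W^{(1)}_{d+u,d+i}t^{s+1}-\hbar\sum_{s\ge0}\sum_{u=1}^iW^{(1)}_{d+i+1,d+u}t^{-s}W^{(1)}_{d+u,d+i+1}t^s-\hbar\sum_{s\ge0}\sum_{u=i+1}^{n_a-n_{a+1}}W^{(1)}_{d+i+1,d+u}t^{-s-1}W^{(1)}_{d+u,d+i+1}t^{s+1}$.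
   Formalization: The formal statement takes 2 ≤ s ≤ v; for s = 1 the claim fails, since Φ_1 sends X^+_{1,0} to W^{(1)}_{1,2}, which does not commute with W^{(1)}_{2,1} in the subalgebra. *)

(* Defs.v *)
From HB Require Import structures.
From mathcomp Require Import all_boot all_order all_algebra.
From mathcomp Require Import generic_quotient ring_quotient.
From mathcomp Require Import boolp classical_sets functions reals complex.
From mathcomp Require Import monalg zify.
Set Implicit Arguments.
Unset Strict Implicit.
Unset Printing Implicit Defensive.
Import GRing.Theory.
Local Open Scope ring_scope.
Local Open Scope quotient_scope.

(* Associative unital K-algebras: a ring with a central ring morphism from K.
   MathComp's algType is not used because it requires 1 != 0, which is not
   available for an algebra presented by generators and relations. *)
Record kalg (K : fieldType) := KAlg {
  kring :> pzRingType;
  kscal : {rmorphism K -> kring};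
  kscalC : forall c x, kscal c * x = x * kscal c
}.

Record khom (K : fieldType) (A B : kalg K) := KHom {
  khom_fun :> {rmorphism A -> B};
  khom_scal : forall c, khom_fun (kscal A c) = kscal B c
}.

Section FreeAlgebra.
Variables (K : fieldType) (X : choiceType).

Lemma malgC_central (c : K) (x : {malg K[{fmonom X}]}) :
  malgC c * x = x * malgC c.
Proof.
rewrite !malgM_def fgmulUg fgmulgU; apply: eq_bigr => k _.
by rewrite mul1m mulm1 mulrC.
Qed.

Definition freealg : kalg K :=
  @KAlg K {malg K[{fmonom X}]} (@malgC {fmonom X} K) malgC_central.

Definition fgen (x : X) : freealg := mkmalgU (fmu x) 1.

End FreeAlgebra.
Arguments fgen {K X} x.

Section Quotient.
Variables (K : fieldType) (A : kalg K) (S : A -> Prop).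

Inductive ideal : A -> Prop :=
| ideal_gen x : S x -> ideal x
| ideal0 : ideal 0
| idealB x y : ideal x -> ideal y -> ideal (x - y)
| idealMl a x : ideal x -> ideal (a * x)
| idealMr a x : ideal x -> ideal (x * a).

Definition idealb : pred A := fun x => `[< ideal x >].

Lemma idealb_zmod : zmod_closed idealb.
Proof.
split; first by apply/asboolP; exact: ideal0.
by move=> x y /asboolP hx /asboolP hy; apply/asboolP; exact: idealB.
Qed.

Definition ideal_closed : zmodClosed A :=
  HB.pack idealb (GRing.isZmodClosed.Build A idealb idealb_zmod).

Definition quot_type : Type := @Quotient.quot A ideal_closed.
HB.instance Definition _ := GRing.Zmodule.on quot_type.
HB.instance Definition _ :=
  EqQuotient.on quot_type.

Let pi (x : A) : quot_type := \pi_quot_type x.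

Let piP x y : ideal (x - y) <-> pi x = pi y.
Proof.
split=> [h|h].
  by apply/eqP; rewrite -Quotient.idealrBE; apply/asboolP.
by move/eqP: h; rewrite -Quotient.idealrBE => /asboolP.
Qed.

Let piD x y : pi (x + y) = pi x + pi y.
Proof. by rewrite /pi !piE. Qed.

Let ind (P : quot_type -> Prop) : (forall x, P (pi x)) -> forall q, P q.
Proof. by move=> h q; rewrite -[q]reprK. Qed.

Definition quot_mul (x y : quot_type) : quot_type := pi (repr x * repr y).

Let piM x y : pi (x * y) = quot_mul (pi x) (pi y).
Proof.
apply/piP; set x' := repr (pi x); set y' := repr (pi y).
have hx : ideal (x - x') by apply/piP; rewrite /x' /pi reprK.
have hy : ideal (y' - y) by apply/piP; rewrite /y' /pi reprK.
have -> : x * y - x' * y' = (x - x') * y - x' * (y' - y).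
  by rewrite mulrBl mulrBr opprB addrA subrK.
by apply: idealB; [exact: idealMr | exact: idealMl].
Qed.

Lemma quot_mulA : associative quot_mul.
Proof.
by elim/ind=> x; elim/ind=> y; elim/ind=> z; rewrite -!piM mulrA.
Qed.

Lemma quot_mul1q : left_id (pi 1) quot_mul.
Proof. by elim/ind=> x; rewrite -piM mul1r. Qed.

Lemma quot_mulq1 : right_id (pi 1) quot_mul.
Proof. by elim/ind=> x; rewrite -piM mulr1. Qed.

Lemma quot_mulDl : left_distributive quot_mul +%R.
Proof.
by elim/ind=> x; elim/ind=> y; elim/ind=> z; rewrite -!(piM, piD) mulrDl.
Qed.

Lemma quot_mulDr : right_distributive quot_mul +%R.
Proof.
by elim/ind=> x; elim/ind=> y; elim/ind=> z; rewrite -!(piM, piD) mulrDr.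
Qed.

HB.instance Definition _ := GRing.Zmodule_isPzRing.Build quot_type
  quot_mulA quot_mul1q quot_mulq1 quot_mulDl quot_mulDr.

Definition quot_proj (x : A) : quot_type := \pi_quot_type x.

Lemma quot_proj_zmod : zmod_morphism quot_proj.
Proof. by move=> x y; rewrite /quot_proj !piE. Qed.

Lemma quot_proj_monoid : monoid_morphism quot_proj.
Proof. by split=> // x y; exact: piM. Qed.

HB.instance Definition _ :=
  GRing.isZmodMorphism.Build A quot_type quot_proj quot_proj_zmod.
HB.instance Definition _ :=
  GRing.isMonoidMorphism.Build A quot_type quot_proj quot_proj_monoid.

Definition quot_scal : {rmorphism K -> quot_type} := quot_proj \o kscal A.

Lemma quot_scalC c x : quot_scal c * x = x * quot_scal c.
Proof.
elim/ind: x => x; rewrite -[quot_scal c]/(pi (kscal A c)).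
by rewrite -[LHS]piM -[RHS]piM kscalC.
Qed.

Definition quotalg : kalg K := KAlg quot_scalC.

Definition qpi : khom A quotalg :=
  @KHom K A quotalg quot_proj (fun=> erefl).

Lemma qpi_eq x y : qpi x = qpi y <-> ideal (x - y).
Proof. by split=> /piP. Qed.

Lemma qpi_surj (z : quotalg) : exists x, qpi x = z.
Proof. by exists (repr (z : quot_type)); rewrite /= /quot_proj reprK. Qed.

End Quotient.
Arguments quotalg {K A} S.
Arguments qpi {K A} S.

Section Subalgebra.
Variables (K : fieldType) (A : kalg K) (P : A -> Prop).

Record subalg_closed : Prop := SubalgClosed {
  subalg_scal : forall c, P (kscal A c);
  subalgB : forall x y, P x -> P y -> P (x - y);
  subalgM : forall x y, P x -> P y -> P (x * y)
}.

Hypothesis HP : subalg_closed.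

Definition subalg_pred of subalg_closed : pred A := fun x => `[< P x >].
Local Notation S := (subalg_pred HP).

Lemma subalg_pred_subring : subring_closed S.
Proof.
split=> [|x y /asboolP hx /asboolP hy|x y /asboolP hx /asboolP hy].
- by apply/asboolP; rewrite -(rmorph1 (kscal A)); exact: subalg_scal.
- by apply/asboolP; exact: subalgB.
- by apply/asboolP; exact: subalgM.
Qed.

Definition subalg_type : Type := {x : A | S x}.
HB.instance Definition _ := SubChoice.on subalg_type.
HB.instance Definition _ :=
  GRing.SubChoice_isSubPzRing.Build A S subalg_type subalg_pred_subring.

Definition subalg_in (x : A) (hx : P x) : subalg_type :=
  exist _ x (asboolT hx).

Definition subalg_scal_fun (c : K) : subalg_type :=
  subalg_in (subalg_scal HP c).

Lemma subalg_scal_zmod : zmod_morphism subalg_scal_fun.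
Proof. by move=> x y; apply: val_inj; rewrite /= rmorphB. Qed.

Lemma subalg_scal_monoid : monoid_morphism subalg_scal_fun.
Proof.
by split=> [|x y]; apply: val_inj; rewrite /= (rmorph1, rmorphM).
Qed.

HB.instance Definition _ :=
  GRing.isZmodMorphism.Build K subalg_type subalg_scal_fun subalg_scal_zmod.
HB.instance Definition _ :=
  GRing.isMonoidMorphism.Build K subalg_type subalg_scal_fun
    subalg_scal_monoid.

Lemma subalg_scalC c x : subalg_scal_fun c * x = x * subalg_scal_fun c.
Proof. by apply: val_inj; rewrite /= kscalC. Qed.

Definition subalg : kalg K :=
  @KAlg K subalg_type subalg_scal_fun subalg_scalC.

Definition sval_fun (x : subalg_type) : A := val x.
Lemma sval_zmod : zmod_morphism sval_fun. Proof. by []. Qed.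
Lemma sval_monoid : monoid_morphism sval_fun. Proof. by []. Qed.
HB.instance Definition _ :=
  GRing.isZmodMorphism.Build subalg_type A sval_fun sval_zmod.
HB.instance Definition _ :=
  GRing.isMonoidMorphism.Build subalg_type A sval_fun sval_monoid.

Definition subalg_incl : khom subalg A :=
  @KHom K subalg A sval_fun (fun _ => erefl).

Lemma subalg_inclP (x : subalg) : P (subalg_incl x).
Proof. by have /asboolP := valP (x : subalg_type). Qed.

End Subalgebra.

Section FunctionAlgebra.
Variables (K : fieldType) (A : kalg K).

Definition fscal (c : K) : nat -> A := fun=> kscal A c.

Lemma fscal_zmod : zmod_morphism fscal.
Proof. by move=> x y; apply/funext => m; rewrite /fscal rmorphB. Qed.
Lemma fscal_monoid : monoid_morphism fscal.
Proof.
by split=> [|x y]; apply/funext => m; rewrite /fscal (rmorph1, rmorphM).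
Qed.
HB.instance Definition _ :=
  GRing.isZmodMorphism.Build K (nat -> A) fscal fscal_zmod.
HB.instance Definition _ :=
  GRing.isMonoidMorphism.Build K (nat -> A) fscal fscal_monoid.

Lemma fscalC c x : fscal c * x = x * fscal c.
Proof. by apply/funext => m; exact: kscalC. Qed.

Definition seqalg : kalg K := @KAlg K (nat -> A) fscal fscalC.
End FunctionAlgebra.

Section Centralizer.
Variables (K : fieldType) (A : kalg K) (S : A -> Prop).

Lemma centralizer_closed :
  subalg_closed (fun x : A => forall y, S y -> x * y = y * x).
Proof.
split=> [c y _|x x' hx hx' y hy|x x' hx hx' y hy]; first exact: kscalC.
  by rewrite mulrBl mulrBr hx // hx'.
by rewrite -mulrA hx' // mulrA hx // mulrA.
Qed.

Definition centralizer : kalg K := subalg centralizer_closed.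
End Centralizer.

Section GeneralizedBinomial.
Variable K : fieldType.
Definition binz (a : int) (j : nat) : K :=
  (\prod_(i < j) (a%:~R - i%:R)) / (j`!)%:R.
End GeneralizedBinomial.
Arguments binz {K} a j.

Section VertexAlgebras.
Variable K : fieldType.

(* For a family of products u_(n) v, the Borcherds identity
     sum_j binom(m,j) (u_(n+j) v)_(m+l-j) w
       = sum_j (-1)^j binom(n,j) (u_(m+n-j) (v_(l+j) w)
                                   - e (-1)^n v_(n+l-j) (u_(m+j) w)),
   where e is the sign of the exchange of u and v.  The sums over j >= 0 are
   cut at any M beyond which all their terms vanish. *)
Definition borcherds (V : lmodType K) (pr : int -> V -> V -> V) (e : K)
    (u v w : V) : Prop :=
  forall (m n l : int) (M : nat),
  (forall j : nat, (M <= j)%N ->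
    [/\ pr (n + j%:Z) u v = 0, pr (l + j%:Z) v w = 0
      & pr (m + j%:Z) u w = 0]) ->
  \sum_(j < M) binz m j *: pr (m + l - j%:Z) (pr (n + j%:Z) u v) w =
  \sum_(j < M) ((-1) ^+ j * binz n j) *:
    (pr (m + n - j%:Z) u (pr (l + j%:Z) v w)
     - (e * (-1) ^ n) *: pr (n + l - j%:Z) v (pr (m + j%:Z) u w)).

Record vertex_core (V : lmodType K) (one : V) (pr : int -> V -> V -> V) :
    Prop := VertexCore {
  core_linl : forall n w c u v, pr n (c *: u + v) w = c *: pr n u w + pr n v w;
  core_linr : forall n w c u v, pr n w (c *: u + v) = c *: pr n w u + pr n w v;
  core_trunc : forall u v, exists M : nat, forall j : nat,
    (M <= j)%N -> pr j%:Z u v = 0;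
  core_vacl : forall n u, pr n one u = if n == -1 then u else 0;
  core_vacr : forall u, pr (-1) u one = u;
  core_vacr0 : forall (n : nat) u, pr n%:Z u one = 0
}.

Record vsalg := VSAlg {
  vs_space :> lmodType K;
  vac : vs_space;
  nprod : int -> vs_space -> vs_space -> vs_space;
  vpar : bool -> vs_space -> Prop;  (* false: even, true: odd *)
  vs_core : vertex_core vac nprod;
  vpar_lin : forall b c u v, vpar b u -> vpar b v -> vpar b (c *: u + v);
  vpar_dec : forall u, exists u0 u1,
    [/\ vpar false u0, vpar true u1 & u = u0 + u1];
  vpar_cap : forall u, vpar false u -> vpar true u -> u = 0;
  vpar_vac : vpar false vac;
  vpar_prod : forall b c n u v,
    vpar b u -> vpar c v -> vpar (b (+) c) (nprod n u v);
  vs_borcherds : forall b c u v w, vpar b u -> vpar c v ->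
    borcherds nprod ((-1) ^+ (b && c)) u v w
}.

Record valg := VAlg {
  va_space : lmodType K;
  va_vac : va_space;
  va_prod : int -> va_space -> va_space -> va_space;
  va_core : vertex_core va_vac va_prod;
  va_borcherds : forall u v w, borcherds va_prod 1 u v w
}.

Section PurelyEven.
Variable V : valg.
Let par (b : bool) (u : va_space V) : Prop := if b then u = 0 else True.


Let pr0l n (w : va_space V) : va_prod n 0 w = 0.
Proof.
have := core_linl (va_core V) n w (-1) 0 0.
by rewrite scaler0 addr0 => ->; rewrite scaleN1r addNr.
Qed.

Let pr0r n (w : va_space V) : va_prod n w 0 = 0.
Proof.
have := core_linr (va_core V) n w (-1) 0 0.
by rewrite scaler0 addr0 => ->; rewrite scaleN1r addNr.
Qed.

Lemma even_par_lin b c u v : par b u -> par b v -> par b (c *: u + v).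
Proof. by case: b => //= -> ->; rewrite scaler0 addr0. Qed.

Lemma even_par_dec u : exists u0 u1,
  [/\ par false u0, par true u1 & u = u0 + u1].
Proof. by exists u, 0; split=> //; rewrite addr0. Qed.

Lemma even_par_prod b c n u v :
  par b u -> par c v -> par (b (+) c) (va_prod n u v).
Proof. by case: b c => [] [] //= => [->|_ ->]; rewrite ?pr0l ?pr0r. Qed.

Lemma even_borcherds b c u v w : par b u -> par c v ->
  borcherds (@va_prod V) ((-1) ^+ (b && c)) u v w.
Proof.
case: b => /=; last by move=> _ _; exact: va_borcherds.
move=> -> _ m n l M _; rewrite !big1 // => j _.
  by rewrite !(pr0l, pr0r) scaler0 subrr scaler0.
by rewrite !pr0l scaler0.
Qed.

Definition super_of : vsalg :=
  @VSAlg (va_space V) (va_vac V) (@va_prod V) par (va_core V)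
    even_par_lin even_par_dec (fun _ _ h => h) I even_par_prod even_borcherds.

End PurelyEven.

Coercion super_of : valg >-> vsalg.

Section VertexSubalgebra.
Variables (V : valg) (P : V -> Prop).

Record subva_closed : Prop := SubvaClosed {
  subva_vac : P (vac V);
  subva_lin : forall c u v, P u -> P v -> P (c *: u + v);
  subva_prod : forall n u v, P u -> P v -> P (nprod n u v)
}.

Hypothesis HP : subva_closed.

Definition subva_pred of subva_closed : pred (va_space V) := fun u => `[< P u >].
Local Notation S := (subva_pred HP).

Lemma subva_submod : submod_closed S.
Proof.
split=> [|c u v /asboolP hu /asboolP hv]; apply/asboolP.
  have := subva_lin HP (-1) (subva_vac HP) (subva_vac HP).
  by rewrite scaleN1r addNr.
exact: subva_lin.
Qed.

Definition subva_type : Type := {u : va_space V | S u}.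
HB.instance Definition _ := SubChoice.on subva_type.
HB.instance Definition _ :=
  GRing.SubChoice_isSubLmodule.Build K (va_space V) S subva_type subva_submod.

Definition subva_in (u : V) (hu : P u) : subva_type := exist _ u (asboolT hu).

Lemma subva_valP (u : subva_type) : P (val u).
Proof. by have /asboolP := valP u. Qed.

Let sv (u : subva_type) : va_space V := val u.
Let sv_lin c x y : sv (c *: x + y) = c *: sv x + sv y.
Proof. exact: (linearP (val : {linear subva_type -> va_space V})). Qed.

Definition subva_nprod (n : int) (u v : subva_type) : subva_type :=
  subva_in (subva_prod HP n (subva_valP u) (subva_valP v)).

Lemma subva_core : vertex_core (subva_in (subva_vac HP)) subva_nprod.
Proof.
split=> [n w c u v|n w c u v|u v|n u|u|n u].
- by apply: val_inj; rewrite [RHS]sv_lin -(core_linl (va_core V)) -sv_lin.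
- by apply: val_inj; rewrite [RHS]sv_lin -(core_linr (va_core V)) -sv_lin.
- have [M hM] := core_trunc (va_core V) (val u) (val v).
  by exists M => j hj; apply: val_inj; rewrite /= hM.
- apply: val_inj; rewrite /= (core_vacl (va_core V)).
  by case: ifP.
- by apply: val_inj; rewrite /= (core_vacr (va_core V)).
- by apply: val_inj; rewrite /= (core_vacr0 (va_core V)).
Qed.

Lemma subva_borcherds u v w : borcherds subva_nprod 1 u v w.
Proof.
have sv0 : sv 0 = 0 by [].
have svD x y : sv (x + y) = sv x + sv y.
  by have := sv_lin 1 x y; rewrite !scale1r.
have svZ c x : sv (c *: x) = c *: sv x.
  by have := sv_lin c x 0; rewrite sv0 !addr0.
have svB x y : sv (x - y) = sv x - sv y.
  by rewrite -!scaleN1r svD svZ.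
move=> m n l M h; apply: val_inj.
rewrite -[LHS]/(sv _) -[RHS]/(sv _) !(big_morph sv svD sv0).
have := @va_borcherds V (val u) (val v) (val w) m n l M.
move=> e; under eq_bigr do rewrite svZ.
rewrite e => [|j /h[h1 h2 h3]]; last first.
  by split; [move: h1 | move: h2 | move: h3] => /(congr1 val).
by apply: eq_bigr => j _; rewrite svZ svB svZ.
Qed.

Definition subva : valg := VAlg subva_core subva_borcherds.

Definition subva_val (u : subva) : V := val (u : subva_type).

End VertexSubalgebra.

Inductive va_span (V : valg) (S : V -> Prop) : V -> Prop :=
| va_span_gen u : S u -> va_span S u
| va_span_vac : va_span S (vac V)
| va_span_lin c u v : va_span S u -> va_span S v -> va_span S (c *: u + v)
| va_span_prod n u v :
    va_span S u -> va_span S v -> va_span S (nprod n u v).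

Lemma va_span_closed (V : valg) (S : V -> Prop) : subva_closed (va_span S).
Proof.
by split; [exact: va_span_vac | exact: va_span_lin | exact: va_span_prod].
Qed.

(* Vertex superalgebras freely generated by a current-type OPE:
     x_(0) y = sum_z br x y z * z + c0 x y * 1,  x_(1) y = c1 x y * 1,
   and x_(n) y = 0 for n >= 2. *)
Record opedata := OpeData {
  og : finType;
  opar : og -> bool;
  obr : og -> og -> og -> K;
  oc0 : og -> og -> K;
  oc1 : og -> og -> K
}.

(* U(t^-1 g[t^-1]): the generator (x, n) stands for x t^(-n-1).  The central
   terms c0 and c1 do not contribute to brackets of negative modes. *)
Section NegativeModes.
Variable D : opedata.
Let F := freealg K (og D * nat)%type.

Inductive neg_rel : F -> Prop :=
| Neg_rel x y m n : neg_rel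
    (fgen (x, m) * fgen (y, n)
     - kscal F ((-1) ^+ (opar x && opar y)) * (fgen (y, n) * fgen (x, m))
     - \sum_z kscal F (obr x y z) * fgen (z, (m + n).+1)).

Definition negalg : kalg K := quotalg neg_rel.
Definition neg_gen (x : og D) (n : nat) : negalg := qpi neg_rel (fgen (x, n)).
End NegativeModes.

(* V is the universal vertex superalgebra with OPE D: as a vector space it is
   U(t^-1 g[t^-1]), with x t^-n acting as x_(-n) and 1 as the vacuum. *)
Record universal (D : opedata) (V : vsalg) (g : og D -> V) : Prop :=
  Universal {
  univ_par : forall x, vpar (opar x) (g x);
  univ_ope0 : forall x y,
    nprod 0 (g x) (g y) = \sum_z obr x y z *: g z + oc0 x y *: vac V;
  univ_ope1 : forall x y, nprod 1 (g x) (g y) = oc1 x y *: vac V;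
  univ_ope2 : forall x y (n : nat), nprod n.+2%:Z (g x) (g y) = 0;
  univ_pbw : exists theta : negalg D -> V,
    [/\ bijective theta,
        forall c a b, theta (kscal _ c * a + b) = c *: theta a + theta b,
        theta 1 = vac V
      & forall x n a, theta (neg_gen x n * a)
                      = nprod (- n.+1%:Z) (g x) (theta a)]
}.

Record univ_vsalg (D : opedata) := UnivVSAlg {
  uvs :> vsalg;
  uvs_gen : og D -> uvs;
  uvs_univ : universal uvs_gen
}.

Record univ_valg (D : opedata) := UnivVAlg {
  uva :> valg;
  uva_gen : og D -> uva;
  uva_univ : universal uva_gen
}.

End VertexAlgebras.

Section CurrentAlgebra.
Variables (K : fieldType) (V : valg K).
Let F := freealg K (va_space V * int)%type.

(* U(L(V)): the generator (u, a) is the class of u t^a in L(V). *)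
Inductive ul_rel : F -> Prop :=
| Ul_lin c (u v : V) a : ul_rel
    (fgen (c *: u + v, a) - (kscal F c * fgen (u, a) + fgen (v, a)))
| Ul_der (u : V) (a : int) : ul_rel
    (fgen (nprod (-2) u (vac V), a) + kscal F a%:~R * fgen (u, a - 1))
| Ul_bracket (u v : V) (a b : int) (M : nat) :
    (forall j : nat, (M <= j)%N -> nprod j%:Z u v = 0) -> ul_rel
    (fgen (u, a) * fgen (v, b) - fgen (v, b) * fgen (u, a)
     - \sum_(r < M) kscal F (binz a r)
                    * fgen (nprod r%:Z u v, a + b - r%:Z)).

Definition ulalg : kalg K := quotalg ul_rel.
Definition ul (u : V) (a : int) : ulalg := qpi ul_rel (fgen (u, a)).

Section Completion.
(* wt D u : u is homogeneous of conformal weight D *)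
Variable wt : int -> V -> Prop.

Inductive ul_deg : int -> ulalg -> Prop :=
| ul_deg_gen u a D : wt D u -> ul_deg (a - D + 1) (ul u a)
| ul_deg1 : ul_deg 0 1
| ul_deg0 d : ul_deg d 0
| ul_degD d x y : ul_deg d x -> ul_deg d y -> ul_deg d (x + y)
| ul_degZ d c x : ul_deg d x -> ul_deg d (kscal ulalg c * x)
| ul_degM d e x y : ul_deg d x -> ul_deg e y -> ul_deg (d + e) (x * y).

(* the sum of the components of degrees -B, ..., B *)
Inductive ul_bdeg (B : nat) : ulalg -> Prop :=
| ul_bdeg0 : ul_bdeg B 0
| ul_bdegD d x y :
    (absz d <= B)%N -> ul_deg d x -> ul_bdeg B y -> ul_bdeg B (x + y).

(* the fundamental neighbourhoods of 0: the left ideals generated by the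
   components of degree > n *)
Inductive ul_nbh (n : int) : ulalg -> Prop :=
| ul_nbh0 : ul_nbh n 0
| ul_nbhD r a x y :
    n < r -> ul_deg r x -> ul_nbh n y -> ul_nbh n (a * x + y).

Definition ul_cauchy (x : nat -> ulalg) : Prop :=
  (exists B, forall m, ul_bdeg B (x m)) /\
  (forall n : nat, exists M, forall m m',
     (M <= m)%N -> (M <= m')%N -> ul_nbh n%:Z (x m - x m')).

Lemma ul_bdegDD B x y : ul_bdeg B x -> ul_bdeg B y -> ul_bdeg B (x + y).
Proof.
move=> hx hy; elim: hx => [|d x' x'' hd hx' _ IH]; first by rewrite add0r.
by rewrite -addrA; exact: ul_bdegD hd hx' IH.
Qed.

Lemma ul_bdegW B B' x : (B <= B')%N -> ul_bdeg B x -> ul_bdeg B' x.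
Proof.
move=> hB; elim=> [|d x' x'' hd hx' _ IH]; first exact: ul_bdeg0.
exact: ul_bdegD (leq_trans hd hB) hx' IH.
Qed.

Lemma ul_bdegM B B' x y : ul_bdeg B x -> ul_bdeg B' y -> ul_bdeg (B + B') (x * y).
Proof.
move=> hx hy; elim: hx => [|d x' x'' hd hx' _ IH].
  by rewrite mul0r; exact: ul_bdeg0.
rewrite mulrDl; apply: ul_bdegDD IH.
elim: hy => [|e y' y'' he hy' _ IH]; first by rewrite mulr0; exact: ul_bdeg0.
rewrite mulrDr; apply: ul_bdegD IH; last exact: ul_degM hx' hy'.
by lia.
Qed.

Lemma ul_bdeg_scal c : ul_bdeg 0 (kscal ulalg c).
Proof.
rewrite -[kscal _ _]addr0 -[kscal _ _]mulr1.
by apply: (@ul_bdegD 0 0) (ul_bdeg0 _) => //; apply: ul_degZ ul_deg1.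
Qed.

Lemma ul_bdegB B x y : ul_bdeg B x -> ul_bdeg B y -> ul_bdeg B (x - y).
Proof.
move=> hx hy; apply: ul_bdegDD hx _.
by rewrite -mulN1r -(rmorph1 (kscal ulalg)) -rmorphN;
  exact: ul_bdegM (ul_bdeg_scal _) hy.
Qed.

Lemma ul_nbhDD n x y : ul_nbh n x -> ul_nbh n y -> ul_nbh n (x + y).
Proof.
move=> hx hy; elim: hx => [|r a x' x'' hr hx' _ IH]; first by rewrite add0r.
by rewrite -addrA; exact: ul_nbhD hr hx' IH.
Qed.

Lemma ul_nbhMl n a x : ul_nbh n x -> ul_nbh n (a * x).
Proof.
elim=> [|r b x' x'' hr hx' _ IH]; first by rewrite mulr0; exact: ul_nbh0.
by rewrite mulrDr mulrA; exact: ul_nbhD hr hx' IH.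
Qed.

Lemma ul_nbhB n x y : ul_nbh n x -> ul_nbh n y -> ul_nbh n (x - y).
Proof. by move=> hx hy; apply: ul_nbhDD hx _; rewrite -mulN1r; exact: ul_nbhMl. Qed.

Lemma ul_nbhMr n B x y : ul_nbh (n + B%:Z) x -> ul_bdeg B y -> ul_nbh n (x * y).
Proof.
move=> hx hy; elim: hx => [|r a x' x'' hr hx' _ IH].
  by rewrite mul0r; exact: ul_nbh0.
rewrite mulrDl; apply: ul_nbhDD IH.
elim: hy => [|e y' y'' he hy' _ IH]; first by rewrite mulr0; exact: ul_nbh0.
rewrite mulrDr; apply: ul_nbhDD IH.
rewrite -mulrA -[_ * _]addr0.
by apply: ul_nbhD (ul_degM hx' hy') (ul_nbh0 _); lia.
Qed.

Lemma ul_cauchy_closed : @subalg_closed K (seqalg ulalg) ul_cauchy.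
Proof.
split=> [c|x y [[B hB] hx] [[B' hB'] hy]|x y [[B hB] hx] [[B' hB'] hy]].
- split; first by exists 0%N => m; exact: ul_bdeg_scal.
  by exists 0%N => m m' _ _; rewrite /= /fscal subrr; exact: ul_nbh0.
- split.
    exists (B + B')%N => m; apply: ul_bdegB.
      by apply: ul_bdegW (hB m); exact: leq_addr.
    by apply: ul_bdegW (hB' m); exact: leq_addl.
  move=> n; have [M hM] := hx n; have [M' hM'] := hy n.
  exists (maxn M M') => m m'; rewrite !geq_max.
  move=> /andP[h1 h2] /andP[h3 h4].
  have -> : (x - y) m - (x - y) m' = (x m - x m') - (y m - y m').
    by rewrite /= opprD opprK !opprB addrACA [- y m + _]addrC.
  by apply: ul_nbhB; [exact: hM | exact: hM'].
- split; first by exists (B + B')%N => m; exact: ul_bdegM.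
  move=> n; have [M hM] := hx (n + B')%N; have [M' hM'] := hy n.
  exists (maxn M M') => m m'; rewrite !geq_max.
  move=> /andP[h1 h2] /andP[h3 h4].
  have -> : (x * y) m - (x * y) m' =
            (x m - x m') * y m + x m' * (y m - y m').
    by rewrite mulrBl mulrBr addrA subrK.
  apply: ul_nbhDD; last by apply: ul_nbhMl; exact: hM'.
  by apply: ul_nbhMr (hB' m); rewrite -PoszD; exact: hM.
Qed.

(* The degreewise completion of U(L(V)) is cauchyalg modulo null sequences;
   the latter all lie in completed_ideal below. *)
Definition cauchyalg : kalg K := subalg ul_cauchy_closed.
Definition cseq (c : cauchyalg) : nat -> ulalg := subalg_incl ul_cauchy_closed c.

Inductive u_rel : cauchyalg -> Prop :=
| U_vac c : (forall m, cseq c m = ul (vac V) (-1) - 1) -> u_rel c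
| U_assoc (u v : V) (a b : int) c :
    (forall m, cseq c m = ul (nprod a u v) b
       - \sum_(i < m) kscal ulalg (binz a i * (-1) ^+ i)
           * (ul u (a - i%:Z) * ul v (b + i%:Z)
              - kscal ulalg ((-1) ^ a) * (ul v (a + b - i%:Z) * ul u i%:Z))) ->
    u_rel c.

(* closure of the two-sided ideal generated by u_rel *)
Definition completed_ideal (c : cauchyalg) : Prop :=
  forall n : nat, exists j : cauchyalg, ideal u_rel j /\
    exists M, forall m, (M <= m)%N -> ul_nbh n%:Z (cseq c m - cseq j m).

Definition uva_env : kalg K := quotalg completed_ideal.

Definition ulim (x : nat -> ulalg) (z : uva_env) : Prop :=
  exists c : cauchyalg, (forall m, cseq c m = x m) /\ qpi completed_ideal c = z.

End Completion.
End CurrentAlgebra.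

Section InducedMap.
Variables (K : fieldType) (V1 V2 : valg K) (f : V1 -> V2).
Variables (wt1 : int -> V1 -> Prop) (wt2 : int -> V2 -> Prop).

(* graph of the algebra morphism U(L(V1)) -> U(L(V2)) induced by f *)
Inductive ul_map : ulalg V1 -> ulalg V2 -> Prop :=
| ul_map_gen u a : ul_map (ul u a) (ul (f u) a)
| ul_map_scal c : ul_map (kscal _ c) (kscal _ c)
| ul_mapD x y x' y' : ul_map x x' -> ul_map y y' -> ul_map (x + y) (x' + y')
| ul_mapM x y x' y' : ul_map x x' -> ul_map y y' -> ul_map (x * y) (x' * y').

(* graph of the induced map U(V1) -> U(V2) *)
Definition u_map (z : uva_env wt1) (z' : uva_env wt2) : Prop :=
  exists x x', [/\ forall m, ul_map (x m) (x' m), ulim x z & ulim x' z'].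

Definition u_image (z' : uva_env wt2) : Prop := exists z, u_map z z'.

End InducedMap.

Section AffineYangian.
Variables (K : fieldType) (n : nat) (hbar eps : K).

(* generators X^+_{i,r}, X^-_{i,r} and H_{i,r}; Z/nZ is 'I_n *)
Definition ygen : choiceType := (bool * 'I_n * 'I_2 + 'I_n * 'I_2)%type.
Let F := freealg K ygen.

Definition yX (s : bool) (i : 'I_n) (r : 'I_2) : F := fgen (inl (s, i, r)).
Definition yH (i : 'I_n) (r : 'I_2) : F := fgen (inr (i, r)).

Let pm (s : bool) : K := if s then 1 else -1.
Let kk (c : K) : F := kscal F c.
Let com (x y : F) : F := x * y - y * x.
Let acom (x y : F) : F := x * y + y * x.

Definition cartan (i j : 'I_n) : int :=
  if i == j then 2
  else if (i.+1 %% n == j)%N || (j.+1 %% n == i)%N then -1 else 0.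

Let yHt (i : 'I_n) : F := yH i 1 - kk (hbar / 2%:R) * (yH i 0 * yH i 0).

(* (i, j) = (0, n-1) *)
Let wrap (i j : 'I_n) : bool := (i == 0 :> nat)%N && (j == n.-1 :> nat)%N.
Let shift : K := eps + n%:R / 2%:R * hbar.

Inductive y_rel : F -> Prop :=
| Y_HH i j r s : y_rel (com (yH i r) (yH j s))
| Y_X0X0 i j : y_rel
    (com (yX true i 0) (yX false j 0) - kk (i == j)%:R * yH i 0)
| Y_X1X0 i j : y_rel
    (com (yX true i 1) (yX false j 0) - kk (i == j)%:R * yH i 1)
| Y_X0X1 i j : y_rel
    (com (yX true i 0) (yX false j 1) - kk (i == j)%:R * yH i 1)
| Y_H0X s i j r : y_rel
    (com (yH i 0) (yX s j r) - kk (pm s * (cartan i j)%:~R) * yX s j r)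
| Y_H1X s i j : ~~ wrap i j -> ~~ wrap j i -> y_rel
    (com (yHt i) (yX s j 0) - kk (pm s * (cartan i j)%:~R) * yX s j 1)
| Y_H1X_wrap s i j : wrap i j -> y_rel
    (com (yHt i) (yX s j 0) + kk (pm s) * (yX s j 1 + kk shift * yX s j 0))
| Y_H1X_wrap' s i j : wrap j i -> y_rel
    (com (yHt i) (yX s j 0) + kk (pm s) * (yX s j 1 - kk shift * yX s j 0))
| Y_XX s i j : ~~ wrap i j -> ~~ wrap j i -> y_rel
    (com (yX s i 1) (yX s j 0) - com (yX s i 0) (yX s j 1)
     - kk (pm s * (cartan i j)%:~R * (hbar / 2%:R))
       * acom (yX s i 0) (yX s j 0))
| Y_XX_wrap s i j : wrap i j -> y_rel
    (com (yX s i 1) (yX s j 0) - com (yX s i 0) (yX s j 1)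
     + kk (pm s * (hbar / 2%:R)) * acom (yX s i 0) (yX s j 0)
     - kk shift * com (yX s i 0) (yX s j 0))
| Y_Serre s i j : i != j -> y_rel
    (iter (1 + absz (cartan i j)) (com (yX s i 0)) (yX s j 0)).

Definition yangian : kalg K := quotalg y_rel.
Definition yangX s i r : yangian := qpi y_rel (yX s i r).
Definition yangH i r : yangian := qpi y_rel (yH i r).

End AffineYangian.

Section OddDerivation.
Variables (K : fieldType) (C : vsalg K).

Lemma odd_derivation (Q y z : C) (l : int) : vpar true Q -> vpar false y ->
  nprod 0 Q (nprod l y z) =
    nprod l (nprod 0 Q y) z + nprod l y (nprod 0 Q z).
Proof.
move=> hQ hy.
have [M1 h1] := core_trunc (vs_core C) Q y.
have [M2 h2] := core_trunc (vs_core C) y z.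
have [M3 h3] := core_trunc (vs_core C) Q z.
pose M := (maxn (maxn M1 M3) (M2 + absz l)).+1.
have := @vs_borcherds _ C _ _ _ _ z hQ hy 0 0 l M.
rewrite /= expr0 expr0z mulr1.
have binz0 j : binz (K := K) 0 j.+1 = 0.
  by rewrite /binz big_ord_recl /= subrr !mul0r.
have binz00 : binz (K := K) 0 0 = 1.
  by rewrite /binz big_ord0 fact0 divr1.
rewrite !big_ord_recl !binz00 !big1 => [||i _]; last first.
- by rewrite lift0 binz0 scale0r.
- by move=> i _; rewrite lift0 binz0 mulr0 scale0r.
rewrite /= expr0 mulr1 !scale1r [Posz 0]/(0 : int) !(addr0, add0r, subr0) => -> //.
  by rewrite subrK.
move=> j hj; rewrite !add0r; split.
- by apply: h1; lia.
- have -> : (l + j%:Z)%R = (absz (l + j%:Z)%R)%:Z by lia.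
  by apply: h2; lia.
- by apply: h3; lia.
Qed.

Lemma vpar0 b : @vpar K C b 0.
Proof.
have [u0 [u1 [h0 h1 _]]] := vpar_dec (vac C).
case: b; first by rewrite -(addNr u1) -scaleN1r; exact: vpar_lin.
by rewrite -(addNr u0) -scaleN1r; exact: vpar_lin.
Qed.

Lemma vparZ b c (u : C) : vpar b u -> vpar b (c *: u).
Proof.
by move=> h; rewrite -[c *: u]addr0; apply: vpar_lin (vpar0 _).
Qed.

Lemma vparD b (u v : C) : vpar b u -> vpar b v -> vpar b (u + v).
Proof. by move=> hu hv; rewrite -[u]scale1r; apply: vpar_lin. Qed.

Lemma vpar_sum b (I : finType) (P : pred I) (f : I -> C) :
  (forall i, vpar b (f i)) -> vpar b (\sum_(i | P i) f i).
Proof. by move=> h; elim/big_ind: _ => // [|u v]; [exact: vpar0|exact: vparD]. Qed.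

End OddDerivation.

Section Pyramid.
Variables (K : fieldType) (k : K) (q : seq nat).

Definition pyr_N : nat := sumn q.
Local Notation N := pyr_N.
Local Notation l := (size q).

(* q_s, for 1 <= s <= l *)
Definition qs (s : nat) : nat := nth 0%N q s.-1.
(* n_a: the distinct values of the (nonincreasing) q, with n_(v+1) = 0 *)
Definition nval (a : nat) : nat := nth 0%N (undup q) a.-1.
Definition nvals : nat := size (undup q).

(* The box i : 'I_N is the index i.+1 of the usual numbering 1, ..., N;
   columns and rows are numbered from 1. *)
Definition col (i : 'I_N) : nat := (reshape_index q i).+1.
Definition row (i : 'I_N) : nat :=
  (reshape_offset q i).+1 + (qs 1 - qs (col i)).

Definition alpha (s : nat) : K := k + N%:R - (qs s)%:R.
Definition gamma (s : nat) : K := \sum_(s.+1 <= u < l.+1) alpha u.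

(* coefficient of E_z in [E_x, E_y], where E_(i,j) = E_{i,j} *)
Definition glbr (x y z : 'I_N * 'I_N) : K :=
  ((x.2 == y.1) && (z == (x.1, y.2)))%:R
  - ((x.1 == y.2) && (z == (y.1, x.2)))%:R.

(* the form (E_{i,j} | E_{p,q}) with first coefficient c *)
Definition glform (c : K) (x y : 'I_N * 'I_N) : K :=
  c * ((x.1 == y.2) && (y.1 == x.2))%:R
  + ((x.1 == x.2) && (y.1 == y.2))%:R.

Definition nilf : 'M[K]_N :=
  \matrix_(i, j) ((col i == (col j).+1) && (row i == row j))%:R.

(* a basis of the direct sum of the gl(q_s) *)
Definition lev : finType := {x : 'I_N * 'I_N | col x.1 == col x.2}.
(* a basis of the positive part n of gl(N) *)
Definition pos : finType := {x : 'I_N * 'I_N | (col x.1 < col x.2)%N}.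

(* the tensor product of the V^{kappa_s}(gl(q_s)), that is, the universal
   affine vertex algebra of the direct sum of the gl(q_s) *)
Definition miura_data : opedata K := {|
  og := lev;
  opar := fun=> false;
  obr := fun x y z => glbr (val x) (val y) (val z);
  oc0 := fun _ _ => 0;
  oc1 := fun x y => if col (val x).1 == col (val y).1
                    then glform (alpha (col (val x).1)) (val x) (val y) else 0
|}.

(* The BRST complex: the affine vertex algebra of gl(N) tensored with the
   charged fermions phi_b, phi^*_b, for b in the basis pos of n. *)
Definition brst_par (x : ('I_N * 'I_N) + (pos + pos)) : bool :=
  if x is inl _ then false else true.

Definition brst_data : opedata K := {|
  og := (('I_N * 'I_N) + (pos + pos))%type;
  opar := brst_par;
  obr := fun x y z => match x, y, z with
         | inl x, inl y, inl z => glbr x y z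
         | _, _, _ => 0
         end;
  oc0 := fun x y => match x, y with
         | inr (inl b), inr (inr c) | inr (inr b), inr (inl c) => (b == c)%:R
         | _, _ => 0
         end;
  oc1 := fun x y => match x, y with
         | inl x, inl y => glform k x y
         | _, _ => 0
         end
|}.

Section Reduction.
Variables (C : univ_vsalg brst_data) (V : univ_valg miura_data).

Definition bE (x : 'I_N * 'I_N) : C :=
  uvs_gen C (inl x : og brst_data).
Definition bphi (b : pos) : C := uvs_gen C (inr (inl b) : og brst_data).
Definition bphis (b : pos) : C := uvs_gen C (inr (inr b) : og brst_data).

(* chi(x) = tr(f x) *)
Definition chi (x : 'I_N * 'I_N) : K := \tr (nilf *m delta_mx x.1 x.2).

Definition brst_Q : C :=
  \sum_(b : pos) (nprod (-1) (bE (val b)) (bphis b) + chi (val b) *: bphis b)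
  - 2%:R^-1 *: \sum_(b : pos) \sum_(c : pos) \sum_(e : pos)
      glbr (val b) (val c) (val e)
        *: nprod (-1) (bphi e) (nprod (-1) (bphis b) (bphis c)).

Definition brst_d (y : C) : C := nprod 0 brst_Q y.

(* For x in the nonpositive part of gl(N), the current
   J_x = x + sum_(b, c) c_{x,b}^c :phi_c phi^*_b:. *)
Definition brst_J (x : 'I_N * 'I_N) : C :=
  bE x + \sum_(b : pos) \sum_(c : pos)
    glbr x (val b) (val c) *: nprod (-1) (bphi c) (bphis b).

Definition lE (x : 'I_N * 'I_N) : V :=
  if insub x is Some y then uva_gen V (y : og miura_data) else 0.

(* Graph of the Miura map on the vertex subalgebra of C generated by the
   currents J_x: J_x is sent to the block-diagonal part of x. *)
Inductive miura : C -> V -> Prop :=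
| Miura_gen x : (col x.2 <= col x.1)%N -> miura (brst_J x) (lE x)
| Miura_vac : miura (vac C) (vac V)
| Miura_lin c y z u v :
    miura y u -> miura z v -> miura (c *: y + z) (c *: u + v)
| Miura_prod n y z u v :
    miura y u -> miura z v -> miura (nprod n y z) (nprod n u v).

(* W^k(gl(N), f), as a vertex subalgebra of the target of the Miura map.  Each
   class of H^0(C, brst_d) has exactly one representative in the vertex
   subalgebra generated by the J_x. *)
Definition in_W (w : V) : Prop := exists2 y, miura y w & brst_d y = 0.

Lemma brst_Q_odd : vpar true brst_Q.
Proof.
have hE x : vpar false (bE x).
  exact: (univ_par (uvs_univ C) (inl x : og brst_data)).
have hp b : vpar true (bphi b).
  exact: (univ_par (uvs_univ C) (inr (inl b) : og brst_data)).
have hs b : vpar true (bphis b).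
  exact: (univ_par (uvs_univ C) (inr (inr b) : og brst_data)).
rewrite /brst_Q -scaleNr; apply: vparD.
  apply: vpar_sum => b; apply: vparD; last exact: vparZ.
  exact: (vpar_prod (-1) (hE _) (hs _)).
apply: vparZ; do 3! [apply: vpar_sum => ?]; apply: vparZ.
exact: (vpar_prod (-1) (hp _) (vpar_prod (-1) (hs _) (hs _))).
Qed.

Lemma miura_even y w : miura y w -> vpar false y.
Proof.
have hE x : vpar false (bE x).
  exact: (univ_par (uvs_univ C) (inl x : og brst_data)).
have hp b : vpar true (bphi b).
  exact: (univ_par (uvs_univ C) (inr (inl b) : og brst_data)).
have hs b : vpar true (bphis b).
  exact: (univ_par (uvs_univ C) (inr (inr b) : og brst_data)).
elim=> [x _||c y1 z u v _ h1 _ h2|n y1 z u v _ h1 _ h2].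
- apply: vparD => //; do 2! [apply: vpar_sum => ?]; apply: vparZ.
  exact: (vpar_prod (-1) (hp _) (hs _)).
- exact: vpar_vac.
- exact: vpar_lin.
- exact: (vpar_prod n h1 h2).
Qed.

Lemma in_W_closed : subva_closed in_W.
Proof.
have prodr0 n (u : C) : nprod n u 0 = 0.
  have := core_linr (vs_core C) n u (-1) 0 0.
  by rewrite scaler0 addr0 => ->; rewrite scaleN1r addNr.
have prod0r n (u : C) : nprod n 0 u = 0.
  have := core_linl (vs_core C) n u (-1) 0 0.
  by rewrite scaler0 addr0 => ->; rewrite scaleN1r addNr.
split.
- exists (vac C); first exact: Miura_vac.
  exact: (core_vacr0 (vs_core C) 0).
- move=> c u v [y hy dy] [z hz dz]; exists (c *: y + z).
    exact: Miura_lin.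
  rewrite /brst_d (core_linr (vs_core C)).
  by rewrite [nprod 0 _ y]dy [nprod 0 _ z]dz scaler0 addr0.
- move=> n u v [y hy dy] [z hz dz]; exists (nprod n y z).
    exact: Miura_prod.
  rewrite /brst_d odd_derivation; [|exact: brst_Q_odd|exact: miura_even hy].
  by rewrite [nprod 0 _ y]dy [nprod 0 _ z]dz prod0r prodr0 addr0.
Qed.

Definition Walg : valg K := subva in_W_closed.
Definition Wval (w : Walg) : V := subva_val w.

(* E^{(s)}_{p,r}, which is 0 unless q_1 - q_s < p, r <= q_1 *)
Definition colE (s p r : nat) : V :=
  \sum_(i : 'I_N) \sum_(j : 'I_N |
    [&& col i == s, col j == s, row i == p & row j == r]) lE (i, j).

Definition W1_elt (p r : nat) : V := \sum_(1 <= s < l.+1) colE s p r.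

Definition W2_elt (a p r : nat) : V :=
  - \sum_(1 <= s < l.+1) gamma s *: nprod (-2) (colE s p r) (vac V)
  + \sum_(1 <= r1 < l.+1) \sum_(r1.+1 <= r2 < l.+1)
      \sum_((qs 1 - nval a).+1 <= u < (qs 1).+1)
        nprod (-1) (colE r1 u r) (colE r2 p u)
  - \sum_(1 <= r1 < l.+1) \sum_(1 <= r2 < r1.+1)
      \sum_((qs 1 - qs r2).+1 <= u < (qs 1 - nval a).+1)
        nprod (-1) (colE r1 u r) (colE r2 p u).

(* the conformal weight: E^{(s)}_{p,r}[-u] has weight u *)
Inductive Vwt : int -> V -> Prop :=
| Vwt_gen x : Vwt 1 (uva_gen V x)
| Vwt_vac : Vwt 0 (vac V)
| Vwt_lin D c u v : Vwt D u -> Vwt D v -> Vwt D (c *: u + v)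
| Vwt_prod D D' n u v :
    Vwt D u -> Vwt D' v -> Vwt (D + D' - n - 1) (nprod n u v).

Definition Wwt (D : int) (w : Walg) : Prop := Vwt D (Wval w).
Definition UW : kalg K := uva_env Wwt.

Definition in_block (a p : nat) : bool :=
  (qs 1 - nval a < p <= qs 1 - nval a.+1)%N.

(* w1 p r and w2 p r are the elements W^{(1)}_{p,r} and W^{(2)}_{p,r} of the
   W-algebra *)
Definition is_W_family (w1 w2 : nat -> nat -> Walg) : Prop :=
  forall a p r, (1 <= a <= nvals)%N -> in_block a p -> in_block a r ->
    Wval (w1 p r) = W1_elt p r /\ Wval (w2 p r) = W2_elt a p r.

Section Families.
Variables (w1 w2 : nat -> nat -> Walg).

(* generators of the vertex subalgebra attached to the block a = 1 *)
Inductive Wtilde_gen : Walg -> Prop :=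
| Wtilde_gen1 i j : (1 <= i <= nval 1 - nval 2)%N ->
    (1 <= j <= nval 1 - nval 2)%N -> Wtilde_gen (w1 i j)
| Wtilde_gen2 i j : (1 <= i <= nval 1 - nval 2)%N ->
    (1 <= j <= nval 1 - nval 2)%N -> Wtilde_gen (w2 i j).

Definition Wtilde : valg K := subva (va_span_closed Wtilde_gen).
Definition Wtilde_val (w : Wtilde) : Walg := subva_val w.
Definition Wtilde_wt (D : int) (w : Wtilde) : Prop := Wwt D (Wtilde_val w).

Definition image_UWtilde : UW -> Prop :=
  @u_image K Wtilde Walg Wtilde_val Wtilde_wt Wwt.

Section Phi.
Variables (hbar : K) (a : nat).
Let d : nat := (nval 1 - nval a)%N.
Let n : nat := (nval a - nval a.+1)%N.
Let h : ulalg Walg := kscal _ hbar.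
Let W (p r : nat) (m : int) : ulalg Walg := ul (w1 (d + p) (d + r)) m.

(* partial sums (over s < m) of the image of H_{i,1} *)
Definition Phi_H (i m : nat) : ulalg Walg :=
  - (h * (ul (w2 (d + i) (d + i)) 1 - ul (w2 (d + i.+1) (d + i.+1)) 1))
  - kscal _ (i%:R / 2%:R * hbar) * (W i i 0 - W i.+1 i.+1 0)
  - h * (W i i 0 * W i.+1 i.+1 0)
  + h * \sum_(s < m) \sum_(1 <= u < i.+1) W i u (- s%:Z) * W u i s%:Z
  + h * \sum_(s < m) \sum_(i.+1 <= u < n.+1)
          W i u (- s%:Z - 1) * W u i (s%:Z + 1)
  - h * \sum_(s < m) \sum_(1 <= u < i.+1) W i.+1 u (- s%:Z) * W u i.+1 s%:Z
  - h * \sum_(s < m) \sum_(i.+1 <= u < n.+1)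
          W i.+1 u (- s%:Z - 1) * W u i.+1 (s%:Z + 1).

Definition is_Phi (eps : K) (Phi : khom (yangian n hbar eps) UW) : Prop :=
  forall i : 'I_n,
  if (i == 0 :> nat)%N then
    ulim (fun=> W n 1 1) (Phi (yangX hbar eps true i 0)) /\
    ulim (fun=> W 1 n (-1)) (Phi (yangX hbar eps false i 0))
  else
    [/\ ulim (fun=> W i i.+1 0) (Phi (yangX hbar eps true i 0)),
        ulim (fun=> W i.+1 i 0) (Phi (yangX hbar eps false i 0))
      & ulim (Phi_H i) (Phi (yangH hbar eps i 1))].

End Phi.
End Families.
End Reduction.
End Pyramid.
Arguments is_Phi {K k q C V} w1 w2 {hbar} a {eps} Phi.

(* Main.v *)
From HB Require Import structures.
Require Import Defs.
From mathcomp Require Import all_boot all_order all_algebra.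
From mathcomp Require Import boolp reals complex ring zify monalg.
Set Implicit Arguments.
Unset Strict Implicit.
Unset Printing Implicit Defensive.
Import GRing.Theory.
Local Open Scope ring_scope.

(** The range of [Phi_s] is tested on the generators [X^+-_{i,0}] and [H_{j,1}]
    of the Yangian, and commutation with the modes of [Wtilde] is tested inside
    the vertex algebra: [{u | w_(j) u = 0 for all j <= n}] is closed under all
    products, so only the generators [W^(1)_{j,l}], [W^(2)_{j,l}] of [Wtilde]
    matter, and they are supported on the columns of full height [q_1].

    Over the full columns write [W] for the sum of the column currents [E^c] and
    define [R] by [R_{m+1} = R_m + sum_x W_{xl} E_{jx} - al * der W_{jl}], so that
    [R = W^(2)] up to a multiple of [der W].  The products of [W] and [R] are found
    by induction on the number of columns.  For two rows [p <> r] of a lower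
    block, the mixed products [R_{pr} (n) R_{jl}] with [n = 0, 1] coincide with
    those of the quadratic expression [sum_u W_{ur} W_{pu} + W_{rr} W_{pr}], hence
    [W^(2)_{pr} - W_{rr} W_{pr}] is annihilated; applying [W_{rp} (0)] yields that
    the products [0] and [1] of
    [W^(2)_{rr} - W^(2)_{pp} - (W_{rr}^2 - W_{pp}^2) / 2] with [Wtilde] vanish.

    In [Phi_s H_{j,1}] the infinite sums contain terms [W_{ii} t^-s W_{ii} t^s]
    which do not commute with [Wtilde].  By the defining relations of the
    completed enveloping algebra they add up to half of the mode of [W_{ii}^2],
    which is exactly the quadratic correction above; all other summands commute
    term by term. *)

(** * Linear identities in modules *)

(** Commutation with [Wtilde] cannot be had for whole fields. The form contains
    [(E_{pp} | E_{jj}) = 1], so [W^(1)_{pp}] has a nonzero product 1 with [W^(1)_{jj}], and only its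
    zero mode is available. The bracket with a mode [u t^a], [a >= 0], involves just the products
    [0, ..., a]: product 0 settles the zero modes, and products 0 and 1 settle the modes [t^1] of
    [W^(2)] in [H_{j,1}]. The images of the [X^+-_{i,0}] are off-diagonal and commute in every mode.

    The condition [2 <= s] separates the rows of block [s] from those of the generators of [Wtilde].
    Together with [p <> r] it kills most Kronecker symbols, which keeps the products of [R_{pr}]
    with [R_{jl}] short enough for the induction; the diagonal case is reached by the derivation
    [W_{rp} (0)], which annihilates the generators. It turns [W_{rr} W_{pr}] into terms that are not
    squares; adding half of [(W_{rr} - W_{pp})^2], which commutes with [Wtilde], completes the
    square.

    Shorter columns do not meet the rows of the generators, so their currents commute with [Wtilde];
    only products mixing full and short columns have to be regrouped. *)

Section ModuleReflection.
Variables (K : comNzRingType) (V : lmodType K).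

Inductive mexpr :=
| MAtom of nat
| MZero
| MAdd of mexpr & mexpr
| MOpp of mexpr
| MScale of K & mexpr.

Fixpoint meval (env : seq V) (e : mexpr) : V :=
  match e with
  | MAtom i => nth 0 env i
  | MZero => 0
  | MAdd a b => meval env a + meval env b
  | MOpp a => - meval env a
  | MScale c a => c *: meval env a
  end.

(** [Nat.eqb] rather than [==], so that [cbn] computes the coefficients down to expressions that
    [ring] accepts. *)
Fixpoint mcoef (e : mexpr) (i : nat) : K :=
  match e with
  | MAtom j => if Nat.eqb i j then 1 else 0
  | MZero => 0
  | MAdd a b => mcoef a i + mcoef b i
  | MOpp a => - mcoef a i
  | MScale c a => c * mcoef a i
  end.

Fixpoint meqs (n : nat) (a b : mexpr) : Prop :=
  match n with
  | 0%N => True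
  | n'.+1 => mcoef a n' = mcoef b n' /\ meqs n' a b
  end.

Lemma mevalE env e : meval env e = \sum_(i < size env) mcoef e i *: env`_i.
Proof.
elim: e => [j||a IHa b IHb|a IHa|c a IHa] /=.
- have eqE i : Nat.eqb i j = (i == j) by apply/idP/eqP => [/PeanoNat.Nat.eqb_eq|->]; rewrite ?PeanoNat.Nat.eqb_refl.
  case: (ltnP j (size env)) => hj; last first.
    rewrite nth_default // big1 // => i _; rewrite eqE.
    by case: eqP => [e|]; rewrite ?scale0r //; move: (ltn_ord i); rewrite e ltnNge hj.
  rewrite (bigD1 (Ordinal hj)) //= eqE eqxx scale1r big1 ?addr0 // => i hi.
  by rewrite eqE -[j]/(val (Ordinal hj)) val_eqE (negbTE hi) scale0r.
- by rewrite big1 // => i _; rewrite scale0r.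
- by rewrite IHa IHb -big_split; apply: eq_bigr => i _; rewrite scalerDl.
- by rewrite IHa -sumrN; apply: eq_bigr => i _; rewrite scaleNr.
- by rewrite IHa scaler_sumr; apply: eq_bigr => i _; rewrite scalerA.
Qed.

Lemma meqs_coef n a b i : meqs n a b -> (i < n)%N -> mcoef a i = mcoef b i.
Proof.
elim: n => // n IH [e h]; rewrite ltnS leq_eqVlt => /orP[/eqP->|] //.
exact: IH.
Qed.

Lemma meval_eq env a b : meqs (size env) a b -> meval env a = meval env b.
Proof.
by rewrite !mevalE => h; apply: eq_bigr => i _; rewrite (meqs_coef h).
Qed.

End ModuleReflection.

(** The matches on [constr:(Set)] run the tactic [cmp] while a term is being built; its failure
    selects the next branch. *)
Ltac mod_find cmp x l :=
  lazymatch l with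
  | cons ?y ?l' =>
      let r := match constr:(Set) with
               | _ => let _ := match constr:(Set) with _ => cmp x y end in
                      constr:(O)
               | _ => let n := mod_find cmp x l' in constr:(S n)
               end in r
  end.

Ltac mod_atoms cmp t l :=
  lazymatch t with
  | @GRing.add _ ?a ?b => let l1 := mod_atoms cmp a l in mod_atoms cmp b l1
  | @GRing.opp _ ?a => mod_atoms cmp a l
  | @GRing.scale _ _ _ ?a => mod_atoms cmp a l
  | @GRing.zero _ => l
  | _ => match constr:(Set) with
         | _ => let n := mod_find cmp t l in l
         | _ => constr:(cons t l)
         end
  end.

Ltac mod_reify cmp K t l :=
  lazymatch t with
  | @GRing.add _ ?a ?b =>
      let ea := mod_reify cmp K a l in let eb := mod_reify cmp K b l in
      constr:(MAdd ea eb)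
  | @GRing.opp _ ?a => let ea := mod_reify cmp K a l in constr:(MOpp ea)
  | @GRing.scale _ _ ?c ?a =>
      let ea := mod_reify cmp K a l in constr:(@MScale K c ea)
  | @GRing.zero _ => constr:(MZero K)
  | _ => let n := mod_find cmp t l in constr:(MAtom K n)
  end.

Ltac mod_syntactic x y := constr_eq x y.
Ltac mod_unify x y := unify x y.

(* Decides linear identities in a K-module; [ring] compares the coefficients
   of the atoms. *)
Ltac module_eq_by cmp K V :=
  lazymatch goal with
  | |- ?a = ?b =>
      let l0 := mod_atoms cmp a (@nil V) in
      let l := mod_atoms cmp b l0 in
      let ea := mod_reify cmp K a l in
      let eb := mod_reify cmp K b l in
      change (@meval K V l ea = @meval K V l eb);
      apply: meval_eq; cbn [meqs mcoef size Nat.eqb]; repeat split;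
      try ring
  end.

Ltac module_eq K V := module_eq_by mod_unify K V.
Ltac zmod_eq G := module_eq_by mod_syntactic (int : comNzRingType) (zmodule G : lmodType int).

(** * Products of a vertex algebra *)

Reserved Notation "a *[ n ] b" (at level 38, right associativity,
  format "a  *[ n ]  b").

Definition char0 (K : fieldType) := forall n : nat, n.+1%:R != 0 :> K.

Section Binz.
Variables (K : fieldType) (ch : char0 K).

Lemma binz0 (a : int) : binz a 0 = 1 :> K.
Proof. by rewrite /binz big_ord0 fact0 divr1. Qed.

Lemma binzS (a : int) j :
  binz a j.+1 = binz a j * ((a%:~R - j%:R) / j.+1%:R) :> K.
Proof.
by rewrite /binz big_ord_recr /= factS natrM invfM [X in _ * X]mulrC mulrACA.
Qed.

Lemma binz_gt (a j : nat) : (a < j)%N -> binz a%:Z j = 0 :> K.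
Proof.
move=> h; rewrite /binz (bigD1 (Ordinal h)) //= pmulrn subrr.
by rewrite !mul0r.
Qed.

Lemma binzN1 j : binz (-1) j = (-1) ^+ j :> K.
Proof.
elim: j => [|j IH]; first by rewrite binz0 expr0.
rewrite binzS IH exprSr; congr (_ * _).
have -> : (-1)%:~R - j%:R = - j.+1%:R :> K by rewrite -[j.+1]addn1 natrD opprD addrC.
by rewrite mulNr divff.
Qed.

Lemma binzN2 j : binz (-2) j = (-1) ^+ j * j.+1%:R :> K.
Proof.
elim: j => [|j IH]; first by rewrite binz0 expr0 mulr1.
rewrite binzS IH exprSr -!mulrA; congr (_ * _).
have -> : (-2)%:~R - j%:R = - j.+2%:R :> K.
  by ring.
by rewrite mulrCA divff // mulr1 mulN1r.
Qed.

End Binz.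

Section Calculus.
Variables (K : fieldType) (ch : char0 K) (V : valg K).
Local Notation Vs := (va_space V).
Local Notation one := (va_vac V).
Local Notation "a *[ n ] b" := (@va_prod K V n a b).
Implicit Types a b c u v w : Vs.

Lemma vpDl n u v w : (u + v) *[n] w = u *[n] w + v *[n] w.
Proof. by have := core_linl (va_core V) n w 1 u v; rewrite !scale1r. Qed.
Lemma vpDr n u v w : w *[n] (u + v) = w *[n] u + w *[n] v.
Proof. by have := core_linr (va_core V) n w 1 u v; rewrite !scale1r. Qed.
Lemma vp0l n w : 0 *[n] w = 0.
Proof.
by have /eqP := vpDl n 0 0 w; rewrite addr0 -subr_eq0 opprD addrA subrr sub0r oppr_eq0 => /eqP.
Qed.
Lemma vp0r n w : w *[n] 0 = 0.
Proof.
by have /eqP := vpDr n 0 0 w; rewrite addr0 -subr_eq0 opprD addrA subrr sub0r oppr_eq0 => /eqP.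
Qed.
Lemma vpZl n (k : K) u w : (k *: u) *[n] w = k *: (u *[n] w).
Proof. by have := core_linl (va_core V) n w k u 0; rewrite !addr0 vp0l addr0. Qed.
Lemma vpZr n (k : K) u w : w *[n] (k *: u) = k *: (w *[n] u).
Proof. by have := core_linr (va_core V) n w k u 0; rewrite !addr0 vp0r addr0. Qed.
Lemma vpNl n u w : (- u) *[n] w = - (u *[n] w).
Proof. by rewrite -scaleN1r vpZl scaleN1r. Qed.
Lemma vpNr n u w : w *[n] (- u) = - (w *[n] u).
Proof. by rewrite -scaleN1r vpZr scaleN1r. Qed.
Lemma vp_suml n w I (r : seq I) (P : pred I) (F : I -> Vs) :
  (\sum_(i <- r | P i) F i) *[n] w = \sum_(i <- r | P i) F i *[n] w.
Proof. exact: (big_morph (fun x => x *[n] w) (fun x y => vpDl n x y w) (vp0l n w)). Qed.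
Lemma vp_sumr n w I (r : seq I) (P : pred I) (F : I -> Vs) :
  w *[n] (\sum_(i <- r | P i) F i) = \sum_(i <- r | P i) w *[n] F i.
Proof. exact: (big_morph (fun x => w *[n] x) (fun x y => vpDr n x y w) (vp0r n w)). Qed.

Definition vpE := (vpDl, vpDr, vp0l, vp0r, vpZl, vpZr, vpNl, vpNr).

Lemma vp1l n u : one *[n] u = if n == -1 then u else 0.
Proof. exact: (core_vacl (va_core V)). Qed.
Lemma vp1r u : u *[-1] one = u.
Proof. exact: (core_vacr (va_core V)). Qed.
Lemma vp1r0 (n : nat) u : u *[n%:Z] one = 0.
Proof. exact: (core_vacr0 (va_core V)). Qed.

Lemma vp_trunc u v : exists M : nat, forall j : int, M%:Z <= j -> u *[j] v = 0.
Proof.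
have [M hM] := core_trunc (va_core V) u v; exists M => -[j|j] // hj.
exact: hM.
Qed.

Lemma big_ord_support (M M' : nat) (F : nat -> Vs) : (M <= M')%N ->
  (forall j, (M <= j)%N -> F j = 0) -> \sum_(j < M') F j = \sum_(j < M) F j.
Proof.
move=> /subnKC <- h; rewrite big_split_ord /= [X in _ + X]big1 ?addr0 // => i _.
by rewrite h // leq_addr.
Qed.

(** Borcherds identity at [n = 0]: [binz 0 j] vanishes for [j > 0], so its right-hand side collapses
    to a commutator. *)
Lemma vp_comm (m l : int) M a b c : (forall j, (M <= j)%N -> a *[j%:Z] b = 0) ->
  a *[m] b *[l] c = b *[l] a *[m] c
    + \sum_(j < M) binz m j *: ((a *[j%:Z] b) *[m + l - j%:Z] c).
Proof.
move=> hM.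
have [M1 h1] := vp_trunc b c; have [M2 h2] := vp_trunc a c.
pose N := (M + M1 + M2 + absz l + absz m).+1.
have supp (j : nat) : (N <= j)%N -> [/\ a *[0 + j%:Z] b = 0,
    b *[l + j%:Z] c = 0 & a *[m + j%:Z] c = 0].
  rewrite /N add0r => hj.
  by split; [apply: hM; lia | apply: h1; lia | apply: h2; lia].
have E := va_borcherds supp.
rewrite [in RHS]big_ord_recl [X in _ = _ + X]big1 ?addr0 in E => [|i _]; last first.
  by rewrite lift0 (@binz_gt _ 0) // mulr0 scale0r.
move: E; rewrite /= binz0 expr0 expr0z !mulr1 !scale1r add0r => E.
rewrite -[LHS](subrK (b *[l] a *[m] c)) -E addrC; congr (_ + _).
under eq_bigr do rewrite add0r.
apply: (@big_ord_support M N (fun j => binz m j *: ((a *[j%:Z] b) *[m + l - j%:Z] c))).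
  by rewrite /N; lia.
by move=> j /hM ->; rewrite vp0l scaler0.
Qed.

(** Borcherds identity at [m = 0], where only the term [j = 0] remains on the left. *)
Lemma vp_iter (n l : int) M a b c :
  (forall j : nat, (M <= j)%N -> b *[l + j%:Z] c = 0 /\ a *[j%:Z] c = 0) ->
  (a *[n] b) *[l] c = \sum_(j < M) ((-1) ^+ j * binz n j) *:
    (a *[n - j%:Z] b *[l + j%:Z] c - (-1) ^ n *: b *[n + l - j%:Z] a *[j%:Z] c).
Proof.
move=> hM.
have [M1 h1] := vp_trunc a b.
pose N := (M + M1 + absz n).+1.
have supp (j : nat) : (N <= j)%N -> [/\ a *[n + j%:Z] b = 0,
    b *[l + j%:Z] c = 0 & a *[0 + j%:Z] c = 0].
  rewrite /N add0r => hj; have [] := hM j; first by lia.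
  by split=> //; apply: h1; lia.
have E := va_borcherds supp.
rewrite big_ord_recl [X in _ + X = _]big1 ?addr0 in E => [|i _]; last first.
  by rewrite lift0 (@binz_gt _ 0) // scale0r.
move: E; rewrite /= binz0 scale1r add0r => ->.
pose F j : Vs := ((-1) ^+ j * binz n j) *:
  (a *[n - j%:Z] b *[l + j%:Z] c - (-1) ^ n *: b *[n + l - j%:Z] a *[j%:Z] c).
under eq_bigr do rewrite !add0r mul1r.
apply: (@big_ord_support M N F); first by rewrite /N; lia.
by move=> j /hM[hb ha]; rewrite /F hb ha !vp0r scaler0 subr0 scaler0.
Qed.

(** Borcherds identity on the vacuum with [m = -1] and [l = 0]: on the right, nonnegative modes kill
    the vacuum and only [v *[n] u] survives. *)
Lemma vp_skew (n : int) M u v :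
  (forall j : nat, (M <= j)%N -> u *[n + j%:Z] v = 0) ->
  v *[n] u = (-1) ^ (n + 1) *:
    \sum_(j < M) (-1) ^+ j *: ((u *[n + j%:Z] v) *[-1 - j%:Z] one).
Proof.
move=> hM; pose N := M.+1.
have supp (j : nat) : (N <= j)%N -> [/\ u *[n + j%:Z] v = 0,
    v *[0 + j%:Z] one = 0 & u *[-1 + j%:Z] one = 0].
  move=> hj; rewrite add0r vp1r0 hM; last by rewrite /N in hj; lia.
  have -> : -1 + j%:Z = (j.-1)%:Z by rewrite /N in hj; lia.
  by rewrite vp1r0.
have E := va_borcherds supp.
rewrite [in RHS]big_ord_recl [X in _ = _ + X]big1 in E; last first.
  move=> i _; rewrite lift0 !add0r vp1r0 vp0r.
  have -> : -1 + i.+1%:Z = i%:Z by lia.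
  by rewrite vp1r0 vp0r scaler0 subr0 scaler0.
move: E; rewrite vp1r0 vp0r /= !addr0 vp1r expr0 binz0 !mul1r scale1r sub0r.
have -> : \sum_(j < N) binz (-1) j *: ((u *[n + j%:Z] v) *[-1 - j%:Z] one)
  = \sum_(j < M) (-1) ^+ j *: ((u *[n + j%:Z] v) *[-1 - j%:Z] one).
  rewrite /N big_ord_recr /= hM // vp0l scaler0 addr0.
  by apply: eq_bigr => i _; rewrite binzN1.
have nz : (-1 : K) != 0 by rewrite oppr_eq0 oner_neq0.
move=> ->; rewrite scalerN scalerA expfzDr // expr1z mulrN1 mulNr -expfzMl.
by rewrite mulrNN mulr1 exp1rz scaleNr opprK scale1r.
Qed.

Definition com u v := forall n : nat, u *[n%:Z] v = 0.
Definition der u := u *[-2] one.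

Lemma com_sym u v : com u v -> com v u.
Proof.
move=> h n; rewrite (@vp_skew n 0 u v) ?big_ord0 ?scaler0 // => j _.
exact: (h (n + j)%N).
Qed.

Lemma com_swap m l a b c : com a b -> a *[m] b *[l] c = b *[l] a *[m] c.
Proof.
by move=> h; rewrite (@vp_comm _ _ 0) ?big_ord0 ?addr0 // => j _; exact: h.
Qed.

(** For [m >= 0] the sum is cut off by [binz m j], so no bound on the products of [a] and [b] is
    needed. *)
Lemma vp_commn (m : nat) l a b c :
  a *[m%:Z] b *[l] c = b *[l] a *[m%:Z] c
    + \sum_(j < m.+1) binz m%:Z j *: (a *[j%:Z] b) *[m%:Z + l - j%:Z] c.
Proof.
have [M hM] := vp_trunc a b.
rewrite (@vp_comm _ _ (M + m.+1)) => [|j hj]; last by apply: hM; lia.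
congr (_ + _).
apply: (@big_ord_support m.+1 (M + m.+1)
  (fun j => binz m%:Z j *: (a *[j%:Z] b) *[m%:Z + l - j%:Z] c)).
  exact: leq_addl.
by move=> j hj; rewrite binz_gt // scale0r.
Qed.

Lemma binz1 (a : int) : binz a 1 = a%:~R :> K.
Proof. by rewrite binzS binz0 mul1r subr0 divr1. Qed.

Lemma vp_comm0 l a b c : a *[0] b *[l] c = b *[l] a *[0] c + (a *[0] b) *[l] c.
Proof.
by rewrite (vp_commn 0) big_ord1 binz0 scale1r subr0 add0r.
Qed.

Lemma vp_comm1 l a b c : a *[1] b *[l] c =
  b *[l] a *[1] c + (a *[0] b) *[l + 1] c + (a *[1] b) *[l] c.
Proof.
rewrite (vp_commn 1) !big_ord_recl big_ord0 /= binz0 binz1 !scale1r.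
by rewrite subr0 [1 + l]addrC addr0 addrK addrA.
Qed.

Lemma vp_comm_current m l a b c : (forall j : nat, a *[j.+2%:Z] b = 0) ->
  a *[m] b *[l] c = b *[l] a *[m] c + (a *[0] b) *[m + l] c
    + m%:~R *: (a *[1] b) *[m + l - 1] c.
Proof.
move=> h; rewrite (@vp_comm _ _ 2) => [|[|[|j]] // _].
rewrite !big_ord_recl big_ord0 /= binz0 binz1 scale1r subr0 addr0.
by rewrite addrA.
Qed.

Lemma vp_iterN1 l M a b c :
  (forall j : nat, (M <= j)%N -> b *[l + j%:Z] c = 0 /\ a *[j%:Z] c = 0) ->
  (a *[-1] b) *[l] c = \sum_(j < M)
    (a *[-1 - j%:Z] b *[l + j%:Z] c + b *[l - 1 - j%:Z] a *[j%:Z] c).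
Proof.
move=> hM; rewrite (vp_iter _ hM); apply: eq_bigr => j _.
rewrite binzN1 // -exprMn mulrNN mulr1 expr1n scale1r.
by rewrite [-1 + l]addrC exprN1 invrN invr1 scaleN1r opprK.
Qed.

(** The bound 3 fits [a], [b] of weight 1 and [c] of weight at most 2, that is, quadratic fields in
    the currents acting on a current or on [R]. *)
Lemma vp_iterN1_0 a b c :
  (forall j : nat, b *[j.+3%:Z] c = 0 /\ a *[j.+3%:Z] c = 0) ->
  (a *[-1] b) *[0] c =
    a *[-1] b *[0] c + a *[-2] b *[1] c + a *[-3] b *[2] c
    + (b *[-1] a *[0] c + b *[-2] a *[1] c + b *[-3] a *[2] c).
Proof.
move=> h; rewrite (@vp_iterN1 _ 3) => [|[|[|[|j]]] // _]; last by rewrite add0r.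
rewrite !big_ord_recl big_ord0 /= addr0.
rewrite -[LHS]/(a *[-1] b *[0] c + b *[-1] a *[0] c
  + (a *[-2] b *[1] c + b *[-2] a *[1] c
  + (a *[-3] b *[2] c + b *[-3] a *[2] c + 0))).
by module_eq K (va_space V).
Qed.

Lemma vp_iterN1_1 a b c :
  (forall j : nat, b *[j.+3%:Z] c = 0 /\ a *[j.+3%:Z] c = 0) ->
  (a *[-1] b) *[1] c =
    a *[-1] b *[1] c + a *[-2] b *[2] c
    + (b *[0] a *[0] c + b *[-1] a *[1] c + b *[-2] a *[2] c).
Proof.
move=> h; rewrite (@vp_iterN1 _ 3) => [|[|[|[|j]]] // _]; last first.
  by split; [exact: (h j.+1).1 | exact: (h j).2].
have h3 : b *[3] c = 0 := (h 0%N).1.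
rewrite !big_ord_recl big_ord0 /=.
rewrite -[LHS]/(a *[-1] b *[1] c + b *[0] a *[0] c
  + (a *[-2] b *[2] c + b *[-1] a *[1] c
  + (a *[-3] b *[3] c + b *[-2] a *[2] c + 0))) h3 vp0r.
by module_eq K (va_space V).
Qed.

Lemma vp_iterN1_N1 a b c :
  (forall j : nat, b *[j.+2%:Z] c = 0 /\ a *[j.+2%:Z] c = 0) ->
  (a *[-1] b) *[-1] c =
    a *[-1] b *[-1] c + a *[-2] b *[0] c + a *[-3] b *[1] c
    + (b *[-2] a *[0] c + b *[-3] a *[1] c).
Proof.
move=> h; rewrite (@vp_iterN1 _ 3) => [|[|[|[|j]]] // _]; last first.
  by split; [exact: (h j).1 | exact: (h j.+1).2].
have h3 : a *[2] c = 0 := (h 0%N).2.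
rewrite !big_ord_recl big_ord0 /=.
rewrite -[LHS]/(a *[-1] b *[-1] c + b *[-2] a *[0] c
  + (a *[-2] b *[0] c + b *[-3] a *[1] c
  + (a *[-3] b *[1] c + b *[-4] a *[2] c + 0))) h3 vp0r.
by module_eq K (va_space V).
Qed.

(** In the iterate of [a *[-2] one] only the term with mode -1 of the vacuum survives. It comes from
    the second half of the formula for [l > 0], from the first half for [l < 0], and does not occur
    for [l = 0]. *)
Lemma vp_der l a c : der a *[l] c = - l%:~R *: a *[l - 1] c.
Proof.
have [M hM] := vp_trunc a c.
pose N := (M + absz l).+2.
rewrite /der (@vp_iter _ _ N); last first.
  move=> j; rewrite /N => hj; rewrite hM; last by lia.
  by rewrite vp1l ifF //; apply/eqP; lia.
have cE j : (-1) ^+ j * binz (-2) j = j.+1%:R :> K.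
  by rewrite binzN2 // mulrA -exprMn mulrNN mulr1 expr1n mul1r.
have -> : (-1 : K) ^ (-2) = 1 by rewrite -exprnN expr2 mulrNN mulr1 invr1.
under eq_bigr do rewrite cE scale1r !vp1l.
case: l @N => [[|l]|l] N.
- rewrite big1 ?oppr0 ?scale0r // => j _.
  by rewrite !ifF ?vp0r ?subr0 ?scaler0 //; apply/eqP; lia.
- have hl : (l < N)%N by rewrite /N; lia.
  rewrite (bigD1 (Ordinal hl)) //= big1 ?addr0.
    rewrite ifT; last by apply/eqP; lia.
    rewrite vp0r sub0r scalerN scaleNr; congr (- (_ *: _ *[ _ ] _)); lia.
  by move=> j /eqP hj; rewrite !ifF ?vp0r ?subr0 ?scaler0 //; apply/eqP => e;
    first [lia | apply: hj; apply: val_inj => /=; lia].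
- have hl : (l < N)%N by rewrite /N; lia.
  rewrite (bigD1 (Ordinal hl)) //= big1 ?addr0.
    rewrite ifT; last by apply/eqP; lia.
    rewrite ifF; last by apply/eqP; lia.
    rewrite subr0 NegzE mulrNz opprK; congr (_ *: _ *[ _ ] _); lia.
  by move=> j /eqP hj; rewrite !ifF ?vp0r ?subr0 ?scaler0 //; apply/eqP => e;
    first [lia | apply: hj; apply: val_inj => /=; lia].
Qed.

Lemma der_vp n a b : der (a *[n] b) = a *[n] der b - n%:~R *: a *[n - 1] b.
Proof.
rewrite /der (@vp_iter _ _ 2) => [|[|[|j]] // _]; last first.
  by rewrite vp1r0 (_ : -2 + j.+2%:Z = j%:Z) ?vp1r0 //; lia.
rewrite !big_ord_recl big_ord0 /= !vp1r0 !vp0r scaler0 !subr0 expr0 expr1.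
by rewrite binz0 binz1 mulr1 scale1r mulN1r scaleNr vp1r addr0.
Qed.

Lemma vp_der0 a b : a *[0] der b = der (a *[0] b).
Proof. by rewrite der_vp scale0r subr0. Qed.
Lemma vp_der1 a b : a *[1] der b = der (a *[1] b) + a *[0] b.
Proof. by rewrite der_vp scale1r subrK. Qed.

Lemma der1 : der one = 0.
Proof. by rewrite /der vp1l. Qed.
Lemma derD a b : der (a + b) = der a + der b. Proof. exact: vpDl. Qed.
Lemma derN a : der (- a) = - der a. Proof. exact: vpNl. Qed.
Lemma derZ (x : K) a : der (x *: a) = x *: der a. Proof. exact: vpZl. Qed.
Lemma der0 : der 0 = 0. Proof. exact: vp0l. Qed.
Lemma der_sum I (r : seq I) (P : pred I) (F : I -> Vs) :
  der (\sum_(i <- r | P i) F i) = \sum_(i <- r | P i) der (F i).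
Proof. exact: vp_suml. Qed.

Lemma der_der a : der (der a) = 2%:R *: a *[-3] one.
Proof. by rewrite [LHS]vp_der; congr (_ *: _); ring. Qed.

Lemma com_mul m a b : com a b -> a *[m] b = b *[-1] a *[m] one.
Proof. by move=> h; rewrite -[in LHS](vp1r b) com_swap. Qed.

Lemma comD a b c : com a c -> com b c -> com (a + b) c.
Proof. by move=> h k n; rewrite vpDl h k addr0. Qed.
Lemma com0 c : com 0 c. Proof. by move=> n; rewrite vp0l. Qed.
Lemma comZ (x : K) a c : com a c -> com (x *: a) c.
Proof. by move=> h n; rewrite vpZl h scaler0. Qed.
Lemma comN a c : com a c -> com (- a) c.
Proof. by move=> h n; rewrite vpNl h oppr0. Qed.
Lemma com_sum I (r : seq I) (P : pred I) (F : I -> Vs) c :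
  (forall i, P i -> com (F i) c) -> com (\sum_(i <- r | P i) F i) c.
Proof.
move=> h; elim/big_ind: _ => //; first exact: com0.
by move=> x y hx hy; exact: comD.
Qed.
Lemma com_vac c : com one c.
Proof. by move=> n; rewrite vp1l. Qed.

Lemma comM l a b c : com a c -> com b c -> com (a *[l] b) c.
Proof.
move=> /com_sym ha /com_sym hb; apply: com_sym => n.
by rewrite (com_swap _ _ _ ha) hb vp0r.
Qed.
Lemma com_der a c : com a c -> com (der a) c.
Proof. by move=> h; apply: comM h (com_vac _). Qed.
End Calculus.

(** * Adding a column of full height *)

Section Rectangular.
Variables (K : fieldType) (ch : char0 K) (V : valg K) (I : finType) (al : K).
Local Notation Vs := (va_space V).
Local Notation one := (va_vac V).
Local Notation "a *[ n ] b" := (@va_prod K V n a b).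

Ltac vmod := module_eq K (va_space V).

Lemma sum_deltal (a : I) (F : I -> Vs) : \sum_x (x == a)%:R *: F x = F a.
Proof.
rewrite (bigD1 a) //= eqxx scale1r big1 ?addr0 // => x /negbTE ->.
by rewrite scale0r.
Qed.

Lemma sum_deltar (a : I) (F : I -> Vs) : \sum_x (a == x)%:R *: F x = F a.
Proof. by under eq_bigr do rewrite eq_sym; exact: sum_deltal. Qed.

(** Currents of gl(I) for the form [k1 tr(xy) + k2 tr(x) tr(y)]. A sum of [m] full columns has
    [k1 = al m] and [k2 = m]. *)
Record affine (k1 k2 : K) (W : I -> I -> Vs) : Prop := Affine {
  aff0 : forall x y z w,
    W x y *[0] W z w = (y == z)%:R *: W x w - (x == w)%:R *: W z y;
  aff1 : forall x y z w, W x y *[1] W z w =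
    (k1 * (y == z)%:R * (x == w)%:R + k2 * (x == y)%:R * (z == w)%:R) *: one;
  aff2 : forall (n : nat) x y z w, W x y *[n.+2%:Z] W z w = 0
}.

Section Step.
Variables (be : K) (W R E : I -> I -> Vs).
Hypothesis affW : affine (al * be) be W.
Hypothesis affE : affine al 1 E.
Hypothesis comWE : forall x y z w, com (W x y) (E z w).
Hypothesis comER : forall x y z w, com (E x y) (R z w).

(** Product 0 is the adjoint action; products 1 and 2 are anomalies. Both vanish at [be = 1], in
    accordance with [R = 0] for a single column. The factor [be (be - 1)] counts each pair of
    columns twice: every step adds [2 al be] through the product 2 of [W] with [al der W]. *)
Definition dressed (W R : I -> I -> Vs) (be : K) : Prop :=
  [/\ forall x y j l, W x y *[0] R j l =
        (y == j)%:R *: R x l - (x == l)%:R *: R j y,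
      forall x y j l, W x y *[1] R j l = (be - 1) *:
        ((al * (x == l)%:R) *: W j y + (x == y)%:R *: W j l),
      forall x y j l, W x y *[2] R j l = - (al * be * (be - 1)
        * (al * (y == j)%:R * (x == l)%:R + (x == y)%:R * (j == l)%:R)) *: one
    & forall (n : nat) x y j l, W x y *[n.+3%:Z] R j l = 0].

(* Only for [{p, r}] disjoint from [{j, l}]; for general indices further terms
   occur. *)
Definition crossed (W R : I -> I -> Vs) (be : K) (p r j l : I) : Prop :=
  R p r *[0] R j l = W j r *[-1] R p l - W p l *[-1] R j r
    + ((be - 1) * al) *: W p l *[-2] W j r + (be - 1) *: W p r *[-2] W j l
    - (al * be * (be - 1) * (j == l)%:R) *: W p r *[-3] one /\
  R p r *[1] R j l = - ((j == l)%:R *: R p r)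
    + ((be - 1) * al) *: W p l *[-1] W j r + (be - 1) *: W p r *[-1] W j l
    - (al * be * (be - 1) * (j == l)%:R) *: der (W p r).

Hypothesis dresR : dressed W R be.

Let W0R := let: And4 h _ _ _ := dresR in h.
Let W1R := let: And4 _ h _ _ := dresR in h.
Let W2R := let: And4 _ _ h _ := dresR in h.
Let W3R := let: And4 _ _ _ h := dresR in h.

Definition nextS (j l : I) : Vs := \sum_x W x l *[-1] E j x.
(** The term [al der W] is forced by the coefficients [gamma] of [W^(2)]: each full column
    contributes one [al] to the [gamma] of every column before it; see [gam_colW]. *)
Definition nextR (j l : I) : Vs := R j l + nextS j l - al *: der (W j l).
Definition nextW (j l : I) : Vs := W j l + E j l.

Let comEW x y z w : com (E x y) (W z w).
Proof. exact: com_sym. Qed.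
Let comRE x y z w : com (R x y) (E z w).
Proof. exact: com_sym. Qed.

Lemma next_affine : affine (al * (be + 1)) (be + 1) nextW.
Proof.
split=> [x y z w|x y z w|n x y z w]; rewrite /nextW !vpE.
- rewrite (aff0 affW) (aff0 affE) (comWE _ _ _ _ 0) (comEW _ _ _ _ 0).
  by vmod.
- rewrite (aff1 affW) (aff1 affE) (comWE _ _ _ _ 1) (comEW _ _ _ _ 1).
  by vmod.
- rewrite (aff2 affW) (aff2 affE) (comWE _ _ _ _ n.+2) (comEW _ _ _ _ n.+2).
  by rewrite !addr0.
Qed.

Let derE1 (c : K) : der (c *: one) = 0 :> Vs.
Proof. by rewrite derZ der1 scaler0. Qed.

Let vpr_der (a b : Vs) n : a *[n] der b = der (a *[n] b) + n%:~R *: a *[n - 1] b.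
Proof. by rewrite der_vp subrK. Qed.

Let E_derW n x y j l : E x y *[n%:Z] der (W j l) = 0.
Proof. exact/com_sym/com_der/comWE. Qed.

Let E_W (n : nat) x y j l : E x y *[n%:Z] W j l = 0. Proof. exact: comEW. Qed.
Let W_E (n : nat) x y j l : W x y *[n%:Z] E j l = 0. Proof. exact: comWE. Qed.
Let E_R (n : nat) x y j l : E x y *[n%:Z] R j l = 0. Proof. exact: comER. Qed.
Let R_E (n : nat) x y j l : R x y *[n%:Z] E j l = 0. Proof. exact: comRE. Qed.
Let E_W0 x y j l : E x y *[0] W j l = 0. Proof. exact: (comEW _ _ _ _ 0). Qed.
Let W_E0 x y j l : W x y *[0] E j l = 0. Proof. exact: (comWE _ _ _ _ 0). Qed.
Let E_R0 x y j l : E x y *[0] R j l = 0. Proof. exact: (comER _ _ _ _ 0). Qed.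
Let R_E0 x y j l : R x y *[0] E j l = 0. Proof. exact: (comRE _ _ _ _ 0). Qed.

Lemma W_S0 x y j l : W x y *[0] nextS j l =
  W x l *[-1] E j y - (x == l)%:R *: nextS j y.
Proof.
rewrite /nextS vp_sumr.
under eq_bigr do rewrite vp_comm0 W_E0 (aff0 affW) !vpE add0r.
by rewrite big_split /= sum_deltar sumrN -scaler_sumr.
Qed.

Lemma E_S0 x y j l : E x y *[0] nextS j l =
  (y == j)%:R *: nextS x l - W x l *[-1] E j y.
Proof.
rewrite /nextS vp_sumr.
under eq_bigr do rewrite vp_comm0 E_W0 (aff0 affE) !vpE addr0.
by rewrite big_split /= sumrN sum_deltar -scaler_sumr.
Qed.

Lemma W_S1 x y j l : W x y *[1] nextS j l =
  be *: ((al * (x == l)%:R) *: E j y + (x == y)%:R *: E j l).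
Proof.
rewrite /nextS vp_sumr.
have h u : W x y *[1] W u l *[-1] E j u =
    (y == u)%:R *: ((al * be * (x == l)%:R) *: E j u)
    + (u == l)%:R *: ((be * (x == y)%:R) *: E j u).
  rewrite vp_comm1 (W_E 1) vp0r add0r (aff0 affW) !vpE (aff1 affW) !vpE.
  rewrite addNr !W_E0 !scaler0 subrr add0r vp1l eqxx.
  by vmod.
under eq_bigr do rewrite h.
by rewrite big_split /= sum_deltar sum_deltal; vmod.
Qed.

Lemma E_S1 x y j l : E x y *[1] nextS j l =
  (al * (y == j)%:R) *: W x l + (x == y)%:R *: W j l.
Proof.
rewrite /nextS vp_sumr.
have h u : E x y *[1] W u l *[-1] E j u =
    (x == u)%:R *: ((al * (y == j)%:R) *: W u l)
    + (j == u)%:R *: ((x == y)%:R *: W u l).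
  rewrite vp_comm1 E_W0 (E_W 1) !vp0l !addr0 (aff1 affE) vpZr vp1r.
  by vmod.
under eq_bigr do rewrite h.
by rewrite big_split /= !sum_deltar.
Qed.

Lemma W_S2 n x y j l : W x y *[n.+2%:Z] nextS j l = 0.
Proof.
rewrite /nextS vp_sumr big1 // => u _.
rewrite vp_commn W_E vp0r add0r big1 // => -[[|[|i]] hi] _ /=.
- rewrite (aff0 affW) !vpE.
  have -> : n.+2%:Z + -1 - 0 = n.+1%:Z by lia.
  by rewrite !W_E !scaler0 subrr scaler0.
- rewrite (aff1 affW) vpZl vp1l.
  have -> : n.+2%:Z + -1 - 1 = n%:Z by lia.
  by rewrite /= !scaler0.
- by rewrite (aff2 affW i) vp0l scaler0.
Qed.

Lemma E_S2 n x y j l : E x y *[n.+2%:Z] nextS j l = 0.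
Proof.
rewrite /nextS vp_sumr big1 // => u _.
rewrite vp_commn (aff2 affE) vp0r add0r big1 // => i _.
by rewrite E_W vp0l scaler0.
Qed.

Lemma next_dressed : dressed nextW nextR (be + 1).
Proof.
split=> [x y j l|x y j l|x y j l|n x y j l]; rewrite /nextW /nextR !vpE.
- rewrite W0R E_R0 W_S0 E_S0 vpr_der (aff0 affW) (E_derW 0) !derD !derN !derZ.
  by vmod.
- rewrite W1R (E_R 1) W_S1 E_S1 vpr_der (aff1 affW) (E_derW 1) derE1 (aff0 affW).
  by vmod.
- rewrite W2R (E_R 2) (W_S2 0) (E_S2 0) vpr_der (aff2 affW 0) (E_derW 2) der0 (aff1 affW).
  by vmod.
- rewrite W3R E_R W_S2 E_S2 vpr_der (aff2 affW) E_derW der0.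
  have -> : n.+3%:Z - 1 = n.+2%:Z by lia.
  by rewrite (aff2 affW) !scaler0; vmod.
Qed.

(** Skew-symmetry would also give a second derivative of the product 2, but that product is a
    multiple of the vacuum. *)
Lemma R_W0 x y p r : R p r *[0] W x y =
  der (W x y *[1] R p r) - W x y *[0] R p r.
Proof.
rewrite (@vp_skew _ ch _ _ 3 (W x y)) => [|[|[|[|n]]] // _]; last first.
  by rewrite add0r W3R.
rewrite !big_ord_recl big_ord0 W2R !vpE vp1l /= vp1r /der expr1 add0r expr1z.
by rewrite !scaler0 !addr0 scale1r !scaleN1r opprB.
Qed.

Lemma R_W1 x y p r : R p r *[1] W x y = W x y *[1] R p r.
Proof.
rewrite (@vp_skew _ ch _ _ 2 (W x y)) => [|[|[|n]] // _]; last first.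
  by rewrite (_ : 1 + n.+2%:Z = n.+3%:Z) ?W3R //; lia.
rewrite !big_ord_recl big_ord0 /= W2R !vpE vp1l /= vp1r.
have -> : (-1 : K) ^ (1 + 1) = 1 by rewrite (_ : 1 + 1 = 2%:Z) // -exprnP sqrrN expr1n.
by rewrite !scaler0 !addr0 expr0 !scale1r.
Qed.

Section Pair.
Variables (p r j l : I).
Hypothesis (pr : (p == r) = false) (pj : (p == j) = false)
  (pl : (p == l) = false) (rj : (r == j) = false) (rl : (r == l) = false).
Let rp : (r == p) = false. Proof. by rewrite eq_sym. Qed.
Let jp : (j == p) = false. Proof. by rewrite eq_sym. Qed.
Let lp : (l == p) = false. Proof. by rewrite eq_sym. Qed.
Let jr : (j == r) = false. Proof. by rewrite eq_sym. Qed.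
Let lr : (l == r) = false. Proof. by rewrite eq_sym. Qed.
Let natF : false%:R = 0 :> K. Proof. by []. Qed.
Let neqs := (natF, pr, pj, pl, rj, rl, rp, jp, lp, jr, lr).
Let d : K := (j == l)%:R.
Let dE : (l == j)%:R = d. Proof. by rewrite eq_sym. Qed.

Lemma R_W0_jl : R p r *[0] W j l = ((be - 1) * d) *: der (W p r).
Proof.
rewrite R_W0 W0R W1R !neqs /d derZ derD !derZ; by vmod.
Qed.

Lemma R_W1_jl : R p r *[1] W j l = ((be - 1) * d) *: W p r.
Proof. by rewrite R_W1 W1R !neqs /d; vmod. Qed.

Lemma derN1 (a c : Vs) : der a *[-1] c = a *[-2] c.
Proof. by rewrite (vp_der ch) -[RHS]scale1r; congr (_ *: _); ring. Qed.

Lemma R_S0 : R p r *[0] nextS j l =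
  R p l *[-1] E j r + ((be - 1) * al) *: W p l *[-2] E j r
    + (be - 1) *: W p r *[-2] E j l.
Proof.
rewrite /nextS vp_sumr.
have h x : R p r *[0] W x l *[-1] E j x =
  (r == x)%:R *: (R p l *[-1] E j x + ((be - 1) * al) *: W p l *[-2] E j x)
  + (x == l)%:R *: ((be - 1) *: W p r *[-2] E j x).
  rewrite vp_comm0 R_E0 vp0r add0r R_W0 W0R W1R !neqs.
  rewrite derZ derD !derZ !vpE !derN1 [x == r]eq_sym.
  by vmod.
under eq_bigr do rewrite h.
by rewrite big_split /= sum_deltar sum_deltal.
Qed.

Let iterS0 a u z w c :
  (forall n : nat, E a u *[n.+3%:Z] c = 0) -> (forall n : nat, W z w *[n.+3%:Z] c = 0) ->
  (W z w *[-1] E a u) *[0] c =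
    W z w *[-1] E a u *[0] c + W z w *[-2] E a u *[1] c + W z w *[-3] E a u *[2] c
    + (E a u *[-1] W z w *[0] c + E a u *[-2] W z w *[1] c + E a u *[-3] W z w *[2] c).
Proof. by move=> h k; rewrite vp_iterN1_0. Qed.

Let iterS1 a u z w c :
  (forall n : nat, E a u *[n.+3%:Z] c = 0) -> (forall n : nat, W z w *[n.+3%:Z] c = 0) ->
  (W z w *[-1] E a u) *[1] c =
    W z w *[-1] E a u *[1] c + W z w *[-2] E a u *[2] c
    + (E a u *[0] W z w *[0] c + E a u *[-1] W z w *[1] c + E a u *[-2] W z w *[2] c).
Proof. by move=> h k; rewrite vp_iterN1_1. Qed.

Let EmW n x y z w : E x y *[n] W z w = W z w *[-1] E x y *[n] one.
Proof. exact: com_mul. Qed.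
Let EmR n x y z w : E x y *[n] R z w = R z w *[-1] E x y *[n] one.
Proof. exact: com_mul. Qed.

Lemma S_W0 x : nextS p r *[0] W x l =
  (x == r)%:R *: nextS p l - W x r *[-1] E p l
  + (be * al * (x == r)%:R) *: der (E p l) + (be * (x == l)%:R) *: der (E p r).
Proof.
rewrite /nextS vp_suml.
have h u : (W u r *[-1] E p u) *[0] W x l =
  (x == r)%:R *: W u l *[-1] E p u
  + (u == l)%:R *: (- (W x r *[-1] E p u) + (be * al * (x == r)%:R) *: der (E p u))
  + (u == r)%:R *: ((be * (x == l)%:R) *: der (E p u)).
  rewrite iterS0 => [|n|n]; [|exact: E_W|exact: (aff2 affW n.+1)].
  rewrite E_W0 (E_W 1) (E_W 2) (aff2 affW 0) (aff1 affW) (aff0 affW) !vpE.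
  by rewrite !EmW !vp1r /der [r == x]eq_sym; vmod.
under eq_bigr do rewrite h.
by rewrite !big_split /= !sum_deltal -scaler_sumr; vmod.
Qed.

Lemma S_E0 x : nextS p r *[0] E j x =
  W j r *[-1] E p x - (x == p)%:R *: nextS j r
  + (al * (x == p)%:R) *: der (W j r) + (x == j)%:R *: der (W p r).
Proof.
rewrite /nextS vp_suml.
have h u : (W u r *[-1] E p u) *[0] E j x =
  (u == j)%:R *: (W u r *[-1] E p x + (al * (x == p)%:R) *: der (W u r))
  - (x == p)%:R *: W u r *[-1] E j u
  + (p == u)%:R *: ((x == j)%:R *: der (W u r)).
  rewrite iterS0 => [|n|n]; [|exact: (aff2 affE n.+1)|exact: W_E].
  rewrite W_E0 (W_E 1) (W_E 2) (aff2 affE 0) (aff1 affE) (aff0 affE) !vpE.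
  by rewrite /der [p == x]eq_sym [j == x]eq_sym; vmod.
under eq_bigr do rewrite h.
by rewrite !big_split /= sum_deltal sum_deltar sumrN -scaler_sumr; vmod.
Qed.

Lemma S_W1 x : nextS p r *[1] W x l =
  (be * al * (x == r)%:R) *: E p l + (be * (x == l)%:R) *: E p r.
Proof.
rewrite /nextS vp_suml.
have h u : (W u r *[-1] E p u) *[1] W x l =
  (u == l)%:R *: ((be * al * (x == r)%:R) *: E p u)
  + (u == r)%:R *: ((be * (x == l)%:R) *: E p u).
  rewrite iterS1 => [|n|n]; [|exact: E_W|exact: (aff2 affW n.+1)].
  rewrite (E_W 1) (E_W 2) (aff2 affW 0) (aff1 affW) (aff0 affW) !vpE.
  by rewrite !E_W0 vp1r [r == x]eq_sym; vmod.
under eq_bigr do rewrite h.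
by rewrite !big_split /= !sum_deltal.
Qed.

Lemma S_E1 x : nextS p r *[1] E j x =
  (al * (x == p)%:R) *: W j r + (x == j)%:R *: W p r.
Proof.
rewrite /nextS vp_suml.
have h u : (W u r *[-1] E p u) *[1] E j x =
  (u == j)%:R *: ((al * (x == p)%:R) *: W u r)
  + (p == u)%:R *: ((x == j)%:R *: W u r).
  rewrite iterS1 => [|n|n]; [|exact: (aff2 affE n.+1)|exact: W_E].
  rewrite W_E0 (W_E 1) (W_E 2) (aff2 affE 0) (aff1 affE) !vpE vp1r.
  by rewrite [p == x]eq_sym [j == x]eq_sym; vmod.
under eq_bigr do rewrite h.
by rewrite !big_split /= sum_deltal sum_deltar.
Qed.

Lemma S_R0 : nextS p r *[0] R j l =
  - (R j r *[-1] E p l) + ((be - 1) * al) *: W j r *[-1] der (E p l)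
  + (be - 1) *: W j l *[-1] der (E p r)
  - (al * be * (be - 1) * d) *: E p r *[-3] one.
Proof.
rewrite /nextS vp_suml.
have h u : (W u r *[-1] E p u) *[0] R j l =
  (u == l)%:R *: (- (R j r *[-1] E p u) + ((be - 1) * al) *: W j r *[-1] der (E p u))
  + (u == r)%:R *: ((be - 1) *: W j l *[-1] der (E p u)
                    - (al * be * (be - 1) * d) *: E p u *[-3] one).
  rewrite iterS0 => [|n|n]; [|exact: E_R|exact: W3R].
  rewrite E_R0 (E_R 1) (E_R 2) W2R W1R W0R !neqs !vpE.
  by rewrite !EmW !EmR vp1r -/d /der; vmod.
under eq_bigr do rewrite h.
by rewrite !big_split /= !sum_deltal; vmod.
Qed.

Lemma S_R1 : nextS p r *[1] R j l =
  ((be - 1) * al) *: W j r *[-1] E p l + (be - 1) *: W j l *[-1] E p r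
  - (al * be * (be - 1) * d) *: der (E p r).
Proof.
rewrite /nextS vp_suml.
have h u : (W u r *[-1] E p u) *[1] R j l =
  (u == l)%:R *: (((be - 1) * al) *: W j r *[-1] E p u)
  + (u == r)%:R *: ((be - 1) *: W j l *[-1] E p u
                    - (al * be * (be - 1) * d) *: der (E p u)).
  rewrite iterS1 => [|n|n]; [|exact: E_R|exact: W3R].
  rewrite (E_R 1) (E_R 2) W2R W1R W0R !neqs !vpE.
  by rewrite !EmW !E_R0 !vp1r -/d /der; vmod.
under eq_bigr do rewrite h.
by rewrite !big_split /= !sum_deltal; vmod.
Qed.

(** Reassociation to the right; the corrections come from the products 0 and 1 of the two currents
    of the same column. *)
Let WE_E a b z w u v : (W a b *[-1] E z w) *[-1] E u v =
  W a b *[-1] E z w *[-1] E u v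
  + W a b *[-2] ((w == u)%:R *: E z v - (z == v)%:R *: E u w)
  + (al * (w == u)%:R * (z == v)%:R + 1 * (z == w)%:R * (u == v)%:R) *: W a b *[-3] one.
Proof.
rewrite vp_iterN1_N1 // => [|m]; last by split; [exact: (aff2 affE) | exact: W_E].
rewrite W_E0 (W_E 1) (aff0 affE) (aff1 affE) !vpE; by vmod.
Qed.

Lemma S_S0 : nextS p r *[0] nextS j l =
  \sum_x W x l *[-1] W j r *[-1] E p x - W p l *[-1] nextS j r
  + al *: W p l *[-1] der (W j r) + W j l *[-1] der (W p r)
  + \sum_x W x l *[-1] E p x *[-1] E j r + W j l *[-2] E p r
  - \sum_x W x r *[-1] E p l *[-1] E j x - d *: \sum_x W x r *[-2] E p x
  + W p r *[-2] E j l - (al * d) *: W p r *[-3] one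
  + (be * al) *: E p l *[-2] E j r + be *: E p r *[-2] E j l.
Proof.
rewrite {2}/nextS vp_sumr.
have h x : nextS p r *[0] W x l *[-1] E j x =
    W x l *[-1] W j r *[-1] E p x - (x == p)%:R *: W x l *[-1] nextS j r
    + (x == p)%:R *: (al *: W x l *[-1] der (W j r))
    + (x == j)%:R *: W x l *[-1] der (W p r)
    + (x == r)%:R *: nextS p l *[-1] E j x
    - W x r *[-1] E p l *[-1] E j x
    - d *: W x r *[-2] E p x + (p == x)%:R *: W x r *[-2] E j l
    - (p == x)%:R *: ((al * d) *: W x r *[-3] one)
    + (x == r)%:R *: ((be * al) *: E p l *[-2] E j x)
    + (x == l)%:R *: (be *: E p r *[-2] E j x).
  rewrite vp_comm0 S_W0 S_E0 !vpE !derN1 WE_E !vpE !neqs dE.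
  by vmod.
have e : nextS p l *[-1] E j r =
    \sum_x W x l *[-1] E p x *[-1] E j r + W j l *[-2] E p r.
  rewrite {1}/nextS vp_suml.
  under eq_bigr do rewrite WE_E !vpE !neqs !(mulr0, mul0r, addr0, scale0r, subr0).
  by rewrite big_split /= sum_deltal.
under eq_bigr do rewrite h.
rewrite !big_split /= !sumrN !sum_deltal !sum_deltar -!scaler_sumr e.
by vmod.
Qed.

Lemma S_S1 : nextS p r *[1] nextS j l =
  al *: W p l *[-1] W j r + W j l *[-1] W p r + W j l *[-1] E p r
  - d *: nextS p r + W p r *[-1] E j l - (al * d) *: der (W p r)
  + (be * al) *: E p l *[-1] E j r + be *: E p r *[-1] E j l.
Proof.
have WE0 a b z w u v : (W a b *[-1] E z w) *[0] E u v =
    W a b *[-1] ((w == u)%:R *: E z v - (z == v)%:R *: E u w)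
    + (al * (w == u)%:R * (z == v)%:R + 1 * (z == w)%:R * (u == v)%:R) *: der (W a b).
  rewrite iterS0 => [|n|n]; [|exact: (aff2 affE n.+1)|exact: W_E].
  rewrite W_E0 (W_E 1) (W_E 2) (aff2 affE 0) (aff1 affE) (aff0 affE) !vpE.
  by rewrite /der; vmod.
rewrite {2}/nextS vp_sumr.
have h x : nextS p r *[1] W x l *[-1] E j x =
    (x == p)%:R *: (al *: W x l *[-1] W j r)
    + (x == j)%:R *: W x l *[-1] W p r
    + (x == r)%:R *: nextS p l *[0] E j x
    - d *: W x r *[-1] E p x + (p == x)%:R *: W x r *[-1] E j l
    - (p == x)%:R *: ((al * d) *: der (W x r))
    + (x == r)%:R *: ((be * al) *: E p l *[-1] E j x)
    + (x == l)%:R *: (be *: E p r *[-1] E j x).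
  rewrite vp_comm1 S_W0 S_E1 S_W1 addNr !vpE WE0 !vpE !(vp_der ch) !neqs dE.
  by vmod.
have e : nextS p l *[0] E j r = W j l *[-1] E p r.
  rewrite {1}/nextS vp_suml.
  under eq_bigr do rewrite WE0 !vpE !neqs !(mulr0, mul0r, addr0, scale0r, subr0).
  by rewrite sum_deltal.
under eq_bigr do rewrite h.
rewrite !big_split /= !sumrN !sum_deltal !sum_deltar -!scaler_sumr e.
by vmod.
Qed.

Let WW (n : int) x y z w c : W x y *[-1] W z w *[n] c = W z w *[n] W x y *[-1] c
    + (y == z)%:R *: W x w *[n - 1] c - (x == w)%:R *: W z y *[n - 1] c
    - (al * be * (y == z)%:R * (x == w)%:R + be * (x == y)%:R * (z == w)%:R)
      *: one *[n - 1 - 1] c.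
Proof.
rewrite vp_comm_current => [|m]; last exact: (aff2 affW).
rewrite (aff0 affW) (aff1 affW) !vpE [-1 + n]addrC.
by vmod.
Qed.

Let EE x y z w : E x y *[-1] E z w = E z w *[-1] E x y
    + (y == z)%:R *: der (E x w) - (x == w)%:R *: der (E z y).
Proof.
rewrite -[E z w in LHS]vp1r vp_comm_current => [|m]; last exact: (aff2 affE).
rewrite vp1r (aff0 affE) (aff1 affE) !vpE vp1l /= scaler0 scaler0 /der.
by vmod.
Qed.

(** Once each monomial is put in a normal order, with the old columns to the left of the new one,
    both sides are linear combinations of the same monomials. The equations [e1] to [e11] and [f1]
    to [f5] perform the reordering; the derivatives that it creates match those caused by the term
    [al der W] of [nextR]. *)
Lemma next_crossed : crossed W R be p r j l -> crossed nextW nextR (be + 1) p r j l.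
Proof.
case=> RR0 RR1; split.
- have e1 : W j r *[-1] nextS p l = \sum_x W x l *[-1] W j r *[-1] E p x
      + W j l *[-2] E p r - d *: \sum_x W x r *[-2] E p x.
    rewrite /nextS vp_sumr.
    under eq_bigr do rewrite WW vp1l /= !neqs scaler0 subr0.
    rewrite !big_split /= sum_deltar sumrN -scaler_sumr.
    by vmod.
  have e2 : E j r *[-1] nextS p l = \sum_x W x l *[-1] E p x *[-1] E j r
      - W j l *[-1] der (E p r).
    rewrite /nextS vp_sumr.
    under eq_bigr do rewrite (com_swap _ _ _ (comEW _ _ _ _)) EE !vpE !neqs scale0r addr0.
    rewrite !big_split /= sumrN.
    by rewrite (_ : \sum_x (j == x)%:R *: _ = W j l *[-1] der (E p r)) // sum_deltar.
  have e3 : E p l *[-1] nextS j r = \sum_x W x r *[-1] E p l *[-1] E j x.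
    rewrite /nextS vp_sumr.
    by under eq_bigr do rewrite (com_swap _ _ _ (comEW _ _ _ _)).
  have e4 : W j r *[-1] der (W p l) = W p l *[-2] W j r - d *: W p r *[-3] one.
    by rewrite /der WW vp1l /= vp1r !neqs -/d; vmod.
  have e5 : W j l *[-1] der (W p r) = W p r *[-2] W j l.
    by rewrite /der WW vp1l /= vp1r !neqs; vmod.
  have e6 : E j r *[-1] der (W p l) = W p l *[-2] E j r.
    by rewrite /der (com_swap _ _ _ (comEW _ _ _ _)) vp1r.
  have e7 : E p l *[-1] der (W j r) = W j r *[-2] E p l.
    by rewrite /der (com_swap _ _ _ (comEW _ _ _ _)) vp1r.
  rewrite /nextR /nextW !vpE RR0 R_S0 S_R0 S_S0 !vp_der0 R_W0_jl S_W0 !neqs !(vp_der ch 0).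
  rewrite e1 e2 e3 e4 e5 e6 e7.
  have e8 : E p l *[-2] W j r = W j r *[-1] der (E p l) by rewrite EmW.
  have e9 : E p r *[-2] W j l = W j l *[-1] der (E p r) by rewrite EmW.
  have e10 : E j r *[-1] R p l = R p l *[-1] E j r by rewrite EmR vp1r.
  have e11 : E p l *[-1] R j r = R j r *[-1] E p l by rewrite EmR vp1r.
  rewrite !derD !derN !derZ !(der_der ch) !der_vp -/d e8 e9 e10 e11.
  by vmod.
- have f1 : W j l *[-1] W p r = W p r *[-1] W j l.
    by rewrite -[W p r in LHS]vp1r WW vp1r vp1l /= !neqs scaler0 !scale0r !subr0 addr0.
  have f2 : W p r *[0] nextS j l = W p l *[-1] E j r.
    by rewrite W_S0 !neqs scale0r subr0.
  have f3 : R p r *[1] nextS j l =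
      ((be - 1) * al) *: W p l *[-1] E j r + (be - 1) *: W p r *[-1] E j l.
    rewrite /nextS vp_sumr.
    have h x : R p r *[1] W x l *[-1] E j x =
      (r == x)%:R *: (((be - 1) * al) *: W p l *[-1] E j x)
      + (x == l)%:R *: ((be - 1) *: W p r *[-1] E j x).
      rewrite vp_comm1 (R_E 1) vp0r add0r R_W1 R_W0 W0R W1R !neqs addNr.
      rewrite derZ derD !derZ !vpE !R_E0 !(vp_der ch) [x == r]eq_sym.
      by vmod.
    under eq_bigr do rewrite h.
    by rewrite big_split /= sum_deltar sum_deltal.
  have f4 : E p l *[-1] W j r = W j r *[-1] E p l by rewrite EmW vp1r.
  have f5 : E p r *[-1] W j l = W j l *[-1] E p r by rewrite EmW vp1r.
  rewrite /nextR /nextW !vpE RR1 f3 S_R1 S_S1 !vp_der1 R_W1_jl R_W0_jl S_W1 S_W0.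
  rewrite !(vp_der ch 1) W0R (aff0 affW) f2 f1 f4 f5 !neqs !derD !derZ.
  rewrite !scale0r !subr0 der0 (vp_der ch 0) -/d.
  by vmod.
Qed.

End Pair.

End Step.
End Rectangular.

(** * Fields with rows in distinct blocks *)

Section Commuting.
Variables (K : fieldType) (ch : char0 K) (V : valg K) (I : finType) (al : K).
Local Notation Vs := (va_space V).
Local Notation one := (va_vac V).
Local Notation "a *[ n ] b" := (@va_prod K V n a b).

Ltac vmod := module_eq K (va_space V).

(** Exactly what the bracket with a mode [u t^1] sees, since [binz 1 j] vanishes for [j > 1]. *)
Definition com1 (u v : Vs) := u *[0] v = 0 /\ u *[1] v = 0.

Lemma com_com1 u v : com u v -> com1 u v.
Proof. by move=> h; split; [exact: (h 0%N) | exact: (h 1%N)]. Qed.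

Lemma com1D u v w : com1 u w -> com1 v w -> com1 (u + v) w.
Proof. by case=> h0 h1 [k0 k1]; rewrite /com1 !vpDl h0 h1 k0 k1 addr0. Qed.

Lemma com1Dr u v w : com1 u v -> com1 u w -> com1 u (v + w).
Proof. by case=> h0 h1 [k0 k1]; rewrite /com1 !vpDr h0 h1 k0 k1 addr0. Qed.

Lemma com1Zr (c : K) u w : com1 u w -> com1 u (c *: w).
Proof. by case=> h0 h1; rewrite /com1 !vpZr h0 h1 scaler0. Qed.

Lemma com1_derr u w : com1 u w -> com1 u (der w).
Proof. by case=> h0 h1; rewrite /com1 vp_der0 vp_der1 h0 h1 der0 addr0. Qed.

(** The product [a *[0]] is a derivation of all products and annihilates [w]. *)
Lemma com1_vp0 a u w : a *[0] w = 0 -> com1 u w -> com1 (a *[0] u) w.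
Proof.
move=> h [h0 h1]; split.
  by have := vp_comm0 0 a u w; rewrite h h0 !vp0r add0r.
by have := vp_comm0 1 a u w; rewrite h h1 !vp0r add0r.
Qed.

Lemma sum_deltaS (S : pred I) (a : I) (F : I -> Vs) : S a ->
  \sum_(x | S x) (x == a)%:R *: F x = F a.
Proof.
move=> Sa; rewrite (bigD1 a) //= eqxx scale1r big1 ?addr0 // => x /andP[_ /negbTE ->].
by rewrite scale0r.
Qed.

Section Block.
Variables (be : K) (W R : I -> I -> Vs) (S : pred I).
Hypothesis affW : affine (al * be) be W.
Hypothesis dresR : dressed al W R be.

Let W0R := let: And4 h _ _ _ := dresR in h.
Let W1R := let: And4 _ h _ _ := dresR in h.
Let W2R := let: And4 _ _ h _ := dresR in h.
Let W3R := let: And4 _ _ _ h := dresR in h.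

Let natF : false%:R = 0 :> K. Proof. by []. Qed.
Let natT : true%:R = 1 :> K. Proof. by []. Qed.

Lemma W_com_R x y j l : x != y -> x != l -> y != j -> com (W x y) (R j l).
Proof.
move=> /negbTE xy /negbTE xl /negbTE yj [|[|[|n]]].
- by rewrite W0R xl yj !scale0r subrr.
- by rewrite W1R xl xy mulr0 !scale0r addr0 scaler0.
- by rewrite W2R xl xy natF; vmod.
- exact: W3R.
Qed.

Lemma W_com_W x y j l : x != y -> x != l -> y != j -> com (W x y) (W j l).
Proof.
move=> /negbTE xy /negbTE xl /negbTE yj [|[|n]].
- by rewrite (aff0 affW) xl yj !scale0r subrr.
- by rewrite (aff1 affW) xl xy natF; vmod.
- exact: (aff2 affW).
Qed.

(** The trace terms, which are the same for [W x x] and [W y y], cancel in the difference. *)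
Lemma W_diag_com_R x y j l : x != j -> x != l -> y != j -> y != l ->
  com (W x x - W y y) (R j l).
Proof.
move=> /negbTE xj /negbTE xl /negbTE yj /negbTE yl [|[|[|n]]]; rewrite vpDl vpNl.
- by rewrite !W0R xj xl yj yl !scale0r !subr0.
- by rewrite !W1R xl yl !eqxx natF; vmod.
- by rewrite !W2R xl yl xj yj !eqxx natF; vmod.
- by rewrite !W3R subrr.
Qed.

Lemma W_diag_com_W x y j l : x != j -> x != l -> y != j -> y != l ->
  com (W x x - W y y) (W j l).
Proof.
move=> /negbTE xj /negbTE xl /negbTE yj /negbTE yl [|[|n]]; rewrite vpDl vpNl.
- by rewrite !(aff0 affW) xj xl yj yl !scale0r !subr0.
- by rewrite !(aff1 affW) xl yl !eqxx natF; vmod.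
- by rewrite !(aff2 affW) subrr.
Qed.

Section Pair.
Variables (p r j l : I).
Hypothesis (pr : (p == r) = false) (Sp : ~~ S p) (Sr : ~~ S r)
  (Sj : S j) (Sl : S l).
Let neqS x y : S x -> ~~ S y -> (x == y) = false.
Proof. by move=> Sx Sy; apply: contraNF Sy => /eqP <-. Qed.
Let neqS' x y : S x -> ~~ S y -> (y == x) = false.
Proof. by move=> Sx Sy; rewrite eq_sym neqS. Qed.
Let pj := neqS' Sj Sp. Let pl := neqS' Sl Sp.
Let rj := neqS' Sj Sr. Let rl := neqS' Sl Sr.
Let jp := neqS Sj Sp. Let lp := neqS Sl Sp.
Let jr := neqS Sj Sr. Let lr := neqS Sl Sr.
Let rp : (r == p) = false. Proof. by rewrite eq_sym. Qed.
Let neqs := (natF, natT, pr, pj, pl, rj, rl, rp, jp, lp, jr, lr).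

(** The two corrections cancel different parts of [crossed]. The sum over [S] reproduces the terms
    with exchanged indices, from [u = j] and [u = l]. The product [W r r *[-1] W p r] reproduces the
    trace terms: [W r r] has nonzero products 1 and 2 with [R j l] in general, while [W p r] has
    none. *)
Definition crossQ : Vs :=
  R p r - \sum_(u | S u) W u r *[-1] W p u - W r r *[-1] W p r.

Hypothesis RR : crossed al W R be p r j l.

Let iter0 x y z w c : (forall n x y, W x y *[n.+3%:Z] c = 0) ->
  (W x y *[-1] W z w) *[0] c =
    W x y *[-1] W z w *[0] c + W x y *[-2] W z w *[1] c + W x y *[-3] W z w *[2] c
    + (W z w *[-1] W x y *[0] c + W z w *[-2] W x y *[1] c + W z w *[-3] W x y *[2] c).
Proof. by move=> h; rewrite vp_iterN1_0. Qed.

Let iter1 x y z w c : (forall n x y, W x y *[n.+3%:Z] c = 0) ->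
  (W x y *[-1] W z w) *[1] c =
    W x y *[-1] W z w *[1] c + W x y *[-2] W z w *[2] c
    + (W z w *[0] W x y *[0] c + W z w *[-1] W x y *[1] c + W z w *[-2] W x y *[2] c).
Proof. by move=> h; rewrite vp_iterN1_1. Qed.

Lemma crossQ_R : com1 crossQ (R j l).
Proof.
have [RR0 RR1] := RR; rewrite /com1 /crossQ !(vpDl, vpNl) RR0 RR1; split.
- rewrite vp_suml.
  have h u : S u -> (W u r *[-1] W p u) *[0] R j l =
      (u == j)%:R *: W u r *[-1] R p l
      + (u == l)%:R *: (- (W p u *[-1] R j r) + ((be - 1) * al) *: W p u *[-2] W j r).
    move=> Su; rewrite iter0 => [|n x y]; last exact: W3R.
    rewrite !W2R !W1R !W0R (neqS Su Sr) (neqS' Su Sp) !neqs !vpE.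
    by vmod.
  rewrite (eq_bigr _ h) big_split /= !sum_deltaS //.
  rewrite iter0 => [|n x y]; last exact: W3R.
  rewrite !W2R !W1R !W0R !eqxx !neqs !vpE.
  by vmod.
- rewrite vp_suml.
  have h u : S u -> (W u r *[-1] W p u) *[1] R j l =
      (u == l)%:R *: (- (W p u *[0] R j r) + ((be - 1) * al) *: W p u *[-1] W j r).
    move=> Su; rewrite iter1 => [|n x y]; last exact: W3R.
    rewrite !W2R !W1R [W u r *[0] _]W0R (neqS Su Sr) (neqS' Su Sp) !neqs !vpE.
    by vmod.
  rewrite (eq_bigr _ h) !sum_deltaS // W0R.
  rewrite iter1 => [|n x y]; last exact: W3R.
  rewrite !W2R !W1R !W0R [l == j]eq_sym !eqxx !neqs !vpE.
  by rewrite /der; vmod.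
Qed.

Lemma crossQ_W : com1 crossQ (W j l).
Proof.
rewrite /com1 /crossQ !(vpDl, vpNl).
rewrite (R_W0_jl ch dresR) // (R_W1_jl ch dresR) //.
have W3W n x y : W x y *[n.+3%:Z] W j l = 0 := aff2 affW n.+1 x y j l.
split.
- rewrite vp_suml.
  have h u : S u -> (W u r *[-1] W p u) *[0] W j l =
      (u == j)%:R *: W u r *[-1] W p l - (u == l)%:R *: W p u *[-1] W j r.
    move=> Su; rewrite iter0 // !(aff2 affW 0) !(aff1 affW) !(aff0 affW).
    rewrite (neqS Su Sr) (neqS' Su Sp) !neqs !vpE.
    by vmod.
  rewrite (eq_bigr _ h) big_split /= sumrN !sum_deltaS // iter0 //.
  rewrite !(aff2 affW 0) !(aff1 affW) !(aff0 affW) !eqxx !neqs !vpE.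
  have -> : W j r *[-1] W p l = W p l *[-1] W j r - (j == l)%:R *: der (W p r).
    rewrite -[W p l in LHS]vp1r vp_comm_current => [|m]; last exact: (aff2 affW).
    by rewrite vp1r (aff0 affW) (aff1 affW) !vpE vp1l /= !neqs /der; vmod.
  by rewrite /der; vmod.
- rewrite vp_suml.
  have h u : S u -> (W u r *[-1] W p u) *[1] W j l =
      (u == l)%:R *: (- (W p u *[0] W j r)).
    move=> Su; rewrite iter1 // !(aff2 affW 0) !(aff1 affW).
    rewrite [W u r *[0] _](aff0 affW) (neqS Su Sr) (neqS' Su Sp) !neqs !vpE.
    by vmod.
  rewrite (eq_bigr _ h) !sum_deltaS // iter1 //.
  rewrite !(aff2 affW 0) !(aff1 affW) !(aff0 affW) [l == j]eq_sym !eqxx !neqs !vpE !vp1r.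
  by vmod.
Qed.

End Pair.
End Block.
End Commuting.

(** * A row of columns: [b] full ones followed by a tail of shorter ones *)

Section Columns.
Variables (K : fieldType) (ch : char0 K) (V : valg K) (I : finType) (al : K).
Local Notation Vs := (va_space V).
Local Notation one := (va_vac V).
Local Notation "a *[ n ] b" := (@va_prod K V n a b).

Ltac vmod := module_eq K (va_space V).

Variables (E : nat -> I -> I -> Vs) (b L : nat).

Definition colW (m : nat) (x y : I) : Vs := \sum_(c < m) E c x y.

Fixpoint colR (m : nat) : I -> I -> Vs :=
  if m is m'.+1 then nextR al (colW m') (colR m') (E m') else fun _ _ => 0.

Hypothesis bL : (b <= L)%N.
Hypothesis affE : forall c, (c < b)%N -> affine al 1 (E c).
Hypothesis comE : forall c c' x y z w, (c < b)%N -> c' != c ->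
  com (E c x y) (E c' z w).

Lemma colWS m x y : colW m.+1 x y = colW m x y + E m x y.
Proof. by rewrite /colW big_ord_recr. Qed.

Lemma com_colW m c x y z w : (m <= c)%N -> (m <= b)%N -> com (colW m x y) (E c z w).
Proof.
move=> mc mb; apply: com_sum => i _; apply: comE.
  exact: leq_trans (ltn_ord i) mb.
by rewrite neq_ltn orbC (leq_trans (ltn_ord i) mc).
Qed.

Lemma com_colR m c x y z w : (m <= c)%N -> (m <= b)%N -> com (colR m x y) (E c z w).
Proof.
elim: m x y => [|m IH] x y mc mb /=; first exact: com0.
have comW u v : com (colW m u v) (E c z w).
  by apply: com_colW; [exact: ltnW | exact: ltnW].
rewrite /nextR /nextS; apply: comD; first apply: comD.
- by apply: IH; exact: ltnW.
- apply: com_sum => i _; apply: comM => //.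
  by apply: comE => //; rewrite neq_ltn mc orbT.
- exact/comN/comZ/com_der.
Qed.

Lemma colW_next m : colW m.+1 = nextW (colW m) (E m).
Proof. by apply: boolp.funext => x; apply: boolp.funext => y; rewrite colWS. Qed.

Lemma natSK m : m.+1%:R = m%:R + 1 :> K.
Proof. by rewrite -addn1 natrD. Qed.

Lemma col_affine m : (m <= b)%N -> affine (al * m%:R) m%:R (colW m).
Proof.
elim: m => [_|m IH mb].
  split=> *; rewrite /colW !big_ord0 !vpE // ?scaler0 ?subrr //.
  by vmod.
rewrite colW_next natSK; apply: (next_affine ch); first exact: (IH (ltnW mb)).
  exact: affE.
by move=> *; apply: com_colW => //; exact: ltnW.
Qed.

Lemma col_dressed m : (m <= b)%N -> dressed al (colW m) (colR m) m%:R.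
Proof.
elim: m => [_|m IH mb].
  split=> *; rewrite /= /colW ?big_ord0 ?vpE //; by vmod.
rewrite colW_next natSK; apply: (next_dressed ch).
- exact: (col_affine (ltnW mb)).
- exact: affE.
- by move=> *; apply: com_colW => //; exact: ltnW.
- by move=> *; apply: com_sym => //; apply: com_colR => //; exact: ltnW.
- exact: (IH (ltnW mb)).
Qed.

Lemma col_crossed m p r j l : (m <= b)%N ->
  p != r -> p != j -> p != l -> r != j -> r != l ->
  crossed al (colW m) (colR m) m%:R p r j l.
Proof.
move=> mb /negbTE pr /negbTE pj /negbTE pl /negbTE rj /negbTE rl.
elim: m mb => [_|m IH mb].
  by split; rewrite /= /colW ?big_ord0 ?vpE ?der0; vmod.
rewrite colW_next natSK; apply: (next_crossed ch) => //.
- exact: (col_affine (ltnW mb)).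
- exact: affE.
- by move=> *; apply: com_colW => //; exact: ltnW.
- by move=> *; apply: com_sym => //; apply: com_colR => //; exact: ltnW.
- exact: (col_dressed (ltnW mb)).
- exact: (IH (ltnW mb)).
Qed.

Variables (S : pred I) (gam : nat -> K) (g : K).
Hypothesis E0 : forall c x y, (b <= c)%N -> S x || S y -> E c x y = 0.
Hypothesis gamE : forall c, (c < b)%N -> gam c = al * (b - c.+1)%:R + g.

Definition colT (m : nat) (x y : I) : Vs := \sum_(b <= c < m) E c x y.

Lemma colW_split m x y : (b <= m)%N -> colW m x y = colW b x y + colT m x y.
Proof.
move=> bm; rewrite /colW /colT -(big_mkord xpredT (fun c => E c x y)).
by rewrite (@big_cat_nat _ _ _ b) //= big_mkord.
Qed.

Lemma colT0 m x y : S x || S y -> colT m x y = 0.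
Proof. by move=> h; rewrite /colT big_nat big1 // => c /andP[bc _]; apply: E0. Qed.

Lemma com_E_tail c x y z w : (b <= c)%N -> com (E c x y) (colW b z w).
Proof. by move=> bc; apply: com_sym => //; apply: com_colW. Qed.

Lemma com_E_tailR c x y z w : (b <= c)%N -> com (E c x y) (colR b z w).
Proof. by move=> bc; apply: com_sym => //; apply: com_colR. Qed.

Definition pairs (p r : I) : Vs :=
  \sum_(c < L) \sum_u colW c u r *[-1] E c p u.

Definition derpart (p r : I) : Vs := \sum_(c < L) gam c *: der (E c p r).

(** Abel summation: [gam c] is [al] times the number of later full columns plus the constant [g], so
    weighting by [gam] amounts to summing partial sums. These are the derivatives absorbed in
    [colR]. *)
Lemma gam_colW m x y : (m <= b)%N ->
  \sum_(c < m) gam c *: E c x y =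
  \sum_(c < m) al *: colW c x y + (al * (b - m)%:R + g) *: colW m x y.
Proof.
elim: m => [_|m IH mb]; first by rewrite /colW !big_ord0 scaler0 addr0.
rewrite !big_ord_recr /= IH ?(ltnW mb) // gamE // colWS.
have -> : (b - m)%:R = (b - m.+1)%:R + 1 :> K by rewrite -natSK -subSn.
by vmod.
Qed.

Lemma colR_pairs m p r : \sum_(c < m) \sum_u colW c u r *[-1] E c p u
  = colR m p r + \sum_(c < m) al *: der (colW c p r).
Proof.
elim: m => [|m IH]; first by rewrite !big_ord0 addr0.
by rewrite !big_ord_recr /= IH /nextR /nextS; vmod.
Qed.

Lemma pairs_split p r : pairs p r - derpart p r =
  colR b p r - g *: der (colW b p r)
  + (\sum_(b <= c < L) \sum_u colW c u r *[-1] E c p u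
     - \sum_(b <= c < L) gam c *: der (E c p r)).
Proof.
rewrite /pairs /derpart.
rewrite -(big_mkord xpredT (fun c => \sum_u colW c u r *[-1] E c p u)).
rewrite -(big_mkord xpredT (fun c => gam c *: der (E c p r))).
rewrite !(@big_cat_nat _ _ _ b 0 L) //= !big_mkord colR_pairs.
have -> : \sum_(c < b) gam c *: der (E c p r) =
    \sum_(c < b) al *: der (colW c p r) + g *: der (colW b p r).
  under eq_bigr do rewrite -derZ; rewrite -der_sum gam_colW // subnn mulr0 add0r.
  by rewrite derD derZ der_sum; congr (_ + _); apply: eq_bigr => i _; rewrite derZ.
by vmod.
Qed.

Lemma pairs_block j l : S j -> S l ->
  pairs j l - derpart j l = colR b j l - g *: der (colW b j l).
Proof.
move=> Sj Sl; rewrite pairs_split !big_nat !big1 ?subrr ?addr0 // => c /andP[bc _].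
  by rewrite E0 ?Sj // /der vp0l scaler0.
by rewrite big1 // => u _; rewrite E0 ?Sj // vp0r.
Qed.

Lemma colW_block j l : S j -> colW L j l = colW b j l.
Proof. by move=> Sj; rewrite colW_split // colT0 ?Sj // addr0. Qed.

Section Target.
Variable Y : Vs.
Hypothesis tailY : forall c x y, (b <= c)%N -> com (E c x y) Y.
Hypothesis offY : forall x y, ~~ S x -> ~~ S y -> x != y -> com (colW b x y) Y.
Hypothesis diagY : forall x y, ~~ S x -> ~~ S y ->
  com (colW b x x - colW b y y) Y.
Hypothesis zeroY : forall x, ~~ S x -> colW b x x *[0] Y = 0.

Lemma colT_com m x y : com (colT m x y) Y.
Proof.
rewrite /colT big_nat; apply: com_sum => c /andP[bc _]; exact: tailY.
Qed.

Lemma colW_com m x y : (b <= m)%N -> ~~ S x -> ~~ S y -> x != y -> com (colW m x y) Y.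
Proof.
move=> bm Sx Sy xy; rewrite colW_split //; apply: comD; first exact: offY.
exact: colT_com.
Qed.

Lemma colW_com_diag x y : ~~ S x -> ~~ S y -> com (colW L x x - colW L y y) Y.
Proof.
move=> Sx Sy; rewrite ![colW L _ _]colW_split // opprD addrACA; apply: comD; first exact: diagY.
by apply: comD; [|apply: comN]; exact: colT_com.
Qed.

Lemma colW_zero x : ~~ S x -> colW L x x *[0] Y = 0.
Proof.
by move=> Sx; rewrite colW_split // vpDl zeroY // (colT_com L x x 0) addr0.
Qed.

Variables (D : pred I) (p r : I).
Hypothesis (pr : p != r) (Sp : ~~ S p) (Sr : ~~ S r) (Dp : ~~ D p) (Dr : ~~ D r).
Hypothesis SD : forall u, S u -> D u.

(** The form of [W^(2)] in which the block enters only through [D], the rows above it. The sum over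
    [r1 >= r2] equals the sum over all [r1, r2] minus that over [r1 < r2]; the latter extends the
    inner index of the first quadratic sum to all rows, which gives [pairs]. *)
Definition W2full (x y : I) : Vs :=
  pairs x y - derpart x y - \sum_(u | D u) colW L u y *[-1] colW L x u.

Hypothesis crossY : com1 (crossQ (colW b) (colR b) S p r) Y.

(** The part living on full columns is [crossQ] up to a derivative; everything else must commute
    with [Y], after one regrouping of mixed terms. *)
Lemma W2full_com1 : com1 (W2full p r - colW L r r *[-1] colW L p r) Y.
Proof.
have Du u : D u -> (u != p) && (u != r).
  by move=> Hu; apply/andP; split; apply: contraTneq Hu => ->.
(* [colW b r r *[-1] E c p r] is the one summand that need not commute with [Y]. Summed over the
   tail it gives [colW b r r *[-1] colT L p r], a part of the subtracted product [colW L r r *[-1]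
   colW L p r], so the two cancel. *)
pose tailc c : Vs := \sum_u colW c u r *[-1] E c p u - colW b r r *[-1] E c p r.
have tailcP c : (b <= c)%N -> com (tailc c) Y.
  move=> bc; rewrite /tailc (bigD1 r) //= (colW_split r r bc) vpDl.
  set T := colT c r r *[-1] _; set U := \sum_(u | _) _; set B := colW b r r *[-1] _.
  have -> : B + T + U - B = T + U by vmod.
  rewrite {}/T {}/U {B}.
  apply: comD; first exact: (comM ch _ (colT_com _ _ _) (tailY _ _ bc)).
  apply: com_sum => u ur; case: (boolP (S u)) => Su.
    by rewrite (E0 _ (y := u)) ?Su ?orbT // vp0r; exact: com0.
  by apply: (comM ch); [exact: colW_com | exact: tailY].
have -> : W2full p r - colW L r r *[-1] colW L p r =
  crossQ (colW b) (colR b) S p r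
  + (- (g *: der (colW b p r)) + \sum_(b <= c < L) tailc c
     - \sum_(b <= c < L) gam c *: der (E c p r)
     - \sum_(u | D u && ~~ S u) colW L u r *[-1] colW L p u
     - colT L r r *[-1] colW b p r - colT L r r *[-1] colT L p r).
  rewrite /W2full pairs_split /crossQ (bigID S) /=.
  rewrite (eq_bigl S) => [|u]; last by case: (boolP (S u)) => [/SD ->|]; rewrite ?andbF.
  rewrite (eq_bigr (fun u => colW b u r *[-1] colW b p u)) => [|u Su]; last first.
    by rewrite ![colW L _ _]colW_split // !colT0 ?Su ?orbT // !addr0.
  rewrite [colW L r r]colW_split // [colW L p r]colW_split // !vpE /tailc.
  rewrite sumrB -vp_sumr -/(colT L p r).
  by vmod.
apply: com1D crossY _; apply: com_com1.
apply: comD; first apply: comD; first apply: comD; first apply: comD; first apply: comD.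
- exact/comN/comZ/(com_der ch)/offY.
- by rewrite big_nat; apply: com_sum => c /andP[bc _]; exact: tailcP.
- apply: comN; rewrite big_nat; apply: com_sum => c /andP[bc _].
  exact/comZ/(com_der ch)/tailY.
- apply: comN; apply: com_sum => u /andP[/Du/andP[up ur] Su].
  by apply: (comM ch); apply: colW_com => //; rewrite eq_sym.
- by apply/comN/(comM ch); [exact: colT_com | exact: offY].
- by apply/comN/(comM ch); exact: colT_com.
Qed.

Hypothesis E_rp_ur : forall c c' u, E c r p *[0] E c' u r =
  (c' == c)%:R *: ((u == p)%:R *: E c r r - E c u p).
Hypothesis E_rp_pu : forall c c' u, E c r p *[0] E c' p u =
  (c' == c)%:R *: (E c r u - (u == r)%:R *: E c p p).
Hypothesis diagC :
  colW L r r *[-1] colW L p p = colW L p p *[-1] colW L r r.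

Let Z := colW L r p.

Let ZE_ur c u : (c < L)%N ->
  Z *[0] E c u r = (u == p)%:R *: E c r r - E c u p.
Proof.
move=> cL; rewrite /Z /colW vp_suml (bigD1 (Ordinal cL)) //= E_rp_ur eqxx.
rewrite scale1r big1 ?addr0 // => c' hc'; rewrite E_rp_ur.
by rewrite eq_sym (_ : (c' == c :> nat) = (c' == Ordinal cL)) // (negbTE hc') scale0r.
Qed.

Let ZE_pu c u : (c < L)%N ->
  Z *[0] E c p u = E c r u - (u == r)%:R *: E c p p.
Proof.
move=> cL; rewrite /Z /colW vp_suml (bigD1 (Ordinal cL)) //= E_rp_pu eqxx.
rewrite scale1r big1 ?addr0 // => c' hc'; rewrite E_rp_pu.
by rewrite eq_sym (_ : (c' == c :> nat) = (c' == Ordinal cL)) // (negbTE hc') scale0r.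
Qed.

Let ZW_ur m u : (m <= L)%N ->
  Z *[0] colW m u r = (u == p)%:R *: colW m r r - colW m u p.
Proof.
move=> mL; rewrite {1}/colW vp_sumr.
under eq_bigr => c _ do rewrite ZE_ur ?(leq_trans (ltn_ord c) mL) //.
by rewrite big_split sumrN -scaler_sumr.
Qed.

Let ZW_pu m u : (m <= L)%N ->
  Z *[0] colW m p u = colW m r u - (u == r)%:R *: colW m p p.
Proof.
move=> mL; rewrite {1}/colW vp_sumr.
under eq_bigr => c _ do rewrite ZE_pu ?(leq_trans (ltn_ord c) mL) //.
by rewrite big_split sumrN -scaler_sumr.
Qed.

(** [Z *[0]] acts as the adjoint action of [E_{rp}]. Its effects on the inner index cancel in the
    sum over all [u] and do not occur in the sum over [D], which contains neither [p] nor [r]. *)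
Lemma W2full_diag : Z *[0] W2full p r = W2full r r - W2full p p.
Proof.
have e1 : Z *[0] pairs p r = pairs r r - pairs p p.
  rewrite /pairs vp_sumr -sumrB; apply: eq_bigr => c _; rewrite vp_sumr.
  have h u : Z *[0] colW c u r *[-1] E c p u =
      colW c u r *[-1] E c r u - colW c u p *[-1] E c p u
      - (u == r)%:R *: colW c u r *[-1] E c p p
      + (u == p)%:R *: colW c r r *[-1] E c p u.
    rewrite vp_comm0 ZE_pu // ZW_ur ?(ltnW (ltn_ord c)) // !vpE.
    by vmod.
  under eq_bigr do rewrite h.
  by rewrite !big_split /= !sumrN !sum_deltal subrK.
have e2 : Z *[0] derpart p r = derpart r r - derpart p p.
  rewrite /derpart vp_sumr -sumrB; apply: eq_bigr => c _.
  by rewrite vpZr vp_der0 ZE_pu // eqxx derD derN scale1r scalerBr.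
have e3 : Z *[0] (\sum_(u | D u) colW L u r *[-1] colW L p u) =
    \sum_(u | D u) colW L u r *[-1] colW L r u
    - \sum_(u | D u) colW L u p *[-1] colW L p u.
  rewrite vp_sumr -sumrB; apply: eq_bigr => u Hu.
  have up : (u == p) = false by apply/eqP => e; rewrite e (negbTE Dp) in Hu.
  have ur : (u == r) = false by apply/eqP => e; rewrite e (negbTE Dr) in Hu.
  by rewrite vp_comm0 ZW_pu // ZW_ur // up ur !scale0r subr0 sub0r vpNl.
rewrite /W2full !(vpDr, vpNr) e1 e2 e3.
by vmod.
Qed.

Definition diagD : Vs := W2full r r - W2full p p
  - 2%:R^-1 *: colW L r r *[-1] colW L r r
  + 2%:R^-1 *: colW L p p *[-1] colW L p p.

Lemma diagD_com1 : com1 diagD Y.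
Proof.
have rp : r != p by rewrite eq_sym.
have two : 2%:R != 0 :> K := ch 1.
have Z0 : Z *[0] Y = 0 := colW_com bL Sr Sp rp 0.
have om : com (colW L r r - colW L p p) Y by exact: colW_com_diag.
(* Completing the square: [Z *[0]] sends [W_{rr} W_{pr}] to [- W_{rp} W_{pr} + W_{rr} (W_{rr} -
   W_{pp})]. The first term commutes with [Y], and half the square of [W_{rr} - W_{pp}], which
   commutes as well, leaves the difference of squares by [diagC]. *)
have -> : diagD = Z *[0] (W2full p r - colW L r r *[-1] colW L p r)
    - Z *[-1] colW L p r
    + 2%:R^-1 *: (colW L r r - colW L p p) *[-1] (colW L r r - colW L p p).
  rewrite vpDr vpNr W2full_diag vp_comm0 ZW_pu // ZW_ur // eqxx.
  rewrite (negbTE rp) scale1r scale0r sub0r !vpE -diagC /diagD -/Z.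
  by vmod; field.
apply: com1D; first apply: com1D.
- by apply: com1_vp0 => //; exact: W2full_com1.
- by apply/com_com1/comN/(comM ch); exact: colW_com.
- exact/com_com1/comZ/(comM ch).
Qed.

End Target.

(** The requirements on [Y] of the preceding section, bundled because they are stable under linear
    combinations and [der]. This reduces [W^(2) = R - g der W] on the first block to [R] and [W]. *)
Definition block_target (Y : Vs) : Prop :=
  [/\ forall c x y, (b <= c)%N -> com (E c x y) Y,
      forall x y, ~~ S x -> ~~ S y -> x != y -> com (colW b x y) Y,
      forall x y, ~~ S x -> ~~ S y -> com (colW b x x - colW b y y) Y,
      forall x, ~~ S x -> colW b x x *[0] Y = 0
    & forall p r, p != r -> ~~ S p -> ~~ S r ->
        com1 (crossQ (colW b) (colR b) S p r) Y].

Lemma com_linr (u v w : Vs) (c : K) : com u v -> com u w -> com u (v + c *: w).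
Proof. by move=> h k n; rewrite vpDr vpZr h k scaler0 addr0. Qed.

Lemma com_derr (u v : Vs) : com u v -> com u (der v).
Proof. by move=> /(com_sym ch) h; apply/(com_sym ch)/(com_der ch). Qed.

Lemma block_target_lin Y Y' (c : K) :
  block_target Y -> block_target Y' -> block_target (Y + c *: Y').
Proof.
case=> a1 a2 a3 a4 a5 [b1 b2 b3 b4 b5]; split=> *.
- by apply: com_linr; auto.
- by apply: com_linr; auto.
- by apply: com_linr; auto.
- by rewrite vpDr vpZr a4 // b4 // scaler0 addr0.
- by apply: com1Dr; [exact: a5 | apply: com1Zr; exact: b5].
Qed.

Lemma block_target_der Y : block_target Y -> block_target (der Y).
Proof.
case=> a1 a2 a3 a4 a5; split=> *.
- by apply: com_derr; auto.
- by apply: com_derr; auto.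
- by apply: com_derr; auto.
- by rewrite vp_der0 a4 // der0.
- by apply: com1_derr; exact: a5.
Qed.

Section BlockTargets.
Variables (j l : I).
Hypothesis (Sj : S j) (Sl : S l).

Let nj x : ~~ S x -> x != j. Proof. by apply: contraNneq => ->. Qed.
Let nl x : ~~ S x -> x != l. Proof. by apply: contraNneq => ->. Qed.
Let affb := col_affine (leqnn b).
Let dresb := col_dressed (leqnn b).

Lemma block_target_colW : block_target (colW L j l).
Proof.
rewrite colW_block //; split.
- by move=> c x y bc; apply: com_E_tail.
- by move=> x y Sx Sy xy; apply: (W_com_W affb) => //; [exact: nl | exact: nj].
- by move=> x y Sx Sy; apply: (W_diag_com_W affb); by [exact: nl | exact: nj].
- move=> x Sx; rewrite (aff0 affb).
  by rewrite (negbTE (nj Sx)) (negbTE (nl Sx)) !scale0r subrr.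
- move=> p r pr Sp Sr; apply: (crossQ_W ch affb dresb) => //.
  exact: negbTE.
Qed.

Lemma block_target_pairs : block_target (pairs j l - derpart j l).
Proof.
rewrite pairs_block // -scaleNr; apply: block_target_lin; last first.
  by apply: block_target_der; rewrite -colW_block //; exact: block_target_colW.
split.
- by move=> c x y bc; apply: com_E_tailR.
- by move=> x y Sx Sy xy; apply: (W_com_R dresb) => //; [exact: nl | exact: nj].
- by move=> x y Sx Sy; apply: (W_diag_com_R dresb); by [exact: nl | exact: nj].
- move=> x Sx; have [h _ _ _] := dresb.
  by rewrite h (negbTE (nj Sx)) (negbTE (nl Sx)) !scale0r subrr.
- move=> p r pr Sp Sr; apply: (crossQ_R ch dresb) => //.
    exact: negbTE.
  by apply: col_crossed => //; by [exact: nl | exact: nj].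
Qed.

End BlockTargets.

End Columns.

(** * The pyramid and its currents *)

Local Notation col := Defs.col.
Local Notation row := Defs.row.
Local Notation colE := Defs.colE.

Section Boxes.
Variable q : seq nat.
Hypothesis q_sorted : sorted geq q.

Lemma sorted_qs (s t : nat) : (s <= t)%N -> (t <= size q)%N -> (qs q t <= qs q s)%N.
Proof.
move=> st; case: t st => [|t] st tl; first by case: s st.
rewrite /qs /=; have trgeq : transitive geq by move=> a b c; rewrite /= => ab ca; apply: leq_trans ca ab.
apply: (sorted_leq_nth trgeq _ 0%N q_sorted) => //; first exact: leqnn.
- by rewrite inE; lia.
- by lia.
Qed.

Lemma qs_gt (s : nat) : (size q < s)%N -> qs q s = 0%N.
Proof. by case: s => // s h; rewrite /qs nth_default. Qed.

Lemma qs_le1 (s : nat) : (qs q s <= qs q 1)%N.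
Proof.
case: (leqP s (size q)) => h; last by rewrite qs_gt.
by case: s h => // s h; apply: sorted_qs.
Qed.

Lemma col_range (i : 'I_(pyr_N q)) : (1 <= col i <= size q)%N.
Proof. by rewrite /Defs.col /= reshape_indexP. Qed.

Definition inrow (s p : nat) : bool := (qs q 1 - qs q s < p <= qs q 1)%N.

Lemma row_range (i : 'I_(pyr_N q)) : inrow (col i) (row i).
Proof.
have h : (reshape_offset q i < qs q (col i))%N by apply: reshape_offsetP.
have := qs_le1 (col i); rewrite /inrow /row; lia.
Qed.

Lemma box_inj (i j : 'I_(pyr_N q)) : col i = col j -> row i = row j -> i = j.
Proof.
move=> hc; rewrite /Defs.row hc => /addIn[ho]; apply: val_inj => /=.
by rewrite -[LHS](reshape_indexK q) -[RHS](reshape_indexK q) ho; case: hc => ->.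
Qed.

Lemma box_ex (s p : nat) : (0 < s)%N -> inrow s p ->
  exists i : 'I_(pyr_N q), col i = s /\ row i = p.
Proof.
case: s => // s _; rewrite /inrow => hp.
set o := (p - (qs q 1 - qs q s.+1)).-1.
have ho : (o < nth 0 q s)%N by have := qs_le1 s.+1; rewrite /o {2}/qs /= in hp *; move: hp; rewrite /qs /=; lia.
exists (Ordinal (flatten_indexP ho)).
have hc : col (Ordinal (flatten_indexP ho)) = s.+1 by rewrite /Defs.col /= flatten_indexKl.
split=> //; rewrite /Defs.row hc /= flatten_indexKr // /o; lia.
Qed.

End Boxes.

(** * Operator products of the column currents *)

Section Currents.
Variables (K : fieldType) (ch : char0 K) (k : K) (q : seq nat).
Hypothesis q_sorted : sorted geq q.
Variable V : univ_valg (miura_data k q).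
Local Notation Vs := (va_space V).
Local Notation one := (va_vac V).
Local Notation "a *[ n ] b" := (@va_prod K V n a b).
Ltac vmod := module_eq K (va_space V).
Local Notation N := (pyr_N q).
Local Notation g := (uva_gen V).

Lemma lev_sum (a : 'I_N * 'I_N) :
  \sum_(z : lev q) (val z == a)%:R *: (g z : Vs) = lE V a.
Proof.
rewrite /lE; case: insubP => [y hy ya|hy].
  rewrite (bigD1 y) //= ya eqxx scale1r big1 ?addr0 // => z hz.
  case: eqP => [e|]; last by rewrite scale0r.
  by case/eqP: hz; apply: val_inj; exact: (etrans e (esym ya)).
rewrite big1 // => z _; case: eqP => [e|]; last by rewrite scale0r.
by move: hy; rewrite -e (valP z).
Qed.

Lemma lE_gen (a : 'I_N * 'I_N) (h : col a.1 == col a.2) : lE V a = g (Sub a h : lev q).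
Proof. by rewrite /lE insubT. Qed.

Lemma lE_ope0 (x y : 'I_N * 'I_N) : col x.1 = col x.2 -> col y.1 = col y.2 ->
  lE V x *[0] lE V y = (x.2 == y.1)%:R *: lE V (x.1, y.2)
                       - (x.1 == y.2)%:R *: lE V (y.1, x.2).
Proof.
move=> /eqP hx /eqP hy; rewrite (lE_gen hx) (lE_gen hy).
apply: (etrans (univ_ope0 (uva_univ V) (Sub x hx : lev q) (Sub y hy : lev q))).
rewrite /= scale0r addr0 -!lev_sum !scaler_sumr -sumrB; apply: eq_bigr => z _.
by rewrite /glbr -!mulnb !natrM scalerBl !scalerA.
Qed.

Lemma lE_ope1 (x y : 'I_N * 'I_N) : col x.1 = col x.2 -> col y.1 = col y.2 ->
  lE V x *[1] lE V y = (if col x.1 == col y.1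
    then glform (alpha k q (col x.1)) x y else 0) *: one.
Proof.
move=> /eqP hx /eqP hy; rewrite (lE_gen hx) (lE_gen hy).
exact: (univ_ope1 (uva_univ V) (Sub x hx : lev q) (Sub y hy : lev q)).
Qed.

Lemma lE_ope2 (x y : 'I_N * 'I_N) n : col x.1 = col x.2 -> col y.1 = col y.2 ->
  lE V x *[n.+2%:Z] lE V y = 0.
Proof.
move=> /eqP hx /eqP hy; rewrite (lE_gen hx) (lE_gen hy).
exact: (univ_ope2 (uva_univ V) (Sub x hx : lev q) (Sub y hy : lev q)).
Qed.

Lemma colE_box (i j : 'I_N) : col i = col j ->
  colE V (col i) (row i) (row j) = lE V (i, j).
Proof.
move=> hij; rewrite /Defs.colE (bigD1 i) //= [X in _ + X]big1 ?addr0.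
  rewrite (bigD1 j) /= ?[X in _ + X]big1 ?addr0 //; last by rewrite hij !eqxx.
  move=> j' /andP[/and4P[_ /eqP hc _ /eqP hr] /eqP[]].
  by apply: (box_inj _ hr); rewrite hc.
move=> i' hi'; apply: big1 => j' /and4P[/eqP hc _ /eqP hr _].
by move/eqP: hi' => []; apply: box_inj.
Qed.

Lemma colE_out (s p r : nat) : ~~ inrow q s p || ~~ inrow q s r || (s == 0)%N ->
  colE V s p r = 0.
Proof.
move=> h; rewrite /Defs.colE big1 // => i _; rewrite big1 // => j /and4P[/eqP ci /eqP cj /eqP ri /eqP rj].
have hi := row_range q_sorted i; have hj := row_range q_sorted j.
have /andP[h1 _] := col_range i.
by move: h; rewrite -{1}ci -{1}ri -{1}cj -{1}rj hi hj -ci gtn_eqF.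
Qed.

Variant colE_spec (s p r : nat) : Vs -> Type :=
| ColEin (i j : 'I_N) of col i = s & col j = s & row i = p & row j = r :
    colE_spec s p r (lE V (i, j))
| ColEout of ~~ (inrow q s p && inrow q s r && (0 < s)%N) : colE_spec s p r 0.

Lemma colEP s p r : colE_spec s p r (colE V s p r).
Proof.
case: (boolP (inrow q s p && inrow q s r && (0 < s)%N)) => [|h]; last first.
  rewrite colE_out; first exact: ColEout.
  by move: h; rewrite !negb_and -eqn0Ngt.
case/andP=> /andP[hp hr] s0.
have /cid[i [ci ri]] := box_ex q_sorted s0 hp.
have /cid[j [cj rj]] := box_ex q_sorted s0 hr.
have <- : lE V (i, j) = colE V s p r by rewrite -colE_box ?ci ?cj // ri rj.
exact: ColEin.
Qed.

Let boxE (i j : 'I_N) : col i = col j -> (i == j) = (row i == row j).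
Proof. by move=> hc; apply/eqP/eqP => [->|] //; apply: box_inj. Qed.

(** The factors [inrow] matter: if column [s] has row [x] but not row [y], the left side is zero,
    whereas [colE V s x w] may not be. *)
Lemma colE_ope0 s x y z w :
  colE V s x y *[0] colE V s z w =
    (inrow q s y && (y == z))%:R *: colE V s x w
    - (inrow q s x && (x == w))%:R *: colE V s z y.
Proof.
have s0 : colE V 0 x w = 0 /\ colE V 0 z y = 0 by rewrite !colE_out ?orbT.
case: (colEP s x y) => [i j ci cj ri rj|hxy]; last first.
  rewrite vp0l; case: s hxy s0 => [_ [-> ->]|s]; first by rewrite !scaler0 subrr.
  rewrite andbT negb_and => hxy _.
  case: (boolP (inrow q s.+1 x)) hxy => [_ /= hy|hx _] /=.
    by rewrite (negbTE hy) [colE V _ z y]colE_out ?hy ?orbT // !(scale0r, scaler0) subrr.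
  by rewrite [colE V _ x w]colE_out ?hx // !(scale0r, scaler0) subrr.
have hx : inrow q s x by rewrite -ci -ri; exact: row_range.
have hy : inrow q s y by rewrite -cj -rj; exact: row_range.
rewrite hx hy /=.
case: (colEP s z w) => [i' j' ci' cj' ri' rj'|hzw]; last first.
  rewrite vp0r; case: s hzw s0 {ci cj hx hy} (hx) (hy) => [_ [-> ->]|s] //.
    by rewrite !scaler0 subrr.
  rewrite andbT negb_and => hzw _ hx hy.
  case: (boolP (inrow q s.+1 z)) hzw => [_ /= hw|hz _].
    rewrite [colE V _ x w]colE_out ?hw ?orbT // scaler0 sub0r.
    by case: eqP => [e|]; [rewrite -e hx in hw | rewrite scale0r oppr0].
  rewrite [colE V _ z y]colE_out ?hz // scaler0 subr0.
  by case: eqP => [e|]; [rewrite -e hy in hz | rewrite scale0r].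
rewrite lE_ope0 ?ci ?ci' //= !boxE ?ci ?cj ?ci' ?cj' // ri rj ri' rj'.
by rewrite -!colE_box ?ci ?cj ?ci' ?cj' // ri rj ri' rj'.
Qed.

Lemma colE_ope1 s x y z w : inrow q s x -> inrow q s y -> inrow q s z -> inrow q s w ->
  (0 < s)%N ->
  colE V s x y *[1] colE V s z w =
    (alpha k q s * (y == z)%:R * (x == w)%:R + 1 * (x == y)%:R * (z == w)%:R) *: one.
Proof.
move=> hx hy hz hw s0.
case: (colEP s x y) => [i j ci cj ri rj|]; last by rewrite hx hy s0.
case: (colEP s z w) => [i' j' ci' cj' ri' rj'|]; last by rewrite hz hw s0.
rewrite lE_ope1 ?ci ?ci' //= eqxx /glform /=.
rewrite !boxE ?ci ?cj ?ci' ?cj' // ri rj ri' rj' -!mulnb !natrM [z == y]eq_sym.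
by congr (_ *: _); ring.
Qed.

Lemma colE_ope2 s x y z w n : colE V s x y *[n.+2%:Z] colE V s z w = 0.
Proof.
case: (colEP s x y) => [i j ci cj _ _|_]; last by rewrite vp0l.
case: (colEP s z w) => [i' j' ci' cj' _ _|_]; last by rewrite vp0r.
by rewrite lE_ope2 ?ci ?ci'.
Qed.

Lemma colE_com s t x y z w : s != t -> com (colE V s x y) (colE V t z w).
Proof.
move=> st n.
case: (colEP s x y) => [i j ci cj _ _|_]; last by rewrite vp0l.
case: (colEP t z w) => [i' j' ci' cj' _ _|_]; last by rewrite vp0r.
have ne (a b : 'I_N) : col a = s -> col b = t -> (a == b) = false.
  by move=> ha hb; apply: contraNF st => /eqP e; rewrite -ha -hb e.
case: n => [|[|n]].
- by rewrite lE_ope0 ?ci ?ci' //= (ne j i') // (ne i j') // !scale0r subrr.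
- by rewrite lE_ope1 ?ci ?ci' //= (negbTE st) scale0r.
- by rewrite lE_ope2 ?ci ?ci'.
Qed.

End Currents.

(** * Column heights and blocks of rows *)

Section Heights.
Variable q : seq nat.
Hypothesis (q_neq0 : q != [::]) (q_sorted : sorted geq q).
Hypothesis gap : forall a : nat, (1 <= a <= nvals q)%N ->
  (3 <= nval q a - nval q a.+1)%N.

(** The decrease is read off from [gap], a positive truncated difference; beyond the last distinct
    height [nval] takes the default value 0. *)
Lemma nval_anti (a a' : nat) : (1 <= a <= a')%N -> (nval q a' <= nval q a)%N.
Proof.
case/andP=> a1; elim: a' => [|a' IH]; first by rewrite leqNgt a1.
rewrite leq_eqVlt ltnS => /orP[/eqP <- //|aa']; apply: leq_trans (IH aa').
case: (leqP a' (nvals q)) => h; last by rewrite {1}/nval nth_default //=; exact: ltnW.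
by have := gap (a := a'); rewrite h (leq_trans a1 aa') => /(_ isT); lia.
Qed.

Lemma qs_nval (c : nat) : (1 <= c <= size q)%N ->
  exists2 a, (1 <= a <= nvals q)%N & qs q c = nval q a.
Proof.
move=> hc; have : qs q c \in undup q by rewrite mem_undup mem_nth //; case: c hc.
case/(nthP 0%N) => a ha e; exists a.+1; first exact: ha.
by rewrite -e.
Qed.

Lemma nval_le (a : nat) : (nval q a <= qs q 1)%N.
Proof.
case: (ltnP a.-1 (nvals q)) => h; last by rewrite /nval nth_default.
have : nval q a \in q by rewrite -mem_undup mem_nth.
case/(nthP 0%N) => c hc <-; exact: (qs_le1 q_sorted c.+1).
Qed.

Lemma nval1 : nval q 1 = qs q 1.
Proof.
have s1 : (1 <= 1 <= size q)%N by rewrite /= lt0n size_eq0.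
have [a /andP[a1 _] e] := qs_nval s1.
by apply/eqP; rewrite eqn_leq nval_le /= e nval_anti.
Qed.

(** Every column height is one of the [n_a], and columns are aligned at the row [q_1], so a column
    contains a block of rows entirely or not at all. *)
Lemma inrow_block (a c p r : nat) : in_block q a p -> in_block q a r ->
  (1 <= a <= nvals q)%N -> (0 < c)%N -> inrow q c p = inrow q c r.
Proof.
rewrite /in_block => hp hr ha c0; rewrite /inrow.
case: (leqP c (size q)) => hc; last first.
  by rewrite (qs_gt hc) subn0; apply/idP/idP; lia.
have [|a' ha' e] := @qs_nval c; first by rewrite c0.
have la := nval_le a.
case: (leqP a' a) => haa.
  have := @nval_anti a' a; rewrite haa; case/andP: ha' => -> _ /(_ isT) h.
  by rewrite e; apply/idP/idP; lia.
have := @nval_anti a.+1 a'; rewrite haa => /(_ isT) h.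
by have h' := nval_le a'; rewrite e; apply/idP/idP; lia.
Qed.

Definition fullcols : nat := find (fun x => x < qs q 1)%N q.

Lemma fullcols_le : (fullcols <= size q)%N.
Proof. exact: find_size. Qed.

Lemma qs_full (c : nat) : (c < fullcols)%N -> qs q c.+1 = qs q 1.
Proof.
move=> hc; have := before_find 0%N hc; have := qs_le1 q_sorted c.+1.
by rewrite /qs /=; lia.
Qed.

Lemma qs_tail (c : nat) : (fullcols <= c)%N -> (qs q c.+1 <= nval q 2)%N.
Proof.
move=> hc; case: (ltnP c (size q)) => cl; last by rewrite qs_gt.
have [|a /andP[a1 _] e] := @qs_nval c.+1; first by rewrite cl.
have hb : has (fun x => x < qs q 1)%N q by rewrite has_find (leq_ltn_trans hc cl).
have h : (qs q fullcols.+1 < qs q 1)%N := nth_find 0%N hb.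
have h2 : (qs q c.+1 <= qs q fullcols.+1)%N by apply: sorted_qs.
rewrite e; apply: nval_anti; case: a a1 e => [|[|a]] // _ e.
by move: h h2; rewrite e nval1; case: ltnP.
Qed.

End Heights.

(** * The elements [W^(1)] and [W^(2)] in terms of the columns *)

Section Family.
Variables (K : fieldType) (ch : char0 K) (k : K) (q : seq nat).
Hypothesis (q_neq0 : q != [::]) (q_sorted : sorted geq q).
Hypothesis gap : forall a : nat, (1 <= a <= nvals q)%N ->
  (3 <= nval q a - nval q a.+1)%N.
Variable V : univ_valg (miura_data k q).
Local Notation Vs := (va_space V).
Local Notation one := (va_vac V).
Local Notation "a *[ n ] b" := (@va_prod K V n a b).
Local Notation n := (qs q 1).
Local Notation b := (fullcols q).
Local Notation L := (size q).
Ltac vmod := module_eq K (va_space V).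

Definition column (c : nat) (x y : 'I_n) : Vs := colE V c.+1 x.+1 y.+1.
Let al : K := alpha k q 1.
Let gam (c : nat) : K := gamma k q c.+1.
Let S : pred 'I_n := fun u => (u < nval q 1 - nval q 2)%N.
Let D (a : nat) : pred 'I_n := fun u => (u < n - nval q a)%N.

Lemma alpha_full c : (c < b)%N -> alpha k q c.+1 = al.
Proof. by move=> hc; rewrite /al /alpha qs_full. Qed.

Lemma column_affine c : (c < b)%N -> affine al 1 (column c).
Proof.
move=> hc; have hin (x : 'I_n) : inrow q c.+1 x.+1.
  by rewrite /inrow qs_full // subnn /= ltn_ord.
split=> [x y z w|x y z w|m x y z w].
- by rewrite colE_ope0 // !hin !eqSS.
- by rewrite colE_ope1 // alpha_full // !eqSS.
- exact: colE_ope2.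
Qed.

Lemma column_com c c' x y z w : (c < b)%N -> c' != c ->
  com (column c x y) (column c' z w).
Proof. by move=> _ hc; apply: colE_com; rewrite // eqSS eq_sym. Qed.

Lemma column0 c x y : (b <= c)%N -> S x || S y -> column c x y = 0.
Proof.
move=> bc; have := qs_tail q_neq0 q_sorted gap bc.
rewrite /S (nval1 q_neq0 q_sorted gap) => h1 h2.
apply: colE_out => //; move: h2; rewrite orbF -negb_and; apply: contraL.
by rewrite /inrow; lia.
Qed.

(** The constant [gamma k q b] collects the [alpha] of the shorter columns. *)
Lemma gamma_full c : (c < b)%N -> gam c = al * (b - c.+1)%:R + gamma k q b.
Proof.
move=> hc; rewrite /gam /gamma (@big_cat_nat _ _ _ b.+1) //=; last exact: fullcols_le.
congr (_ + _); rewrite big_nat (eq_bigr (fun=> al)) => [|[|u] // /andP[_ hu]].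
  by rewrite -big_nat sumr_const_nat subSS mulr_natr.
exact: alpha_full.
Qed.

Lemma W1_column (p r : 'I_n) : W1_elt V p.+1 r.+1 = colW column L p r.
Proof. by rewrite /W1_elt /colW big_add1 /= big_mkord. Qed.

Lemma W2_column a (p r : 'I_n) : W2_elt V a p.+1 r.+1 =
  W2full column L gam (D a) p r.
Proof.
pose F c1 c2 (u : 'I_n) := column c1 u r *[-1] column c2 p u.
have -> : W2_elt V a p.+1 r.+1 =
    - derpart column L gam p r
    + \sum_(c1 < L) \sum_(c2 < L | (c1 < c2)%N) \sum_(u | ~~ D a u) F c1 c2 u
    - \sum_(c1 < L) \sum_(c2 < L | (c2 <= c1)%N) \sum_(u | D a u) F c1 c2 u.
  rewrite /W2_elt; congr (- _ + _ - _).
  - by rewrite big_add1 /= big_mkord.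
  - rewrite big_add1 /= big_mkord; apply: eq_bigr => c1 _.
    rewrite big_add1 /= (big_nat_widenl _ 0) // big_mkord; apply: eq_big => [c2|c2 _].
      by rewrite /= ?andbT.
    rewrite big_add1 /= (big_nat_widenl _ 0) // big_mkord.
    by apply: eq_bigl => u; rewrite /D /= ?andbT -leqNgt.
  - rewrite big_add1 /= big_mkord; apply: eq_bigr => c1 _.
    rewrite big_add1 /= (big_nat_widen _ _ L) ?(leq_trans _ (ltn_ord c1)) // big_mkord.
    apply: eq_big => [c2|c2 hc2]; first by rewrite /= ltnS.
    rewrite big_add1 /= (big_nat_widen _ _ n) ?leq_subr // (big_nat_widenl _ 0) // big_mkord.
    (* The lower bound [q_1 - q_{r2}] on the inner index may be dropped: in the rows above it the
       current of column [r2] is zero. *)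
    apply/esym; rewrite (bigID (fun u : 'I_n => n - qs q c2.+1 <= u)%N) /=.
    rewrite [X in _ + X = _]big1 ?addr0 => [|u /andP[_ hu]]; last first.
      have ho : ~~ inrow q c2.+1 u.+1 by rewrite /inrow; lia.
      by rewrite /F /column [colE V c2.+1 _ _]colE_out ?vp0r ?ho ?orbT.
    by apply: eq_bigl => u; rewrite /D.
have e1 : pairs column L p r =
    \sum_(c1 < L) \sum_(c2 < L | (c1 < c2)%N) \sum_u F c1 c2 u.
  rewrite /pairs [RHS](exchange_big_dep xpredT) //=; apply: eq_bigr => c2 _.
  rewrite [RHS]exchange_big; apply: eq_bigr => u _.
  by rewrite /colW vp_suml (big_ord_widen_cond _ xpredT (fun c => F c c2 u) (ltnW (ltn_ord c2))).
have e2 : \sum_(u | D a u) colW column L u r *[-1] colW column L p u =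
    \sum_(c1 < L) \sum_(c2 < L) \sum_(u | D a u) F c1 c2 u.
  rewrite (eq_bigr (fun u => \sum_(c1 < L) \sum_(c2 < L) F c1 c2 u)) => [|u _].
    by rewrite exchange_big; apply: eq_bigr => c1 _; rewrite exchange_big.
  by rewrite {1}/colW vp_suml; apply: eq_bigr => c1 _; rewrite vp_sumr.
rewrite /W2full e1 e2.
have -> : \sum_(c1 < L) \sum_(c2 < L | (c1 < c2)%N) \sum_u F c1 c2 u =
    \sum_(c1 < L) \sum_(c2 < L | (c1 < c2)%N) \sum_(u | ~~ D a u) F c1 c2 u
    + \sum_(c1 < L) \sum_(c2 < L | (c1 < c2)%N) \sum_(u | D a u) F c1 c2 u.
  rewrite -big_split; apply: eq_bigr => c1 _; rewrite -big_split.
  by apply: eq_bigr => c2 _; rewrite (bigID (D a)) /= addrC.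
have -> : \sum_(c1 < L) \sum_(c2 < L) \sum_(u | D a u) F c1 c2 u =
    \sum_(c1 < L) \sum_(c2 < L | (c1 < c2)%N) \sum_(u | D a u) F c1 c2 u
    + \sum_(c1 < L) \sum_(c2 < L | (c2 <= c1)%N) \sum_(u | D a u) F c1 c2 u.
  rewrite -big_split; apply: eq_bigr => c1 _.
  rewrite (bigID (fun c2 : 'I_L => c1 < c2)%N) /=; congr (_ + _).
  by apply: eq_bigl => c2; rewrite -leqNgt.
by vmod.
Qed.

Definition block_field (Y : Vs) : Prop := exists j l,
  [/\ (1 <= j <= nval q 1 - nval q 2)%N, (1 <= l <= nval q 1 - nval q 2)%N
    & Y = W1_elt V j l \/ Y = W2_elt V 1 j l].

Let rowP (j : nat) : (1 <= j <= n)%N -> exists j' : 'I_n, j = j'.+1.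
Proof. by case: j => // j hj; exists (Ordinal (hj : (j < n)%N)). Qed.

Let nval1n := nval1 q_neq0 q_sorted gap.

Lemma block_field_target Y : block_field Y -> block_target al column b S Y.
Proof.
case=> j [l [hj hl hY]].
have [j' ej] : exists j' : 'I_n, j = j'.+1 by apply: rowP; rewrite -nval1n; lia.
have [l' el] : exists l' : 'I_n, l = l'.+1 by apply: rowP; rewrite -nval1n; lia.
have Sj : S j' by rewrite /S /=; lia.
have Sl : S l' by rewrite /S /=; lia.
case: hY => ->; rewrite ej el.
  rewrite W1_column; apply: block_target_colW => //.
  - exact: fullcols_le.
  - exact: column_affine.
  - exact: column_com.
  - exact: column0.
(* No row lies above the first block, so [D 1] is empty. *)
rewrite W2_column /W2full big_pred0 ?subr0 => [|u]; last first.
  by rewrite /D nval1n subnn.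
apply: block_target_pairs => //.
- exact: fullcols_le.
- exact: column_affine.
- exact: column_com.
- exact: column0.
- exact: gamma_full.
Qed.

Section BlockA.
Variables (a : nat) (p r : nat) (Y : Vs).
Hypothesis (ha : (2 <= a <= nvals q)%N) (hp : in_block q a p) (hr : in_block q a r).
Hypothesis hY : block_field Y.

(* Read from the context by [lia] below. *)
Let na2 : (nval q a <= nval q 2)%N.
Proof. by apply: (nval_anti q_neq0 q_sorted gap); case/andP: ha => ->. Qed.

Let blockP x : in_block q a x ->
  exists x' : 'I_n, [/\ x = x'.+1, ~~ S x' & ~~ D a x'].
Proof.
move=> hx; have [|x' ex] := rowP (j := x); first by move: hx; rewrite /in_block; lia.
by exists x'; move: hx; rewrite /in_block /S /D nval1n ex; split=> //; lia.
Qed.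

Let SD u : S u -> D a u.
Proof. by rewrite /S /D nval1n; lia. Qed.

Lemma W1_com : p != r -> com (W1_elt V p r) Y.
Proof.
have [p' [-> Sp _]] := blockP hp; have [r' [-> Sr _]] := blockP hr => pr.
have [tailY offY _ _ _] := block_field_target hY.
rewrite W1_column; apply: (colW_com tailY offY) => //; exact: fullcols_le.
Qed.

Lemma W1_diag_zero : W1_elt V p p *[0] Y = 0.
Proof.
have [p' [-> Sp _]] := blockP hp.
have [tailY _ _ zeroY _] := block_field_target hY.
rewrite W1_column; apply: (colW_zero _ tailY zeroY) => //; exact: fullcols_le.
Qed.

Let outl c (x y : 'I_n) : ~~ inrow q c.+1 x.+1 -> colE V c.+1 x.+1 y.+1 = 0.
Proof. by move=> h; rewrite colE_out ?h. Qed.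
Let outr c (x y : 'I_n) : ~~ inrow q c.+1 y.+1 -> colE V c.+1 x.+1 y.+1 = 0.
Proof. by move=> h; rewrite colE_out ?h ?orbT. Qed.

(** A column contains both rows or neither, by [inrow_block]; the factors [inrow] can therefore be
    omitted. *)
Lemma column_ope_block (p' r' : 'I_n) : in_block q a p'.+1 ->
  in_block q a r'.+1 -> (forall c c' u,
  column c r' p' *[0] column c' u r' =
    (c' == c)%:R *: ((u == p')%:R *: column c r' r' - column c u p')) /\
  (forall c c' u, column c r' p' *[0] column c' p' u =
    (c' == c)%:R *: (column c r' u - (u == r')%:R *: column c p' p')).
Proof.
move=> hp' hr'; have ha1 : (1 <= a <= nvals q)%N by lia.
have hin c : inrow q c.+1 p'.+1 = inrow q c.+1 r'.+1.
  exact: (inrow_block q_neq0 q_sorted gap hp' hr' ha1).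
split=> c c' u; case: eqP => [->|/eqP cc]; rewrite /column.
- rewrite colE_ope0 // hin !eqSS eqxx andbT scale1r [(p' == u :> nat)]eq_sym.
  case: (boolP (inrow q c.+1 r'.+1)) => [_|hn]; first by rewrite /= scale1r.
  by rewrite outl // outr ?hin // !scaler0 !subr0.
- by rewrite (colE_com _ _ _ _ _ _ _ 0) ?scale0r // eqSS eq_sym.
- rewrite colE_ope0 // hin !eqSS eqxx andbT scale1r [(r' == u :> nat)]eq_sym.
  case: (boolP (inrow q c.+1 r'.+1)) => [_|hn]; first by rewrite /= scale1r.
  by rewrite outl // outl ?hin // !scaler0 !subr0.
- by rewrite (colE_com _ _ _ _ _ _ _ 0) ?scale0r // eqSS eq_sym.
Qed.

(** Within one column the product 1 need not vanish, but it is a multiple of the vacuum and enters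
    with the mode -3 of the vacuum, which is zero. *)
Lemma colE_diag_swap c c' x y : x != y ->
  colE V c x x *[-1] colE V c' y y = colE V c' y y *[-1] colE V c x x.
Proof.
move=> xy; have [<-|cc] := eqVneq c c'; last first.
  have h := colE_com q_sorted V x x y y cc.
  by rewrite -[colE V c' y y in LHS]vp1r (com_swap _ _ _ h) vp1r.
rewrite -[colE V c y y in LHS]vp1r vp_comm_current => [|m]; last exact: colE_ope2.
rewrite colE_ope0 // (negbTE xy) !andbF !scale0r subrr vp0l addr0.
suff [z ->] : exists z, colE V c x x *[1] colE V c y y = z *: one.
  by rewrite vpZl vp1l /= !scaler0 addr0 vp1r.
case: (colEP q_sorted V c x x) => [i j ci cj _ _|_]; last first.
  by exists 0; rewrite vp0l scale0r.
case: (colEP q_sorted V c y y) => [i' j' ci' cj' _ _|_]; last first.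
  by exists 0; rewrite vp0r scale0r.
by eexists; rewrite lE_ope1 ?ci ?ci'.
Qed.

Lemma W1_diag_swap x y : x != y ->
  W1_elt V x x *[-1] W1_elt V y y = W1_elt V y y *[-1] W1_elt V x x.
Proof.
move=> xy; rewrite /W1_elt !vp_suml.
under eq_bigr do rewrite vp_sumr.
rewrite exchange_big; apply: eq_bigr => c _; rewrite vp_sumr.
by apply: eq_bigr => c' _; exact: colE_diag_swap.
Qed.

Lemma W2_diag_com1 : p != r ->
  com1 (W2_elt V a r r - W2_elt V a p p
        - 2%:R^-1 *: W1_elt V r r *[-1] W1_elt V r r
        + 2%:R^-1 *: W1_elt V p p *[-1] W1_elt V p p) Y.
Proof.
have [p' [ep Sp Dp]] := blockP hp; have [r' [er Sr Dr]] := blockP hr => pr.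
have [tailY offY diagY zeroY crossY] := block_field_target hY.
move: hp hr pr; rewrite ep er => hp' hr'; rewrite eqSS => pr.
have swap := W1_diag_swap (x := r'.+1) (y := p'.+1).
have [h1 h2] := column_ope_block hp' hr'.
rewrite eqSS eq_sym in swap.
move: (swap pr); rewrite !W2_column !W1_column => sw.
apply: (diagD_com1 ch _ column0 gamma_full tailY offY diagY pr Sp Sr Dp Dr SD (crossY _ _ pr Sp Sr) h1 h2 sw).
exact: fullcols_le.
Qed.

End BlockA.

End Family.

(** * Modes in the completed enveloping algebra *)

Section VertexSpan.
Variables (K : fieldType) (V : valg K) (S : V -> Prop) (w : va_space V) (n : nat).
Hypothesis hS : forall u, S u -> forall j, (j <= n)%N -> va_prod j%:Z w u = 0.

(** For [j >= 0], commuting [w_(j)] past [u_(m)] produces only the products [w_(i) u] with [i <= j],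
    so annihilation up to [n] passes to all products. *)
Lemma va_span_annihilated u : va_span S u ->
  forall j, (j <= n)%N -> va_prod j%:Z w u = 0.
Proof.
elim=> {u} [u /hS //||c u v _ IHu _ IHv|m u v _ IHu _ IHv] j hj.
- exact: vp1r0.
- by rewrite vpDr vpZr IHu // IHv // scaler0 addr0.
- rewrite [LHS](vp_commn j m w u v) IHv // vp0r add0r big1 // => i _.
  by rewrite IHu ?vp0l ?scaler0 // -ltnS (leq_trans (ltn_ord i)).
Qed.
End VertexSpan.

Section Modes.
Variables (K : fieldType) (V : valg K).
Local Notation U := (ulalg V).

Lemma ul_lin c (u v : V) a : ul (c *: u + v) a = kscal U c * ul u a + ul v a.
Proof.
have : qpi (ul_rel (V := V)) (fgen (c *: u + v, a)) =
  qpi (ul_rel (V := V)) (kscal _ c * fgen (u, a) + fgen (v, a)).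
  by apply/qpi_eq; apply: ideal_gen; exact: Ul_lin.
by move=> h; rewrite /ul h rmorphD rmorphM khom_scal.
Qed.

Lemma ul0 a : ul (0 : V) a = 0.
Proof.
have := ul_lin (-1) (0 : V) 0 a; rewrite scaler0 addr0 rmorphN1 mulN1r addNr.
by [].
Qed.

Lemma ulD (u v : V) a : ul (u + v) a = ul u a + ul v a.
Proof. by have := ul_lin 1 u v a; rewrite scale1r rmorph1 mul1r. Qed.

Lemma ulZ c (u : V) a : ul (c *: u) a = kscal U c * ul u a.
Proof. by have := ul_lin c u 0 a; rewrite !addr0 ul0 addr0. Qed.

Lemma ul_commute (u v : V) (a b : int) :
  (forall j : nat, va_prod j%:Z u v = 0 \/ binz a j = 0 :> K) ->
  ul u a * ul v b = ul v b * ul u a.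
Proof.
move=> h; have [M hM] := core_trunc (va_core V) u v.
have e : qpi (ul_rel (V := V)) (fgen (u, a) * fgen (v, b)) =
  qpi (ul_rel (V := V)) (fgen (v, b) * fgen (u, a)
    + \sum_(r < M) kscal _ (binz a r) * fgen (va_prod r%:Z u v, a + b - r%:Z)).
  by apply/qpi_eq; rewrite opprD addrA; apply: ideal_gen; exact: Ul_bracket.
move: e; rewrite rmorphD 2!rmorphM rmorph_sum big1 ?addr0 // => r _.
rewrite rmorphM khom_scal; case: (h r) => ->; last by rewrite rmorph0 mul0r.
by rewrite -[X in _ * X]/(ul (0 : V) _) ul0 mulr0.
Qed.

Lemma ul_commute_com (u v : V) a b : com (u : va_space V) v ->
  ul u a * ul v b = ul v b * ul u a.
Proof. by move=> h; apply: ul_commute => j; left; exact: h. Qed.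

Lemma ul_commute0 (u v : V) b : va_prod 0 (u : va_space V) v = 0 ->
  ul u 0 * ul v b = ul v b * ul u 0.
Proof.
by move=> h; apply: ul_commute => -[|j]; [left | right; exact: (@binz_gt K 0)].
Qed.

Lemma ul_commute1 (u v : V) b : com1 (u : va_space V) v ->
  ul u 1 * ul v b = ul v b * ul u 1.
Proof.
by case=> h0 h1; apply: ul_commute => -[|[|j]];
  [left | left | right; exact: (@binz_gt K 1)].
Qed.

End Modes.

Lemma sum_consecutive (G : zmodType) (f : nat -> G) m :
  \sum_(i < m) (f i.+1 + f i) =
  \sum_(i < m) f i + f m - f 0%N + \sum_(i < m) f i.
Proof.
rewrite big_split /=; congr (_ + _).
have : \sum_(i < m.+1) f i = f 0%N + \sum_(i < m) f i.+1 by rewrite big_ord_recl.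
by rewrite big_ord_recr /= => ->; rewrite addrAC subrr add0r.
Qed.

Lemma sub_consecutive (G : zmodType) (a s t t0 v : G) :
  v = s + t - t0 + s -> a - (s + s) + t0 - t = a - v.
Proof. by move=> ->; zmod_eq G. Qed.

Lemma step_consecutive (G : zmodType) (a s s' t t' t0 : G) : s' = s + t ->
  a - (s' + s') + t0 - t' - (a - (s + s) + t0 - t) = - (t + t').
Proof. by move=> ->; zmod_eq G. Qed.

(** * Cauchy sequences and the modes of a normally ordered square *)

Section Completion.
Variables (K : fieldType) (ch : char0 K) (V : valg K) (wt : int -> V -> Prop).
Local Notation U := (ulalg V).
Local Notation A := (cauchyalg wt).

Lemma cseq_ex (x : nat -> U) : ul_cauchy wt x ->
  exists c : A, forall m, cseq c m = x m.
Proof. by move=> hx; exists (subalg_in (ul_cauchy_closed wt) hx). Qed.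

Lemma cseq_inj (c c' : A) : (forall m, cseq c m = cseq c' m) -> c = c'.
Proof. by move=> h; apply: val_inj; apply: funext. Qed.

Lemma cseqB (c c' : A) m : cseq (c - c') m = cseq c m - cseq c' m.
Proof. by []. Qed.
Lemma cseqM (c c' : A) m : cseq (c * c') m = cseq c m * cseq c' m.
Proof. by []. Qed.
Lemma cseq_scal k m : cseq (kscal A k) m = kscal U k.
Proof. by []. Qed.

Lemma ul_nbh_deg (n r : int) x : n < r -> ul_deg wt r x -> ul_nbh wt n x.
Proof.
move=> nr hx; rewrite -[x]addr0 -[x]mul1r.
exact: ul_nbhD nr hx (ul_nbh0 _ _).
Qed.

Lemma ul_bdeg_deg (r : int) B x : (absz r <= B)%N -> ul_deg wt r x -> ul_bdeg wt B x.
Proof. by move=> hr hx; rewrite -[x]addr0; exact: ul_bdegD hr hx (ul_bdeg0 _ _). Qed.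

Lemma ul_bdeg_sum B (m : nat) (F : nat -> U) : (forall i, ul_bdeg wt B (F i)) ->
  ul_bdeg wt B (\sum_(i < m) F i).
Proof.
move=> h; elim: m => [|m IH]; first by rewrite big_ord0; exact: ul_bdeg0.
by rewrite big_ord_recr /=; exact: ul_bdegDD.
Qed.

(** The neighbourhoods are additive subgroups, so consecutive differences decide. *)
Lemma ul_cauchy_steps (x : nat -> U) B : (forall m, ul_bdeg wt B (x m)) ->
  (forall n : nat, exists M : nat, forall m : nat, (M <= m)%N ->
     ul_nbh wt n%:Z (x m.+1 - x m)) ->
  ul_cauchy wt x.
Proof.
move=> hB hx; split; first by exists B.
move=> n; have [M hM] := hx n; exists M.
have h m : (M <= m)%N -> ul_nbh wt n%:Z (x m - x M).
  elim: m => [|m IH]; first by rewrite leqn0 => /eqP ->; rewrite subrr; exact: ul_nbh0.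
  rewrite leq_eqVlt => /orP[/eqP ->|]; first by rewrite subrr; exact: ul_nbh0.
  rewrite ltnS => Mm; rewrite -[x m.+1](subrK (x m)) -addrA.
  by apply: ul_nbhDD; [exact: hM | exact: IH].
move=> m m' hm hm'; have -> : x m - x m' = (x m - x M) - (x m' - x M) by zmod_eq (ulalg V).
exact: ul_nbhB (h _ hm) (h _ hm').
Qed.

Lemma null_completed (c : A) :
  (forall n : nat, exists M : nat, forall m, (M <= m)%N -> ul_nbh wt n%:Z (cseq c m)) ->
  completed_ideal c.
Proof.
move=> h n; exists 0; split; first exact: ideal0.
have [M hM] := h n; exists M => m /hM.
by rewrite -[cseq 0 m]/(0 : U) subr0.
Qed.

Lemma u_rel_completed (c : A) : u_rel c -> completed_ideal c.
Proof.
move=> h n; exists c; split; first exact: ideal_gen.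
by exists 0%N => m _; rewrite subrr; exact: ul_nbh0.
Qed.

Section Square.
Variable u : V.
Hypothesis (wt1 : wt 1 u) (wt2 : wt 2 (nprod (-1) u u)).

Let deg_mode (a : int) : ul_deg wt a (ul u a).
Proof. by have := ul_deg_gen a wt1; rewrite subrK. Qed.

Let deg_pair (a : int) : ul_deg wt 0 (ul u (- a) * ul u a).
Proof. by rewrite -[0](addNr a); exact: ul_degM (deg_mode _) (deg_mode _). Qed.

Definition mode_tail (m : nat) : U := ul u (- m%:Z) * ul u m%:Z.

Let bdeg_tail m : ul_bdeg wt 0 (mode_tail m).
Proof. by apply: (@ul_bdeg_deg 0); last exact: (deg_pair m%:Z). Qed.

Let nbh_pair (n i : nat) : (n < i)%N -> ul_nbh wt n%:Z (mode_tail i).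
Proof.
by move=> ni; apply: ul_nbhMl; apply: ul_nbh_deg (deg_mode _).
Qed.

(** The right factor [u t^m] has degree [m], which puts the product in the left ideals of all
    smaller degrees. *)
Lemma mode_tail_null : exists2 c : A, completed_ideal c & forall m, cseq c m = mode_tail m.
Proof.
have [|c hc] := @cseq_ex mode_tail; last first.
  exists c => //; apply: null_completed => n; exists n.+1 => m hm; rewrite hc.
  exact: nbh_pair.
apply: (@ul_cauchy_steps _ 0%N) => [m|n].
  exact: bdeg_tail.
by exists n.+1 => m hm; apply: ul_nbhB; apply: nbh_pair => //; exact: leqW.
Qed.

Definition mode_square (m : nat) : U := \sum_(i < m) mode_tail i.

(* In [(u_(-1) u) t] every pair of modes [u t^-j], [u t^j] with [j > 0] occurs
   twice and the square of the zero mode once, whereas [mode_square] starts at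
   [j = 0]. *)
Lemma mode_square_completed : exists2 c : A, completed_ideal c & forall m,
  cseq c m = ul (nprod (-1) u u) 1 - (mode_square m + mode_square m)
             + ul u 0 * ul u 0 - mode_tail m.
Proof.
pose x m := ul (nprod (-1) u u) 1 - (mode_square m + mode_square m)
  + ul u 0 * ul u 0 - mode_tail m.
pose asc (i : nat) : U := kscal U (binz (-1) i * (-1) ^+ i)
  * (ul u (-1 - i%:Z) * ul u (1 + i%:Z)
     - kscal U ((-1) ^ (-1 : int)) * (ul u (-1 + 1 - i%:Z) * ul u i%:Z)).
have ascE (i : nat) : asc i = mode_tail i.+1 + mode_tail i.
  rewrite /asc binzN1 // -exprMn mulrNN mulr1 expr1n rmorph1 mul1r exprN1 invrN invr1.
  rewrite rmorphN1 mulN1r opprK addNr sub0r /mode_tail -opprD.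
  by rewrite intS.
have e m : x m = ul (nprod (-1) u u) 1 - \sum_(i < m) asc i.
  have e0 : \sum_(i < m) asc i =
      mode_square m + mode_tail m - mode_tail 0 + mode_square m.
    apply: etrans (sum_consecutive mode_tail m).
    by apply: eq_bigr => i _; exact: ascE.
  exact: (sub_consecutive _ e0).
have [|c hc] := @cseq_ex x; last first.
  exists c => //; apply: u_rel_completed; apply: (@U_assoc _ _ _ u u (-1) 1) => m.
  by rewrite hc; exact: e.
apply: (@ul_cauchy_steps _ 0%N) => [m|n].
  apply: ul_bdegB; last exact: bdeg_tail.
  apply: ul_bdegDD; last exact: (bdeg_tail 0).
  apply: ul_bdegB; first by apply: (@ul_bdeg_deg 0); last exact: (ul_deg_gen 1 wt2).
  by apply: ul_bdegDD; apply: ul_bdeg_sum => i; exact: bdeg_tail.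
exists n.+1 => m hm.
have -> : x m.+1 - x m = - (mode_tail m + mode_tail m.+1).
  by apply: step_consecutive; rewrite /mode_square big_ord_recr.
rewrite -[- _]add0r; apply: ul_nbhB; first exact: ul_nbh0.
by apply: ul_nbhDD; apply: nbh_pair => //; exact: leqW.
Qed.
End Square.
End Completion.

Lemma commutator_perturb (R : pzRingType) (a c e x : R) :
  a = c + e -> c * x = x * c -> a * x - x * a = e * x - x * e.
Proof. by move=> -> h; rewrite mulrDl mulrDr h; zmod_eq R. Qed.

(** * Commutation with the image of a completed enveloping algebra *)

Section CommuteImage.
Variables (K : fieldType) (V1 V2 : valg K) (f : V1 -> V2).
Variables (wt1 : int -> V1 -> Prop) (wt2 : int -> V2 -> Prop).

Definition commutes_modes (c : ulalg V2) : Prop :=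
  forall u a, c * ul (f u) a = ul (f u) a * c.

Lemma ul_map_commute c x x' : commutes_modes c -> ul_map f x x' -> c * x' = x' * c.
Proof.
move=> hc; elim=> {x x'} [u a|k|x y x' y' _ hx _ hy|x y x' y' _ hx _ hy].
- exact: hc.
- exact/esym/kscalC.
- exact: commrD hx hy.
- exact: commrM hx hy.
Qed.

(** The commutator of [z] with the image is represented by that of [ce], hence by an element of the
    ideal. Only [ce] has to be a Cauchy sequence; [c] merely has to commute termwise. *)
Lemma ulim_commute_image a c (ce : cauchyalg wt2) (z : uva_env wt2) :
  ulim a z -> ideal (@completed_ideal K V2 wt2) ce ->
  (forall m, a m = c m + cseq ce m) -> (forall m, commutes_modes (c m)) ->
  forall z', @u_image K V1 V2 f wt1 wt2 z' -> z * z' = z' * z.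
Proof.
case=> ca [ha <-] ice hace hc z' [y [x [x' [hx _ [cx [hcx <-]]]]]].
rewrite -2!rmorphM; apply/qpi_eq.
have -> : ca * cx - cx * ca = ce * cx - cx * ce.
  apply: cseq_inj => m.
  rewrite (cseqB (ca * cx) (cx * ca)) (cseqM ca cx) (cseqM cx ca).
  rewrite (cseqB (ce * cx) (cx * ce)) (cseqM ce cx) (cseqM cx ce).
  apply: (@commutator_perturb _ _ (c m)).
    exact: (etrans (ha m) (hace m)).
  apply: etrans (congr1 (fun t => c m * t) (hcx m)) _.
  apply: etrans (ul_map_commute (hc m) (hx m)) _.
  exact: (congr1 (fun t => t * c m) (esym (hcx m))).
exact: (Defs.idealB (Defs.idealMr cx ice) (Defs.idealMl cx ice)).
Qed.

Lemma commutes_modesD c c' : commutes_modes c -> commutes_modes c' -> commutes_modes (c + c').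
Proof. by move=> h h' u a; apply/commr_sym/commrD; exact/commr_sym. Qed.
Lemma commutes_modesB c c' : commutes_modes c -> commutes_modes c' -> commutes_modes (c - c').
Proof. by move=> h h' u a; apply/commr_sym/commrB; exact/commr_sym. Qed.
Lemma commutes_modesM c c' : commutes_modes c -> commutes_modes c' -> commutes_modes (c * c').
Proof. by move=> h h' u a; apply/commr_sym/commrM; exact/commr_sym. Qed.
Lemma commutes_modes_scal k : commutes_modes (kscal _ k).
Proof. by move=> u a; exact: kscalC. Qed.
Lemma commutes_modes0 : commutes_modes 0.
Proof. by move=> u a; exact/commr_sym/commr0. Qed.
Lemma commutes_modes_sum (I : Type) (r : seq I) (P : pred I) (F : I -> ulalg V2) :
  (forall i, P i -> commutes_modes (F i)) -> commutes_modes (\sum_(i <- r | P i) F i).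
Proof.
move=> h; apply: (@big_ind _ commutes_modes) h.
  exact: commutes_modes0.
exact: commutes_modesD.
Qed.

End CommuteImage.

Lemma int_succ (s : nat) : s%:Z + 1 = s.+1%:Z. Proof. by lia. Qed.
Lemma opp_int_succ (s : nat) : - s%:Z - 1 = - s.+1%:Z. Proof. by lia. Qed.

Lemma mode_tailS (K : fieldType) (V : valg K) (u : V) (s : nat) :
  mode_tail u s.+1 = ul u (- s%:Z - 1) * ul u (s%:Z + 1).
Proof. by rewrite /mode_tail opp_int_succ int_succ. Qed.

Lemma sum_shift (G : zmodType) (f : nat -> G) m :
  \sum_(i < m) f i.+1 = \sum_(i < m) f i + f m - f 0%N.
Proof.
have : \sum_(i < m.+1) f i = f 0%N + \sum_(i < m) f i.+1 by rewrite big_ord_recl.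
by rewrite big_ord_recr /= => ->; rewrite addrAC subrr add0r.
Qed.

Lemma sum_split_last (G : zmodType) (f : nat -> nat -> G) (i m : nat) : (0 < i)%N ->
  \sum_(s < m) \sum_(1 <= u < i.+1) f s u =
  \sum_(s < m) \sum_(1 <= u < i) f s u + \sum_(s < m) f s i.
Proof.
by move=> i0; rewrite -big_split; apply: eq_bigr => s _; rewrite big_nat_recr.
Qed.

Lemma sum_split_first (G : zmodType) (f : nat -> nat -> G) (t : nat -> G) (i n m : nat) :
  (i < n)%N -> (forall s, f s i = t s.+1) ->
  \sum_(s < m) \sum_(i <= u < n) f s u =
  \sum_(s < m) t s.+1 + \sum_(s < m) \sum_(i.+1 <= u < n) f s u.
Proof.
by move=> i0 h; rewrite -big_split; apply: eq_bigr => s _; rewrite big_ltn // h.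
Qed.

(* [cU] and [cV] are the errors made when replacing the diagonal sums [A] and [B]
   by half of the modes [Uu] and [Vv] of the normally ordered squares. *)
Lemma diagonal_split (R : pzRingType)
  (h hf x1 x2 ky yy A B Bq s1 s2 s3 s4 t1 t4 Uu Vv u0 v0 tU tV cU cV : R) :
  h = hf + hf -> t1 = s1 + A -> t4 = B + s4 ->
  cU = Uu - (A + A) + u0 - tU -> cV = Vv - (Bq + Bq) + v0 - tV ->
  B = Bq + tV - v0 ->
  - (h * (x1 - x2)) - ky - h * yy + h * t1 + h * s2 - h * s3 - h * t4 =
  (h * (x2 - x1) + hf * (Uu - Vv) - ky - h * yy + hf * (u0 + v0)
   + h * s1 + h * s2 - h * s3 - h * s4) + hf * (cV - cU - tU - tV).
Proof.
move=> -> -> -> -> -> ->; rewrite !(mulrDl, mulrDr, mulrN, opprD, opprK).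
by zmod_eq R.
Qed.

Lemma factor_scalar (R : pzRingType) (h hf g x1 x2 u v : R) : h * g = hf ->
  h * (x2 - x1) + hf * (u - v) = h * (x2 - x1 - g * v + g * u).
Proof. by move=> <-; rewrite !(mulrDr, mulrN) !mulrA; zmod_eq R. Qed.

(** * The images of the Yangian generators against the modes of [Wtilde] *)

Section Commutant.
Variables (K : fieldType) (ch : char0 K) (k : K) (q : seq nat).
Hypothesis (q_neq0 : q != [::]) (q_sorted : sorted geq q).
Hypothesis gap : forall a : nat, (1 <= a <= nvals q)%N ->
  (3 <= nval q a - nval q a.+1)%N.
Variables (C : univ_vsalg (brst_data k q)) (V : univ_valg (miura_data k q)).
Local Notation Wa := (Walg C V).
Variables w1 w2 : nat -> nat -> Wa.
Hypothesis w_family : is_W_family w1 w2.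
Local Notation Wt := (Wtilde w1 w2).
Local Notation commutes := (@commutes_modes K Wt Wa (@Wtilde_val K k q C V w1 w2)).

Lemma Wval_inj : injective (@Wval K k q C V).
Proof. exact: val_inj. Qed.

Lemma Wval_prod n (u v : Wa) : Wval (nprod n u v) = va_prod n (Wval u) (Wval v).
Proof. by []. Qed.

Let nval1n : nval q 1 = qs q 1 := nval1 q_neq0 q_sorted gap.

Let nvals_gt0 : (0 < nvals q)%N.
Proof.
have s1 : (1 <= 1 <= size q)%N by rewrite /= lt0n size_eq0.
by have [a /andP[a1 an] _] := qs_nval s1; exact: leq_trans a1 an.
Qed.

Lemma Wtilde_gen_field u : Wtilde_gen w1 w2 u -> block_field (Wval u).
Proof.
have hb (j : nat) : (1 <= j <= nval q 1 - nval q 2)%N -> in_block q 1 j.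
  by rewrite /in_block nval1n subnn.
have h1 : (1 <= 1 <= nvals q)%N by rewrite nvals_gt0.
case=> i j hi hj; exists i, j; split=> //.
  by left; have [] := w_family h1 (hb _ hi) (hb _ hj).
by right; have [] := w_family h1 (hb _ hi) (hb _ hj).
Qed.

Lemma Wtilde_annihilated (x : Wa) (n : nat) :
  (forall y, block_field y -> forall j : nat, (j <= n)%N -> va_prod j%:Z (Wval x) y = 0) ->
  forall (u : Wt) (j : nat), (j <= n)%N -> va_prod j%:Z (x : va_space Wa) (Wtilde_val u) = 0.
Proof.
move=> h u; apply: (@va_span_annihilated K Wa (Wtilde_gen w1 w2) x n); last exact: subva_valP.
move=> y hy j hj; apply: Wval_inj.
by rewrite Wval_prod h //; exact: Wtilde_gen_field.
Qed.

Section Block.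
Variable a : nat.
Hypothesis ha : (2 <= a <= nvals q)%N.
Let ha1 : (1 <= a <= nvals q)%N. Proof. by case/andP: ha => h ->; rewrite (ltnW h). Qed.

Let w1E p r : in_block q a p -> in_block q a r -> Wval (w1 p r) = W1_elt V p r.
Proof. by move=> hp hr; have [] := w_family ha1 hp hr. Qed.
Let w2E p r : in_block q a p -> in_block q a r -> Wval (w2 p r) = W2_elt V a p r.
Proof. by move=> hp hr; have [] := w_family ha1 hp hr. Qed.

Lemma commutes_w1 p r m : in_block q a p -> in_block q a r -> p != r ->
  commutes (ul (w1 p r) m).
Proof.
move=> hp hr pr u b; apply: ul_commute_com => n.
apply: (@Wtilde_annihilated (w1 p r) n) (leqnn n) => y hy j _.
by rewrite w1E //; exact: (W1_com ch q_neq0 q_sorted gap ha hp hr hy pr).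
Qed.

(** The mode 0 involves only product 0. Product 1 with [W^(1)_{jj}] is a multiple of the vacuum that
    need not vanish, so other modes of [w1 p p] are out of reach. *)
Lemma commutes_w1_diag p : in_block q a p -> commutes (ul (w1 p p) 0).
Proof.
move=> hp u b; apply: ul_commute0.
apply: (@Wtilde_annihilated (w1 p p) 0 _ u 0) (leqnn 0) => y hy j.
rewrite leqn0 => /eqP ->; rewrite w1E //.
exact: (W1_diag_zero ch q_neq0 q_sorted gap ha hp hp hy).
Qed.

Definition w_diag p r : Wa := w2 r r - w2 p p
  - 2%:R^-1 *: nprod (-1) (w1 r r) (w1 r r) + 2%:R^-1 *: nprod (-1) (w1 p p) (w1 p p).

Lemma commutes_w_diag p r : in_block q a p -> in_block q a r -> p != r ->
  commutes (ul (w_diag p r) 1).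
Proof.
move=> hp hr pr u b; apply: ul_commute1.
have h y : block_field y -> forall j : nat, (j <= 1)%N ->
    va_prod j%:Z (Wval (w_diag p r)) y = 0.
  have -> : Wval (w_diag p r) = W2_elt V a r r - W2_elt V a p p
      - 2%:R^-1 *: va_prod (-1) (W1_elt V r r) (W1_elt V r r)
      + 2%:R^-1 *: va_prod (-1) (W1_elt V p p) (W1_elt V p p).
    by rewrite -!w1E // -!w2E.
  move=> hy; have [h0 h1] := W2_diag_com1 ch q_neq0 q_sorted gap ha hp hr hy pr.
  by case=> [|[|j]].
split; first exact: (Wtilde_annihilated h).
exact: (@Wtilde_annihilated (w_diag p r) 1 h u 1).
Qed.

Lemma Vwt1_zero : Vwt 1 (0 : V).
Proof.
(* Zero has weight 1 as the product [vac *[-2] vac], of weight [0 + 0 + 2 - 1]. *)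
have := Vwt_prod (-2) (Vwt_vac V) (Vwt_vac V).
by rewrite [nprod _ _ _](core_vacl (va_core V)).
Qed.

Lemma Vwt1D (u v : V) : Vwt 1 u -> Vwt 1 v -> Vwt 1 (u + v).
Proof. by move=> hu hv; rewrite -[u]scale1r; exact: Vwt_lin. Qed.

Lemma Vwt1_W1 p r : Vwt 1 (W1_elt V p r).
Proof.
apply: big_ind => [||s _]; [exact: Vwt1_zero | exact: Vwt1D |].
apply: big_ind => [||i _]; [exact: Vwt1_zero | exact: Vwt1D |].
apply: big_ind => [||j _]; [exact: Vwt1_zero | exact: Vwt1D |].
rewrite /lE; case: insub => [x|]; [exact: Vwt_gen | exact: Vwt1_zero].
Qed.

Lemma Wwt_w1 p r : in_block q a p -> in_block q a r -> Wwt 1 (w1 p r).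
Proof. by move=> hp hr; rewrite /Wwt w1E //; exact: Vwt1_W1. Qed.

Lemma Wwt_w1_square p : in_block q a p -> Wwt 2 (nprod (-1) (w1 p p) (w1 p p)).
Proof.
move=> hp; rewrite /Wwt Wval_prod w1E //.
exact: (Vwt_prod (-1) (Vwt1_W1 p p) (Vwt1_W1 p p)).
Qed.

Section PhiH.
Variable hbar : K.
Let d : nat := (nval q 1 - nval q a)%N.
Let n : nat := (nval q a - nval q a.+1)%N.
Let h : ulalg Wa := kscal _ hbar.
Let hf : ulalg Wa := kscal _ (hbar / 2%:R).

Lemma block_row (i : nat) : (1 <= i <= n)%N -> in_block q a (d + i).
Proof.
have hn := nval_le q_sorted a; move: hn.
by rewrite /in_block /d /n nval1n; clear; lia.
Qed.

Let two : 2%:R != 0 :> K := ch 1.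

Let h_half : h = hf + hf.
Proof.
rewrite /h /hf -rmorphD; congr (kscal _ _).
by rewrite -mulrDl -mulr2n -[hbar *+ 2]mulr_natr mulfK.
Qed.

Lemma scaled_w_diag (p r : nat) :
  h * (ul (w2 r r) 1 - ul (w2 p p) 1)
  + hf * (ul (nprod (-1) (w1 p p) (w1 p p)) 1 - ul (nprod (-1) (w1 r r) (w1 r r)) 1)
  = h * ul (w_diag p r) 1.
Proof.
have e : ul (w_diag p r) 1 = ul (w2 r r) 1 - ul (w2 p p) 1
   - kscal _ 2%:R^-1 * ul (nprod (-1) (w1 r r) (w1 r r)) 1
   + kscal _ 2%:R^-1 * ul (nprod (-1) (w1 p p) (w1 p p)) 1.
  rewrite /w_diag ulD ulZ; congr (_ + _).
  rewrite -scaleNr ulD ulZ rmorphN mulNr; congr (_ - _).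
  by rewrite -scaleN1r ulD ulZ rmorphN1 mulN1r.
apply: etrans (congr1 (fun x => h * x) (esym e)).
by apply: factor_scalar; rewrite /h /hf rmorphM.
Qed.

Let W (p r : nat) (m : int) : ulalg Wa := ul (w1 (d + p) (d + r)) m.

Let commutes_W (i j : nat) m : (1 <= i <= n)%N -> (1 <= j <= n)%N -> i != j ->
  commutes (W i j m).
Proof.
move=> hi hj ij; apply: commutes_w1; [exact: block_row | exact: block_row |].
by rewrite eqn_add2l.
Qed.

Let commutes_pair (i u : nat) (m m' : int) : (1 <= i <= n)%N -> (1 <= u <= n)%N -> u != i ->
  commutes (W i u m * W u i m').
Proof.
move=> hi hu ui; apply: commutes_modesM; apply: commutes_W => //.
by rewrite eq_sym.
Qed.

Let commutes_pairs (i b e m : nat) (f g : nat -> int) : (1 <= i <= n)%N -> (1 <= b)%N ->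
  (e <= n.+1)%N -> (forall u, (b <= u < e)%N -> u != i) ->
  commutes (\sum_(s < m) \sum_(b <= u < e) W i u (f s) * W u i (g s)).
Proof.
move=> hi b1 en hu; apply: commutes_modes_sum => s _.
rewrite big_nat; apply: commutes_modes_sum => u hbe.
apply: commutes_pair => //; last exact: hu.
by case/andP: hbe => h1 h2; rewrite (leq_trans b1 h1) -ltnS (leq_trans h2 en).
Qed.

(** In [c] the diagonal summands of the infinite sums are replaced by half of the modes of the
    squares of [u] and [v], plus zero modes. The modes of the squares combine with those of [w2]
    into [h * ul (w_diag ..) 1]; what is lost is a multiple of elements of the completed ideal. *)
Lemma Phi_H_perturb (i : nat) : (0 < i < n)%N ->
  exists (c : nat -> ulalg Wa) (ce : cauchyalg (@Wwt K k q C V)),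
  [/\ ideal (@completed_ideal K Wa (@Wwt K k q C V)) ce,
      forall m, Phi_H w1 w2 hbar a i m = c m + cseq ce m
    & forall m, commutes (c m)].
Proof.
move=> /andP[i0 iN].
have hi : (1 <= i <= n)%N by rewrite i0 ltnW.
have hi1 : (1 <= i.+1 <= n)%N by rewrite iN.
have bi := block_row hi; have bi1 := block_row hi1.
pose u := w1 (d + i) (d + i); pose v := w1 (d + i.+1) (d + i.+1).
have [cU iU eU] := mode_square_completed ch (Wwt_w1 bi bi) (Wwt_w1_square bi).
have [cV iV eV] := mode_square_completed ch (Wwt_w1 bi1 bi1) (Wwt_w1_square bi1).
have [tU jU fU] := mode_tail_null (Wwt_w1 bi bi).
have [tV jV fV] := mode_tail_null (Wwt_w1 bi1 bi1).
pose s1 m := \sum_(s < m) \sum_(1 <= x < i) W i x (- s%:Z) * W x i s%:Z.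
pose s2 m := \sum_(s < m) \sum_(i.+1 <= x < n.+1) W i x (- s%:Z - 1) * W x i (s%:Z + 1).
pose s3 m := \sum_(s < m) \sum_(1 <= x < i.+1) W i.+1 x (- s%:Z) * W x i.+1 s%:Z.
pose s4 m := \sum_(s < m) \sum_(i.+2 <= x < n.+1)
  W i.+1 x (- s%:Z - 1) * W x i.+1 (s%:Z + 1).
pose x1 := ul (w2 (d + i) (d + i)) 1; pose x2 := ul (w2 (d + i.+1) (d + i.+1)) 1.
pose Uu := ul (nprod (-1) u u) 1; pose Vv := ul (nprod (-1) v v) 1.
pose ky := kscal (ulalg Wa) (i%:R / 2%:R * hbar) * (W i i 0 - W i.+1 i.+1 0).
pose yy := W i i 0 * W i.+1 i.+1 0.
pose u0 := W i i 0 * W i i 0; pose v0 := W i.+1 i.+1 0 * W i.+1 i.+1 0.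
exists (fun m => h * (x2 - x1) + hf * (Uu - Vv) - ky - h * yy + hf * (u0 + v0)
   + h * s1 m + h * s2 m - h * s3 m - h * s4 m).
exists (kscal _ (hbar / 2%:R) * (cV - cU - tU - tV)); split.
- have iP c : completed_ideal c -> ideal (@completed_ideal K Wa (@Wwt K k q C V)) c.
    exact: ideal_gen.
  apply: Defs.idealMl.
  exact: (Defs.idealB (Defs.idealB (Defs.idealB (iP _ iV) (iP _ iU)) (iP _ jU)) (iP _ jV)).
- move=> m; rewrite cseqM 3!cseqB cseq_scal.
  have e1 : \sum_(s < m) \sum_(1 <= x < i.+1) W i x (- s%:Z) * W x i s%:Z =
      s1 m + mode_square u m.
    exact: (sum_split_last (fun s x => W i x (- s%:Z) * W x i s%:Z)).
  (* The diagonal term of row [i.+1] sits in the sum with [t^(-s-1)] and [t^(s+1)], so it starts at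
     mode 1, while that of row [i] starts at mode 0. The index shift is the source of the further
     [v0] and [tV] in [diagonal_split]. *)
  pose Bm := \sum_(s < m) mode_tail v s.+1.
  have e4 : \sum_(s < m) \sum_(i.+1 <= x < n.+1)
      W i.+1 x (- s%:Z - 1) * W x i.+1 (s%:Z + 1) = Bm + s4 m.
    exact: (@sum_split_first _ (fun s x => W i.+1 x (- s%:Z - 1) * W x i.+1 (s%:Z + 1))
      (mode_tail v) i.+1 n.+1 m iN (fun s => esym (mode_tailS v s))).
  exact: (diagonal_split x1 x2 ky yy (s2 m) (s3 m) h_half e1 e4
    (etrans (eU m) (congr1 (fun t => _ - t) (esym (fU m))))
    (etrans (eV m) (congr1 (fun t => _ - t) (esym (fV m))))
    (etrans (sum_shift (mode_tail v) m) (congr1 (fun t => _ + t - _) (esym (fV m))))).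
- move=> m.
  have cs := @commutes_modes_scal K Wt Wa (@Wtilde_val K k q C V w1 w2).
  have cW x : (1 <= x <= n)%N -> commutes (W x x 0).
    by move=> hx; apply: commutes_w1_diag; exact: block_row.
  have cMs x : commutes x -> commutes (h * x).
    by move=> hx; exact: (commutes_modesM (cs hbar) hx).
  have c1 : commutes (h * (x2 - x1) + hf * (Uu - Vv)).
    rewrite scaled_w_diag; apply: cMs; apply: commutes_w_diag => //.
    by rewrite eqn_add2l neq_ltn ltnSn.
  have c2 : commutes ky.
    exact: (commutes_modesM (cs _) (commutes_modesB (cW _ hi) (cW _ hi1))).
  have c3 : commutes (h * yy).
    exact: (cMs _ (commutes_modesM (cW _ hi) (cW _ hi1))).
  have c4 : commutes (hf * (u0 + v0)).
    exact: (commutes_modesM (cs _) (commutes_modesD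
      (commutes_modesM (cW _ hi) (cW _ hi)) (commutes_modesM (cW _ hi1) (cW _ hi1)))).
  have c5 : commutes (h * s1 m).
    apply: cMs; apply: (@commutes_pairs i 1 i m (fun s => - s%:Z) (fun s => s%:Z)) => //.
      by rewrite ltnW // ltnW.
    by move=> x /andP[_ hx]; rewrite neq_ltn hx.
  have c6 : commutes (h * s2 m).
    apply: cMs; apply: (@commutes_pairs i i.+1 n.+1 m (fun s => - s%:Z - 1) (fun s => s%:Z + 1)) => //.
    by move=> x /andP[hx _]; rewrite neq_ltn hx orbT.
  have c7 : commutes (h * s3 m).
    apply: cMs; apply: (@commutes_pairs i.+1 1 i.+1 m (fun s => - s%:Z) (fun s => s%:Z)) => //.
      by rewrite ltnS ltnW.
    by move=> x /andP[_ hx]; rewrite neq_ltn hx.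
  have c8 : commutes (h * s4 m).
    apply: cMs; apply: (@commutes_pairs i.+1 i.+2 n.+1 m (fun s => - s%:Z - 1) (fun s => s%:Z + 1)) => //.
    by move=> x /andP[hx _]; rewrite neq_ltn hx orbT.
  exact: (commutes_modesB (commutes_modesB (commutes_modesD (commutes_modesD
    (commutes_modesD (commutes_modesB (commutes_modesB c1 c2) c3) c4) c5) c6) c7) c8).
Qed.

End PhiH.

End Block.
End Commutant.

(** * The Yangian and the homomorphism into the centralizer *)

Lemma freealg_ind (K : fieldType) (X : choiceType) (P : freealg K X -> Prop) :
  (forall c, P (kscal _ c)) -> (forall x, P (fgen x)) ->
  (forall x y, P x -> P y -> P (x + y)) ->
  (forall x y, P x -> P y -> P (x * y)) -> forall x, P x.
Proof.
move=> Pc Pg PD PM x.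
have P0 : P 0 by have := Pc 0; rewrite rmorph0.
have Pm (m : {fmonom X}) : P (mkmalgU m 1).
  case: m => s; elim: s => [|y s IH].
    by have := Pc 1; rewrite /= /malgC -fmoneE.
  have -> : mkmalgU (FMonom (y :: s)) (1 : K) = fgen y * mkmalgU (FMonom s) 1 :> freealg K X.
    rewrite /fgen [RHS]malgM_def fgmulUU mulr1; congr mkmalgU.
    by apply: val_inj; rewrite /= [in RHS]/mmul /= fmmulE fmuE.
  exact: PM.
rewrite [x]monalgE; elim/big_ind: _ => // m _.
have -> : << x@_m *g m >> = kscal (freealg K X) x@_m * mkmalgU m 1.
  by rewrite /= [RHS]malgM_def fgmulUU mulr1 mul1m.
exact: PM.
Qed.

(** * Generation of the Yangian by the [X^+-_{i,0}] and the [H_{j,1}] with [j <> 0] *)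

Section Generators.
Variables (K : fieldType) (ch : char0 K) (n : nat) (hbar eps : K).
Hypothesis n3 : (3 <= n)%N.
Local Notation F := (freealg K (ygen n)).
Variable Q : F -> Prop.
Hypothesis (Qc : forall c, Q (kscal _ c))
  (QD : forall x y, Q x -> Q y -> Q (x + y))
  (QM : forall x y, Q x -> Q y -> Q (x * y))
  (Qrel : forall x y, y_rel hbar eps (x - y) -> Q x -> Q y).
Hypothesis (QX : forall s i, Q (yX K s i 0))
  (QH : forall i : 'I_n, (i != 0 :> nat)%N -> Q (yH K i 1)).

Let QZ c x : Q x -> Q (kscal _ c * x). Proof. exact: QM. Qed.
Let QB x y : Q x -> Q y -> Q (x - y).
Proof.
by move=> hx hy; apply: QD => //; rewrite -mulN1r -(rmorphN1 (kscal F)); exact: QZ.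
Qed.
Let Qcom x y : Q x -> Q y -> Q (x * y - y * x).
Proof. by move=> hx hy; apply: QB; exact: QM. Qed.

Let Q_unscale c x : c != 0 -> Q (kscal _ c * x) -> Q x.
Proof.
by move=> c0 /(QZ c^-1); rewrite mulrA -rmorphM mulVf // rmorph1 mul1r.
Qed.

Let QH0 i : Q (yH K i 0).
Proof.
have := Qrel (Y_X0X0 hbar eps i i) (Qcom (QX _ _) (QX _ _)).
by rewrite eqxx; apply: Q_unscale; exact: oner_neq0.
Qed.

Let QHt (i : 'I_n) : (i != 0 :> nat)%N ->
  Q (yH K i 1 - kscal _ (hbar / 2%:R) * (yH K i 0 * yH K i 0)).
Proof. by move=> hi; apply: QB; [exact: QH | apply: QZ; exact: QM]. Qed.

Let pm (s : bool) : K := if s then 1 else -1.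
Let pm0 s : pm s != 0.
Proof. by case: s; rewrite /pm ?oppr_eq0 oner_neq0. Qed.

Let QX1 s i : Q (yX K s i 1).
Proof.
have [i0|i0] := eqVneq (i : nat) 0%N; last first.
  have w : ~~ ((i == 0 :> nat) && (i == n.-1 :> nat))%N by rewrite (negbTE i0).
  have := Qrel (Y_H1X hbar eps s w w) (Qcom (QHt i0) (QX _ _)).
  by rewrite /cartan eqxx; apply: Q_unscale; rewrite mulf_neq0 ?pm0 //; exact: (ch 1).
have n1 : (1 < n)%N by exact: leq_trans n3.
(* [H_{0,1}] is not among the generators, so [X_{0,1}] is obtained from its neighbour [j = 1], where
   the Cartan entry is -1. As [n >= 3], the pair [(1, 0)] is not one of the exceptional pairs with
   shifted relations. *)
pose j : 'I_n := Ordinal n1.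
have w1 : ~~ ((j == 0 :> nat) && (i == n.-1 :> nat))%N by [].
have w2 : ~~ ((i == 0 :> nat) && (j == n.-1 :> nat))%N.
  by rewrite i0 /=; case: n n3 => [|[|[|]]].
have hj : (j != 0 :> nat)%N by [].
have := Qrel (Y_H1X hbar eps s w1 w2) (Qcom (QHt hj) (QX s i)).
have ji : (j == i) = false by apply/eqP => e; move: i0; rewrite -e.
rewrite /cartan ji i0 [(1 %% n)%N]modn_small // eqxx orbT.
by apply: Q_unscale; rewrite mulf_neq0 ?pm0 // oppr_eq0 oner_neq0.
Qed.

Let QH1 i : Q (yH K i 1).
Proof.
have := Qrel (Y_X1X0 hbar eps i i) (Qcom (QX1 _ _) (QX _ _)).
by rewrite eqxx; apply: Q_unscale; exact: oner_neq0.
Qed.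

(** Each missing generator is a nonzero multiple of a commutator modulo what is known: [H_{i,0}]
    from [[X^+_{i,0}, X^-_{i,0}]], [X_{i,1}] from [[H_{i,1} - (hbar/2) H_{i,0}^2, X_{i,0}]] for
    [i <> 0], and finally [H_{0,1}] from [[X^+_{0,1}, X^-_{0,0}]]. *)
Lemma yangian_generated x : Q x.
Proof.
have r01 (r : 'I_2) : r = 0 \/ r = 1.
  by case: r => [[|[|r]] hr] //; [left | right]; exact: val_inj.
apply: freealg_ind => // -[[[s i] r]|[i r]]; case: (r01 r) => ->.
- exact: QX.
- exact: QX1.
- exact: QH0.
- exact: QH1.
Qed.

End Generators.

Section Corestriction.
Variables (K : fieldType) (A B : kalg K) (P : B -> Prop) (HP : Defs.subalg_closed P).
Variables (phi : khom A B) (hphi : forall x, P (phi x)).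

Definition corestr_fun (x : A) : subalg HP := subalg_in HP (hphi x).

Lemma corestr_zmod : zmod_morphism corestr_fun.
Proof. by move=> x y; apply: val_inj; exact: (rmorphB phi). Qed.
Lemma corestr_monoid : monoid_morphism corestr_fun.
Proof.
by split=> [|x y]; apply: val_inj; [exact: (rmorph1 phi) | exact: (rmorphM phi)].
Qed.
HB.instance Definition _ :=
  GRing.isZmodMorphism.Build A (subalg HP) corestr_fun corestr_zmod.
HB.instance Definition _ :=
  GRing.isMonoidMorphism.Build A (subalg HP) corestr_fun corestr_monoid.

Lemma corestr_scal c : corestr_fun (kscal A c) = kscal (subalg HP) c.
Proof. by apply: val_inj; exact: khom_scal. Qed.

Definition corestr : khom A (subalg HP) := @KHom K A (subalg HP) corestr_fun corestr_scal.

End Corestriction.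

Section Commutation.
Variables (K : fieldType) (ch : char0 K) (k : K) (q : seq nat).
Hypothesis (q_neq0 : q != [::]) (q_sorted : sorted geq q).
Hypothesis gap : forall a : nat, (1 <= a <= nvals q)%N ->
  (3 <= nval q a - nval q a.+1)%N.
Variables (C : univ_vsalg (brst_data k q)) (V : univ_valg (miura_data k q)).
Variables (w1 w2 : nat -> nat -> Walg C V).
Hypothesis w_family : is_W_family w1 w2.
Variable a : nat.
Hypothesis ha : (2 <= a <= nvals q)%N.
Local Notation n := (nval q a - nval q a.+1)%N.
Variables (hbar eps : K) (Phi : khom (yangian n hbar eps) (UW C V)).
Hypothesis Phi_a : is_Phi w1 w2 a Phi.

Let commutes_image (z : UW C V) := forall y, image_UWtilde w1 w2 y -> z * y = y * z.

Let n3 : (3 <= n)%N.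
Proof. by apply: gap; case/andP: ha => h ->; rewrite (ltnW h). Qed.

Let ulim_w1 (p r : nat) m z : (1 <= p <= n)%N -> (1 <= r <= n)%N -> p != r ->
  ulim (fun=> ul (w1 (nval q 1 - nval q a + p) (nval q 1 - nval q a + r)) m) z ->
  commutes_image z.
Proof.
move=> hp hr pr hz y hy.
apply: (ulim_commute_image hz (ce := 0) _ _ _ hy); first exact: ideal0.
- by move=> m'; exact/esym/addr0.
- move=> m'; apply: (commutes_w1 ch q_neq0 q_sorted gap w_family ha).
  + exact: (block_row q_neq0 q_sorted gap).
  + exact: (block_row q_neq0 q_sorted gap).
  + by rewrite eqn_add2l.
Qed.

Lemma Phi_commutes y : commutes_image (Phi y).
Proof.
have [x <-] := qpi_surj y.
have n0 : (0 < n)%N by exact: leq_trans n3.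
apply: (@yangian_generated K ch n hbar eps n3 (fun x => commutes_image (Phi (qpi _ x)))) x.
- by move=> c z hz; rewrite khom_scal khom_scal kscalC.
- by move=> x1 x2 h1 h2 z hz; rewrite 2!rmorphD; exact: commr_sym (commrD (commr_sym (h1 z hz)) (commr_sym (h2 z hz))).
- by move=> x1 x2 h1 h2 z hz; rewrite 2!rmorphM; exact: commr_sym (commrM (commr_sym (h1 z hz)) (commr_sym (h2 z hz))).
- move=> x1 x2 hrel h1; have <- // : qpi (y_rel hbar eps) x1 = qpi (y_rel hbar eps) x2.
  by apply/qpi_eq; exact: ideal_gen.
- move=> s i; have := Phi_a i; case: ifP => [i0 [h1 h2]|/negbT i0 [h1 h2 _]].
    (* This makes [W_{n,1}] and [W_{1,n}] off-diagonal, so that they commute in the modes 1 and -1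
       as well. *)
    have n1 : n != 1 by rewrite neq_ltn (leq_trans _ n3) ?orbT.
    case: s.
      by apply: ulim_w1 h1; rewrite ?n0 ?leqnn.
    by apply: ulim_w1 h2; rewrite ?n0 ?leqnn // eq_sym.
  have hi : (1 <= i <= n)%N by rewrite lt0n i0 ltnW.
  have hi1 : (1 <= i.+1 <= n)%N by rewrite ltn_ord.
  case: s.
    by apply: ulim_w1 h1 => //; rewrite neq_ltn ltnSn.
  by apply: ulim_w1 h2 => //; rewrite neq_ltn ltnSn orbT.
- move=> i i0; have := Phi_a i; rewrite (negbTE i0) => -[_ _ h] z hz.
  have hi : (0 < i < n)%N by rewrite lt0n i0 ltn_ord.
  have [c [ce [h1 h2 h3]]] := Phi_H_perturb ch q_neq0 q_sorted gap w_family ha hbar hi.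
  exact: (ulim_commute_image h h1 h2 h3 hz).
Qed.

End Commutation.

Theorem theoremA12 (R : realType) (hbar k eps : R[i]) (q : seq nat)
    (hbar_neq0 : hbar != 0)
    (q_neq0 : q != [::]) (q_sorted : sorted geq q) (q_pos : all (leq 1) q)
    (eps_eq : eps = hbar * (k + (pyr_N q)%:R - (qs q (size q))%:R))
    (gap : forall a : nat, (1 <= a <= nvals q)%N ->
       (3 <= nval q a - nval q a.+1)%N)
    (C : univ_vsalg (brst_data k q)) (V : univ_valg (miura_data k q))
    (w1 w2 : nat -> nat -> Walg C V) (w_family : is_W_family w1 w2)
    (s : nat) (s_block : (2 <= s <= nvals q)%N)
    (Phi : khom (yangian (nval q s - nval q s.+1) hbar
                   (eps - ((nval q s)%:R - (qs q (size q))%:R) * hbar))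
                (UW C V))
    (Phi_s : is_Phi w1 w2 s Phi) :
  exists Psi : khom (yangian (nval q s - nval q s.+1) hbar
                       (eps - ((nval q s)%:R - (qs q (size q))%:R) * hbar))
                    (centralizer (image_UWtilde w1 w2)),
    forall y, subalg_incl _ (Psi y) = Phi y.
Proof.
have ch : char0 R[i] by move=> m; rewrite Num.Theory.pnatr_eq0.
by exists (corestr (centralizer_closed _)
  (Phi_commutes ch q_neq0 q_sorted gap w_family s_block Phi_s)).
Qed.
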